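(* Let $\gamma\in(0,1)$, $N_\gamma=\lfloor\gamma^{-1}\rfloor$, let $\mathbf W$ be a geometric rough path of regularity $\gamma$, let $f_1,\dots,f_d$ be vector fields on $\mathbb R^n$ of class $C^{2N_\gamma+1}_b$, and let $g\in C^{N_\gamma+1}(\mathbb R^n)$. For $(s,x)\in[0,T]\times\mathbb R^n$ let $X^{s,x}:[s,T]\to\mathbb R^n$ be the solution of the rough differential equation $\mathrm dX_t=\sum_{i=1}^df_i(X_t)\,\mathrm d\mathbf W^i_t$, $X_s=x$. Then $$u(s,x):=g(X^{s,x}_T)$$ is a regular solution of the rough transport equation $-\mathrm du_s=\sum_{i=1}^d\Gamma_iu_s\,\mathrm d\mathbf W^i_s$, $u(T,\cdot)=g$.
   Context: Words and rough paths. Fix $T>0$, $d,n\ge1$. A word is a finite sequence $w=(i_1,\dots,i_p)$ of letters in $\{1,\dots,d\}$, $|w|=p$; $\varepsilon$ is the empty word; $uv$ denotes concatenation. $H_N=\bigoplus_{p=0}^N(\mathbb R^d)^{\otimes p}$ has basis $e_w=e_{i_1}\otimes\cdots\otimes e_{i_p}$, $|w|\le N$, with $e_\varepsilon=\mathbf 1$; $(e_w^* )$ is the dual basis and $\mathbf 1^*=e_\varepsilon^*$. Let $ш$ denote the usual shuffle product of words, extended bilinearly. For $g,h\in H_N^*$ put $\langle g\star h,e_w\rangle=\sum_{uv=w}\langle g,e_u\rangle\langle h,e_v\rangle$. $G^{(N)}$ is the group (under $\star$, with identity $\mathbf 1^*$) of all $g\in H_N^*$ with $\langle g,\mathbf 1\rangle=1$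 and $\langle g,x\,ш\,y\rangle=\langle g,x\rangle\langle g,y\rangle$ for $x\in(\mathbb R^d)^{\otimes p}$, $y\in(\mathbb R^d)^{\otimes q}$, $p+q\le N$. A (weakly) geometric rough path of regularity $\gamma$ is a map $\mathbf W:[0,T]\to G^{(N_\gamma)}$ whose increments $\mathbf W_{st}=\mathbf W_s^{-1}\star\mathbf W_t$ satisfy $\sup_{s\ne t}|\langle\mathbf W_{st},e_w\rangle|/|t-s|^{|w|\gamma}<\infty$ for all $|w|\le N_\gamma$ (equivalently, $\mathbf W$ is $\gamma$-Hölder for a homogeneous left-invariant metric on $G^{(N_\gamma)}$). $C^k_b$: functions of class $C^k$ bounded together with all derivatives up to order $k$. Controlled paths. For $1\le N\le N_\gamma+1$, $\mathscr D^{N\gamma}_{\mathbf W}$ is the space of $\mathbf X:[0,T]\to H_{N-1}$ such that for $|w|\le N-1$ the path $t\mapsto\langle e_w^*,\mathbf X_t\rangle$ is $\gamma$-Hölder and $|\langle e_w^*,\mathbf X_t\rangle-\sum_{|v|\le N-1-|w|}\langle\mathbf W_{st},e_v\rangle\langle e_{vw}^*,\mathbf X_s\rangle|\le C|t-s|^{(N-|w|)\gamma}$ for $s<t$. $(\mathscr D^{N\gamma}_{\mathbf W})^n$: same for $\mathbb R^n$-valued coefficients. Composition. For $\phi\in C^N(\mathbb R^n,\mathbb R^m)$ and $\mathbf X\in(\mathscr D^{N\gamma}_{\mathbf W})^n$ with $X_t=\langle\mathbf 1^*,\mathbf X_t\rangle$, the lift $\mathbf\Phi(\mathbf X)\in(\mathscr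 D^{N\gamma}_{\mathbf W})^m$ of $\phi(X)$ has $\langle\mathbf 1^*,\mathbf\Phi(\mathbf X)_t\rangle=\phi(X_t)$ and, for $w\ne\varepsilon$, $\langle e_w^*,\mathbf\Phi(\mathbf X)_t\rangle=\sum_{k=1}^{|w|}\frac1{k!}\sum_{u_1,\dots,u_k\neq\varepsilon}\langle e_w^*,e_{u_1}ш\cdotsш e_{u_k}\rangle D^k\phi(X_t)(\langle e_{u_1}^*,\mathbf X_t\rangle,\dots,\langle e_{u_k}^*,\mathbf X_t\rangle)$. Rough integral. For $\mathbf Y\in\mathscr D^{N_\gamma\gamma}_{\mathbf W}$ with $Y=\langle\mathbf 1^*,\mathbf Y\rangle$: $\int_0^tY_u\,\mathrm d\mathbf W^i_u=\lim_{|\pi|\to0}\sum_{[a,b]\in\pi}\sum_{|w|\le N_\gamma-1}\langle e_w^*,\mathbf Y_a\rangle\langle\mathbf W_{ab},e_{wi}\rangle$ over partitions $\pi$ of $[0,t]$; $\int_0^\cdot\mathbf Y_u\,\mathrm d\mathbf W^i_u\in\mathscr D^{(N_\gamma+1)\gamma}_{\mathbf W}$ has $\mathbf 1^*$-coefficient $\int_0^tY\,\mathrm d\mathbf W^i$, $e_{wi}^*$-coefficient $\langle e_w^*,\mathbf Y_t\rangle$, and all others zero; $\int_s^t=\int_0^t-\int_0^s$. RDE solution. Define $F_\varepsilon=\mathrm{id}$, $F_{iw}(x)=DF_w(x)f_i(x)$. A path $X:[0,T]\to\mathbb R^n$ solves $\mathrm dX=\sum_if_i(X)\,\mathrm d\mathbf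 W^i$ if there is $\mathbf X\in(\mathscr D^{N_\gamma\gamma}_{\mathbf W})^n$ with $\langle\mathbf 1^*,\mathbf X_t\rangle=X_t$, $\langle e_w^*,\mathbf X_0\rangle=F_w(X_0)$ for $|w|\le N_\gamma-1$, and $\mathbf X_t-\mathbf X_s=\sum_{i=1}^d\int_s^t\mathbf F_i(\mathbf X)_u\,\mathrm d\mathbf W^i_u$ in $(H_{N_\gamma-1})^n$ for all $s<t$, where $\mathbf F_i(\mathbf X)$ is the lift of $f_i(X)$. For initial time $s$, replace $[0,T]$ by $[s,T]$ and time $0$ by $s$. For $f_i\in C^{N_\gamma+1}_b$ there is a unique global solution for each initial value. Differential operators. $\Gamma_i\phi(x)=f_i(x)\cdot D\phi(x)$, $\Gamma_w=\Gamma_{i_1}\circ\cdots\circ\Gamma_{i_p}$ for $w=(i_1,\dots,i_p)$, $\Gamma_\varepsilon=\mathrm{id}$. Regular solution of the transport equation. A function $u:[0,T]\times\mathbb R^n\to\mathbb R$ of class $\mathcal C^{\gamma,N_\gamma+1}$ (i.e. $\gamma$-Hölder in time, locally uniformly in $x$, and $N_\gamma+1$ times continuously differentiable in $x$, with these $x$-derivatives bounded on $[0,T]\times K$ for every compact $K$) with $u(T,\cdot)=g$ such that for every word $w$ with $|w|\le N_\gamma$ and every compact $K\subset\mathbb R^n$ there is a constant $C$ with $$\Big|\Gamma_wu_s(x)-\sum_{0\le|v|\le N_\gamma-|w|}\Gamma_{wv}u_t(x)\langle\mathbf W_{st},e_v\rangle\Big|\le C|t-s|^{(N_\gamma+1-|w|)\gamma}$$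 for all $s<t$ in $[0,T]$ and $x\in K$. *)

(* Defs.v *)
From HB Require Import structures.
From mathcomp Require Import all_boot all_order all_algebra.
From mathcomp Require Import all_classical all_reals all_analysis.

Set Implicit Arguments.
Unset Strict Implicit.
Unset Printing Implicit Defensive.

Import Order.TTheory GRing.Theory Num.Theory.
Import numFieldNormedType.Exports.

Local Open Scope ring_scope.

(** Elements of the dual of H_N are represented by functions on all words, and
    likewise H_N-valued paths by functions of time and words; every definition
    below only looks at the coefficients of the words that index H_N.
    Sums over the words of length at most m are sums over [m.-bseq 'I_d]. *)
Definition word (d : nat) := seq 'I_d.

(** The number N_gamma, the integer part of 1/gamma. *)
Definition Nreg (R : realType) (gam : R) : nat := Num.truncn gam^-1.

(** ** Shuffles and the group G^(N) *)

(** The terms, with multiplicity, of the shuffle product of two words: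
    (a u) sh (b v) = a (u sh (b v)) + b ((a u) sh v). *)
Fixpoint shuffle (A : Type) (u : seq A) : seq A -> seq (seq A) :=
  match u with
  | [::] => fun v => [:: v]
  | a :: u' =>
      fix shuffle_u (v : seq A) : seq (seq A) :=
        match v with
        | [::] => [:: u]
        | b :: v' =>
            [seq a :: w | w <- shuffle u' v] ++ [seq b :: w | w <- shuffle_u v']
        end
  end.

Fixpoint shuffles (A : Type) (us : seq (seq A)) : seq (seq A) :=
  match us with
  | [::] => [:: [::]]
  | u :: us' => flatten [seq shuffle u w | w <- shuffles us']
  end.

Definition star (R : realType) (d : nat) (g h : word d -> R) : word d -> R :=
  fun w => \sum_(k < (size w).+1) g (take k w) * h (drop k w).

Definition star1 (R : realType) (d : nat) : word d -> R :=
  fun w => (w == [::])%:R.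

(** Inverse for [star] of a functional [g] with [g [::] = 1], by the Neumann
    series of 1 - (1 - g); the terms of index k > |w| vanish at w. *)
Definition starV (R : realType) (d : nat) (g : word d -> R) : word d -> R :=
  fun w => \sum_(k < (size w).+1)
             iter k (star (fun v => star1 R v - g v)) (star1 R (d:=d)) w.

Lemma star_starV (R : realType) (d : nat) (g : word d -> R) :
  g [::] = 1 -> star g (starV g) =1 star1 R (d:=d).
Proof.
move=> g1 w; set h := fun v => star1 R v - g v.
pose p k := iter k (star h) (star1 R (d:=d)).
have p0 k v : (size v < k)%N -> p k v = 0.
  elim: k v => // k IH v; rewrite ltnS => vk.
  rewrite /p iterS /star; apply: big1 => -[[|j] jv] _ /=.
    by rewrite take0 /h /star1 eqxx g1 subrr mul0r.
  rewrite -/(p k _) IH ?mulr0 // size_drop.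
  rewrite ltnS in jv; apply: leq_trans vk.
  by rewrite ltn_subrL /= (leq_trans _ jv).
have invE m v : (size v < m)%N -> starV g v = \sum_(k < m) p k v.
  move=> vm; rewrite /starV (big_ord_widen m (fun k => p k v)) //.
  rewrite big_mkcond; apply: eq_bigr => i _.
  by case: ltnP => // ?; rewrite p0.
have E : star g (starV g) w = \sum_(k < (size w).+1) star g (p k) w.
  rewrite [LHS]/star /= exchange_big /=; apply: eq_bigr => j _.
  rewrite (invE (size w).+1) ?mulr_sumr // ltnS size_drop; exact: leq_subr.
have gE k : star g (p k) w = p k w - p k.+1 w.
  apply/eqP; rewrite eq_sym subr_eq addrC; apply/eqP.
  rewrite {2}/p iterS -/(p k) /star -big_split /=.
  rewrite big_ord_recl /= take0 drop0 /h /star1 eqxx g1 subrr mul0r mul1r add0r.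
  rewrite big1 ?addr0 // => -[j jw] _ /=.
  by case: w jw {E} => //= a w jw; rewrite sub0r mulNr addNr.
rewrite E; under eq_bigr do rewrite gE.
rewrite -(big_mkord xpredT (fun k => p k w - p k.+1 w)).
under eq_bigr do rewrite -opprB.
by rewrite sumrN telescope_sumr // opprB (p0 (size w).+1) // subr0.
Qed.

(** Multiplicativity on the tensor basis, which is multiplicativity for the
    bilinearly extended shuffle product. *)
Definition in_G (R : realType) (d N : nat) (g : word d -> R) : Prop :=
  g [::] = 1 /\
  forall u v : word d, (size u + size v <= N)%N ->
    \sum_(w <- shuffle u v) g w = g u * g v.

(** ** Rough paths and controlled paths *)

Definition incr (R : realType) (d : nat) (W : R -> word d -> R) (s t : R) :
    word d -> R :=
  star (starV (W s)) (W t).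

Definition geometric_rough_path (R : realType) (d : nat) (gam T : R)
    (W : R -> word d -> R) : Prop :=
  (forall t, t \in `[0, T] -> in_G (Nreg gam) (W t)) /\
  (forall w : word d, (size w <= Nreg gam)%N ->
     exists C : R, forall s t, s \in `[0, T] -> t \in `[0, T] -> s != t ->
       `|incr W s t w| / (`|t - s| `^ ((size w)%:R * gam)) <= C).

(** The space of paths controlled by W, of order N, over the time interval
    [a, b] and with coefficients in V. *)
Definition controlled (R : realType) (d : nat) (V : normedModType R)
    (gam : R) (N : nat) (W : R -> word d -> R) (a b : R)
    (X : R -> word d -> V) : Prop :=
  forall w : word d, (size w <= N.-1)%N ->
    (exists C : R, forall s t, s \in `[a, b] -> t \in `[a, b] ->
       `|X t w - X s w| <= C * `|t - s| `^ gam) /\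
    (exists C : R, forall s t, a <= s -> s < t -> t <= b ->
       `|X t w - \sum_(v : (N.-1 - size w).-bseq 'I_d)
                   incr W s t v *: X s (v ++ w)|
         <= C * `|t - s| `^ ((N - size w)%:R * gam)).

(** ** Differential calculus *)

(** [iterD [:: v1; ..; vk] f x] is D^k f(x)(v1, .., vk). *)
Definition iterD (R : realType) (V W : normedModType R) (vs : seq V)
    (f : V -> W) : V -> W :=
  foldr (fun v h x => 'D_v h x) f vs.

(** Class C^k; V is finite-dimensional in all uses, so continuity of the
    directional derivatives amounts to continuity of D^k f. *)
Fixpoint classC (R : realType) (V W : normedModType R) (k : nat)
    (f : V -> W) : Prop :=
  match k with
  | 0 => continuous f
  | k'.+1 => (forall x, differentiable f x) /\
             (forall v, classC k' (fun x => 'D_v f x))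
  end.

Definition partials (R : realType) (n : nat) (W : normedModType R)
    (js : seq 'I_n) (f : 'rV[R]_n -> W) : 'rV[R]_n -> W :=
  iterD [seq delta_mx 0 j | j <- js] f.

Definition classCb (R : realType) (n : nat) (W : normedModType R) (k : nat)
    (f : 'rV[R]_n -> W) : Prop :=
  classC k f /\
  forall js : seq 'I_n, (size js <= k)%N ->
    exists M : R, forall x, `|partials js f x| <= M.

(** ** Composition and rough integration *)

(** The factors u_j have length at most |w|, since otherwise the pairing of
    e_w with the shuffle product vanishes. *)
Definition lift_comp (R : realType) (d : nat) (V W : normedModType R)
    (phi : V -> W) (X : R -> word d -> V) (t : R) (w : word d) : W :=
  if w == [::] then phi (X t [::]) else
  \sum_(1 <= k < (size w).+1) (k`!%:R : R)^-1 *: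
    \sum_(us : k.-tuple ((size w).-bseq 'I_d) |
          [::] \notin [seq bseqval u | u <- us])
      let us' := [seq bseqval u | u <- us] in
      ((count_mem w (shuffles us'))%:R : R) *:
        iterD [seq X t u | u <- us'] phi (X t [::]).

(** Compensated Riemann sum over the partition a < s_1 < .. < s_r of an
    interval starting at a, for [s = [:: s_1; ..; s_r]]. *)
Definition rough_sum (R : realType) (d : nat) (V : normedModType R) (N : nat)
    (W : R -> word d -> R) (Y : R -> word d -> V) (i : 'I_d) (a : R)
    (s : seq R) : V :=
  let p := nth a (a :: s) in
  \sum_(0 <= k < size s) \sum_(w : N.-1.-bseq 'I_d)
     incr W (p k) (p k.+1) (rcons w i) *: Y (p k) w.

Definition mesh_lt (R : realType) (a : R) (s : seq R) (delta : R) : Prop :=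
  let p := nth a (a :: s) in
  forall k, (k < size s)%N -> p k.+1 - p k < delta.

(** [I] is the integral of Y against W^i over [a, b]. *)
Definition is_rough_int (R : realType) (d : nat) (V : normedModType R)
    (N : nat) (W : R -> word d -> R) (Y : R -> word d -> V) (i : 'I_d)
    (a b : R) (I : V) : Prop :=
  forall eps : R, 0 < eps -> exists2 delta : R, 0 < delta &
    forall s : seq R, itv_partition a b s -> mesh_lt a s delta ->
      `|rough_sum N W Y i a s - I| < eps.

(** The controlled path whose scalar part is the integral path [J] of Y
    against W^i: its coefficient at the word v i is that of Y at v, and the
    coefficients of all other nonempty words are zero. *)
Definition lift_int (R : realType) (d : nat) (V : normedModType R)
    (J : R -> V) (Y : R -> word d -> V) (i : 'I_d) (t : R) (w : word d) : V :=
  match w with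
  | [::] => J t
  | a :: w' => if last a w' == i then Y t (belast a w') else 0
  end.

(** ** Rough differential equations *)

Fixpoint Fword (R : realType) (d n : nat) (f : 'I_d -> 'rV[R]_n -> 'rV[R]_n)
    (w : word d) : 'rV[R]_n -> 'rV[R]_n :=
  match w with
  | [::] => id
  | i :: w' => fun x => 'D_(f i x) (Fword f w') x
  end.

(** X solves dX = sum_i f_i(X) dW^i on [a, b], with initial value x at a. *)
Definition rde_solution (R : realType) (d n : nat) (gam : R)
    (W : R -> word d -> R) (f : 'I_d -> 'rV[R]_n -> 'rV[R]_n) (a b : R)
    (x : 'rV[R]_n) (X : R -> 'rV[R]_n) : Prop :=
  let N := Nreg gam in
  X a = x /\
  exists XX : R -> word d -> 'rV[R]_n,
    [/\ controlled gam N W a b XX,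
        forall t, t \in `[a, b] -> XX t [::] = X t,
        forall w : word d, (size w <= N.-1)%N -> XX a w = Fword f w (X a) &
        exists J : 'I_d -> R -> 'rV[R]_n,
          (forall i t, t \in `[a, b] ->
             is_rough_int N W (lift_comp (f i) XX) i a t (J i t)) /\
          (forall s t, a <= s -> s < t -> t <= b ->
             forall w : word d, (size w <= N.-1)%N ->
             XX t w - XX s w =
               \sum_(i < d) (lift_int (J i) (lift_comp (f i) XX) i t w -
                             lift_int (J i) (lift_comp (f i) XX) i s w))].

(** ** The transport equation *)

Definition Gam (R : realType) (n : nat) (F : 'rV[R]_n -> 'rV[R]_n)
    (phi : 'rV[R]_n -> R) : 'rV[R]_n -> R :=
  fun x => 'D_(F x) phi x.

Definition Gamw (R : realType) (d n : nat) (f : 'I_d -> 'rV[R]_n -> 'rV[R]_n)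
    (w : word d) (phi : 'rV[R]_n -> R) : 'rV[R]_n -> R :=
  foldr (fun i => Gam (f i)) phi w.

(** gamma-Hoelder in time and C^k in space, locally uniformly. *)
Definition time_space_class (R : realType) (n : nat) (gam T : R) (k : nat)
    (u : R -> 'rV[R]_n -> R) : Prop :=
  [/\ forall K : set 'rV[R]_n, compact K ->
        exists C : R, forall s t x, s \in `[0, T] -> t \in `[0, T] -> K x ->
          `|u t x - u s x| <= C * `|t - s| `^ gam,
      forall s, s \in `[0, T] -> classC k (u s) &
      forall (K : set 'rV[R]_n) (js : seq 'I_n), compact K -> (size js <= k)%N ->
        exists C : R, forall s x, s \in `[0, T] -> K x ->
          `|partials js (u s) x| <= C].

Definition regular_solution (R : realType) (d n : nat) (gam T : R)
    (W : R -> word d -> R) (f : 'I_d -> 'rV[R]_n -> 'rV[R]_n)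
    (g : 'rV[R]_n -> R) (u : R -> 'rV[R]_n -> R) : Prop :=
  let N := Nreg gam in
  [/\ time_space_class gam T N.+1 u,
      forall x, u T x = g x &
      forall (w : word d) (K : set 'rV[R]_n), (size w <= N)%N -> compact K ->
        exists C : R, forall s t x, 0 <= s -> s < t -> t <= T -> K x ->
          `|Gamw f w (u s) x -
            \sum_(v : (N - size w).-bseq 'I_d)
               Gamw f (w ++ v) (u t) x * incr W s t v|
            <= C * `|t - s| `^ ((N.+1 - size w)%:R * gam)].

(* Main.v *)
(** The Euler map mu_st(x) = x + sum_(0 < |w| <= N) F_w(x) <W_st, e_w>, with N the
    integer part of 1/gamma, satisfies, by Chen's relation and the shuffle
    identities, mu_rt o mu_sr - mu_st = O(|t - s|^((N+1) gamma)) together with its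
    x-derivatives up to order N + 1; one more derivative costs one power of
    |t - s|^gamma.  Interpolating between these bounds gives the defect a Hoelder
    (N+1)-st derivative while keeping an exponent larger than 1 in |t - s|, so the
    compositions of mu along dyadic partitions stay bounded in C^(N+1,th).  The
    sewing lemma shows that a controlled solution satisfies
    X_t - mu_rt(X_r) = O(|t - r|^((N+1) gamma)); hence these compositions converge
    to the solution flow, which inherits the C^(N+1) bounds and is
    O(|t - s|^((N+1) gamma))-close to mu_st in C^N.  Finally u_s = u_t o flow_st:
    iterating over short time steps bounds u_s in C^(N+1) locally, and comparing
    u_t o flow_st with u_t o mu_st, whose Taylor expansion is the sum of
    Gamma_v u_t <W_st, e_v>, yields the expansion of Gamma_w u_s. *)

Require Import Defs.
From HB Require Import structures.
From mathcomp Require Import all_boot all_order all_algebra.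
From mathcomp Require Import all_classical all_reals all_analysis.
From mathcomp Require Import ring lra zify.
Set Implicit Arguments.
Unset Strict Implicit.
Unset Printing Implicit Defensive.

Import Order.TTheory GRing.Theory Num.Theory.
Import numFieldNormedType.Exports.

Local Open Scope ring_scope.

(** * Partial derivatives *)

Section PartialDerivatives.
Context {R : realType} {n : nat}.
Local Notation E := 'rV[R]_n.

(** The order 2N + 1 of differentiability of f is spent exactly. For a nonempty word v, F_v is |v| -
    1 Lie derivatives of some f_i, hence of class C^(2N+2-|v|). Expanding it along an Euler step to
    order N + 1 - |v| leaves N + 1 derivatives; expanding one order less leaves N + 2. These are the
    two defect bounds that get interpolated.

    An exponent th > 0 is required because bounds on N + 1 derivatives alone do not survive
    pointwise limits, while uniformly Hoelder derivatives do. It is paid for twice: in the exponent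
    of the defect, and when mu o D is compared with mu o B, where only the power 1 - th of the
    distance from D to B is gained. A second run with th = 0 provides the sharp rate in C^N.

    No flow is constructed. The solutions are given, each with an error constant that may depend on
    its starting point; this is enough to identify them pointwise with limits of dyadic
    compositions, and all uniformity comes from the latter. The flow property is deduced from
    uniqueness of paths that follow mu closely, without concatenating controlled paths. *)

Definition pd (l : 'I_n) (h : E -> R) : E -> R := fun x => 'D_(delta_mx 0 l) h x.

Lemma derive_pd (h : E -> R) v x : differentiable h x ->
  'D_v h x = \sum_l v 0 l * pd l h x.
Proof.
move=> dh; rewrite deriveE // {1}[v]row_sum_delta linear_sum /=.
by apply: eq_bigr => l _; rewrite linearZ /= /pd deriveE.
Qed.

Lemma differentiable_row (V : normedModType R) (B : V -> E) x :
  (forall l, differentiable (fun y => B y 0 l) x) -> differentiable B x.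
Proof.
move=> dB; have -> : B = \sum_l (fun y => B y 0 l *: delta_mx 0 l).
  by apply/funext => y; rewrite fct_sumE {1}[B y]row_sum_delta.
by apply: differentiable_sum => l; apply: differentiableZl.
Qed.

Lemma differentiable_coordfun (V : normedModType R) (B : V -> E) x l :
  differentiable B x -> differentiable (fun y => B y 0 l) x.
Proof.
move=> dB; apply: (@differentiable_comp _ _ _ _ B (fun M : E => M 0 l)) => //.
exact: differentiable_coord.
Qed.

Lemma derive_coord (V : normedModType R) (B : V -> E) x v l :
  differentiable B x -> ('D_v B x) 0 l = 'D_v (fun y => B y 0 l) x.
Proof.
move=> dB; rewrite !deriveE //; last exact: differentiable_coordfun.
rewrite (@diff_comp _ _ _ _ B (fun M : E => M 0 l)) //=; last exact: differentiable_coord.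
have L : linear (fun M : E => M 0 l : R) by move=> a b c; rewrite !mxE.
pose L' := GRing.isLinear.Build R E R *%R _ L.
pose f : {linear E -> R} := HB.pack (fun M : E => M 0 l : R) L'.
have -> : 'd (fun M : E => M 0 l : R) (B x) = f :> (E -> R).
  by apply: (@diff_lin _ _ _ f); exact: coord_continuous.
by [].
Qed.

Lemma pd_comp (h : E -> R) (B : E -> E) i x :
  differentiable B x -> differentiable h (B x) ->
  pd i (fun y => h (B y)) x = \sum_l pd l h (B x) * pd i (fun y => B y 0 l) x.
Proof.
move=> dB dh.
rewrite /pd deriveE; last exact: (@differentiable_comp _ _ _ _ B h).
rewrite (@diff_comp _ _ _ _ B h) //= -!deriveE // derive_pd //.
by apply: eq_bigr => l _; rewrite derive_coord // mulrC.
Qed.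

Lemma pdD (h k : E -> R) i x : differentiable h x -> differentiable k x ->
  pd i (fun y => h y + k y) x = pd i h x + pd i k x.
Proof. by move=> dh dk; apply: (@deriveD _ _ _ h k); exact: diff_derivable. Qed.

Lemma pdB (h k : E -> R) i x : differentiable h x -> differentiable k x ->
  pd i (fun y => h y - k y) x = pd i h x - pd i k x.
Proof. by move=> dh dk; apply: (@deriveB _ _ _ h k); exact: diff_derivable. Qed.

Lemma pdM (h k : E -> R) i x : differentiable h x -> differentiable k x ->
  pd i (fun y => h y * k y) x = pd i h x * k x + h x * pd i k x.
Proof.
move=> dh dk; rewrite [RHS]addrC [X in _ + X]mulrC.
by apply: (@deriveM _ _ h k); exact: diff_derivable.
Qed.

Lemma pdZ (h : E -> R) c i x : differentiable h x ->
  pd i (fun y => c * h y) x = c * pd i h x.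
Proof. by move=> dh; apply: (@deriveZ _ _ _ h c); exact: diff_derivable. Qed.

Lemma pd_cst (c : R) i x : pd i (fun=> c) x = 0.
Proof. by rewrite /pd deriveE; [rewrite diff_cst | exact: differentiable_cst]. Qed.

Lemma pd_coord (i l : 'I_n) x : pd i (fun y : E => y 0 l) x = (i == l)%:R.
Proof.
rewrite /pd -(@derive_coord E id) //=.
by rewrite derive_val mxE eqxx /= eq_sym.
Qed.

Lemma differentiable_bigsum (V : normedModType R) (I : Type) (r : seq I) (P : pred I)
    (h : I -> V -> R) x :
  (forall j, P j -> differentiable (h j) x) ->
  differentiable (fun y => \sum_(j <- r | P j) h j y) x.
Proof.
move=> dh; elim: r => [|j r IH].
  rewrite (_ : (fun _ => _) = cst 0); first exact: differentiable_cst.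
  by apply/funext => y; rewrite big_nil.
case Pj : (P j); last first.
  rewrite (_ : (fun _ => _) = fun y => \sum_(j <- r | P j) h j y) //.
  by apply/funext => y; rewrite big_cons Pj.
rewrite (_ : (fun _ => _) = h j + fun y => \sum_(j <- r | P j) h j y).
  by apply: differentiableD => //; apply: dh.
by apply/funext => y; rewrite big_cons Pj.
Qed.

Lemma pd_sum (I : Type) (r : seq I) (P : pred I) (h : I -> E -> R) i x :
  (forall j, P j -> differentiable (h j) x) ->
  pd i (fun y => \sum_(j <- r | P j) h j y) x = \sum_(j <- r | P j) pd i (h j) x.
Proof.
move=> dh; elim: r => [|j r IH].
  rewrite big_nil -[RHS](pd_cst 0 i x); congr (pd i _ x).
  by apply/funext => y; rewrite big_nil.
rewrite big_cons -IH; case: ifP => Pj; last first.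
  by congr (pd i _ x); apply/funext => y; rewrite big_cons Pj.
rewrite -pdD; [|exact: dh|exact: differentiable_bigsum].
by congr (pd i _ x); apply/funext => y; rewrite big_cons Pj.
Qed.

Lemma line_derive (h : E -> R) (x v : E) (t : R) : differentiable h (x + t *: v) ->
  is_derive t 1 (fun s : R => h (x + s *: v)) ('D_v h (x + t *: v)).
Proof.
move=> dh; pose g : R -> E := cst x + ( *:%R ^~ v).
have dl : is_diff t g (0 + ( *:%R ^~ v)) by exact: is_diffD.
have dd : differentiable (h \o g) t by apply: differentiable_comp.
split; first exact: diff_derivable.
rewrite (_ : (fun s => _) = h \o g) // deriveE // diff_comp //=.
by case: dl => _ ->; rewrite fctE /= add0r scale1r -deriveE.
Qed.

Lemma row_entry_le (v : E) l : `|v 0 l| <= `|v|.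
Proof.
by rewrite [leRHS]/Num.Def.normr /= mx_normrE; apply: (le_trans _ (@le_bigmax _ _ _ 0 (fun i : 'I_1 * 'I_n => `|v i.1 i.2|) (0, l))).
Qed.

Lemma row_norm_le (v : E) C : 0 <= C -> (forall l, `|v 0 l| <= C) -> `|v| <= C.
Proof.
move=> C0 vC; rewrite /Num.Def.normr /= mx_normrE; apply/bigmax_leP; split => // -[i l] _ /=.
by rewrite (ord1 i); exact: vC.
Qed.

Lemma mean_value (h dh : R -> R) :
  (forall t : R, is_derive t (1 : R) h (dh t)) -> forall t : R, 0 <= t ->
  exists2 c, 0 <= c <= t & h t - h 0 = dh c * t.
Proof.
move=> hd t t0.
have [|c] := @MVT_segment R h dh 0 t t0 (fun x _ => hd x).
  apply: continuous_subspaceT => x; apply: differentiable_continuous.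
  by apply/derivable1_diffP; have [] := hd x.
by rewrite in_itv /= subr0 => ? ?; exists c.
Qed.

Lemma line_increment (h : E -> R) (x v : E) (C t : R) :
  (forall y, differentiable h y) -> 0 <= t ->
  (forall s, 0 <= s <= t -> `|'D_v h (x + s *: v)| <= C) ->
  `|h (x + t *: v) - h x| <= C * t.
Proof.
move=> dh t0 hC.
have [c ct /=] := mean_value (fun s => line_derive (dh (x + s *: v))) t0.
by rewrite scale0r addr0 => ->; rewrite normrM (ger0_norm t0) ler_wpM2r // hC.
Qed.

Definition convex_set (S : set E) := forall x y t, S x -> S y -> 0 <= t <= 1 ->
  S (x + t *: (y - x)).

Lemma directional_le (h : E -> R) x v C : differentiable h x -> 0 <= C ->
  (forall l, `|pd l h x| <= C) -> `|'D_v h x| <= n%:R * C * `|v|.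
Proof.
move=> dh C0 hC; rewrite derive_pd //; apply: (le_trans (ler_norm_sum _ _ _)).
apply: (@le_trans _ _ (\sum_(l < n) C * `|v|)).
  by apply: ler_sum => l _; rewrite normrM mulrC ler_pM // row_entry_le.
by rewrite sumr_const card_ord -mulrA mulr_natl.
Qed.

Lemma lipschitz_of_pd (S : set E) (h : E -> R) C :
  (forall x, differentiable h x) -> 0 <= C -> convex_set S ->
  (forall x l, S x -> `|pd l h x| <= C) ->
  forall x y, S x -> S y -> `|h x - h y| <= n%:R * C * `|x - y|.
Proof.
move=> dh C0 cS hC x y Sx Sy.
have := @line_increment h y (x - y) (n%:R * C * `|x - y|) 1 dh ler01.
rewrite scale1r subrKC mulr1; apply => s s01.
by apply: directional_le => // l; apply: hC; apply: cS.
Qed.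

End PartialDerivatives.

(** * Symmetry of second partial derivatives *)

Section Schwarz.
Context {R : realType} {n : nat}.
Local Notation E := 'rV[R]_n.

Lemma continuous_dist (V V' : normedModType R) (h : V -> V') x : {for x, continuous h} ->
  forall e : R, 0 < e -> exists2 d : R, 0 < d & forall y, `|y - x| < d -> `|h y - h x| < e.
Proof.
move=> ch e e0; have : \forall y \near x, `|h x - h y| < e by exact: cvgr_dist_lt h (h x) ch e e0.
move=> /nbhs_normP[d d0 hd].
exists d => // y yx; rewrite distrC; apply: hd; rewrite /= distrC //.
Qed.

Lemma dist_continuous (V V' : normedModType R) (h : V -> V') x :
  (forall e : R, 0 < e -> exists2 d : R, 0 < d & forall y, `|y - x| < d -> `|h y - h x| < e) ->
  {for x, continuous h}.
Proof.
move=> H; apply/cvgrPdist_lt => e e0; have [d d0 hd] := H e e0.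
by apply/nbhs_normP; exists d => // y /=; rewrite distrC => /hd; rewrite distrC.
Qed.

Lemma pd_line_mvt (h : E -> R) i x (t : R) : (forall y, differentiable h y) -> 0 <= t ->
  exists2 c, 0 <= c <= t &
    h (x + t *: delta_mx 0 i) - h x = pd i h (x + c *: delta_mx 0 i) * t.
Proof.
move=> dh t0; have [c ct /=] := mean_value (fun s => line_derive (dh (x + s *: delta_mx 0 i))) t0.
by rewrite scale0r addr0; exists c.
Qed.

Lemma pd_coord_shift i l (a x : E) : pd i (fun y => (y + a) 0 l) x = (i == l)%:R.
Proof.
rewrite -(pd_coord i l x) (_ : (fun y => _) = fun y : E => y 0 l + a 0 l).
  rewrite (pdD i (differentiable_coord _ _ _) (differentiable_cst _ _)).
  by rewrite pd_cst addr0.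
by apply/funext => y; rewrite mxE.
Qed.

(** The mean value theorem is used twice: along e_i for the increment k of h in direction e_j, then
    along e_j for [pd i h]. *)
Lemma second_difference (h : E -> R) i j x (t : R) :
  (forall y, differentiable h y) -> (forall y, differentiable (pd i h) y) -> 0 <= t ->
  exists c c', [/\ 0 <= c <= t, 0 <= c' <= t &
    (h (x + t *: delta_mx 0 i + t *: delta_mx 0 j) - h (x + t *: delta_mx 0 i)) -
    (h (x + t *: delta_mx 0 j) - h x) =
    pd j (pd i h) (x + c *: delta_mx 0 i + c' *: delta_mx 0 j) * t ^+ 2].
Proof.
move=> dh di t0.
pose k y := h (y + t *: delta_mx 0 j) - h y.
have ds z : differentiable (fun y => y + t *: delta_mx 0 j : E) z.
  by apply: differentiableD => //; apply: differentiable_cst.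
have dk y : differentiable k y.
  apply: differentiableB => //.
  by apply: (@differentiable_comp _ _ _ _ (fun y => y + t *: delta_mx 0 j) h).
have [c ct] := pd_line_mvt i x dk t0.
have -> : pd i k (x + c *: delta_mx 0 i) = pd i h (x + c *: delta_mx 0 i + t *: delta_mx 0 j)
     - pd i h (x + c *: delta_mx 0 i).
  have dsh : differentiable (fun y => h (y + t *: delta_mx 0 j)) (x + c *: delta_mx 0 i).
    by apply: (@differentiable_comp _ _ _ _ (fun y => y + t *: delta_mx 0 j) h).
  rewrite (pdB i dsh (dh _)).
  rewrite (@pd_comp _ _ h (fun y => y + t *: delta_mx 0 j) i _ (ds _) (dh _)) (bigD1 i) //= big1 ?addr0.
    by rewrite pd_coord_shift eqxx mulr1.
  by move=> l li; rewrite pd_coord_shift eq_sym (negbTE li) mulr0.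
have [c' ct'] := pd_line_mvt j (x + c *: delta_mx 0 i) di t0.
move=> -> E; exists c, c'; split => //; by rewrite expr2 mulrA -E.
Qed.

Lemma dist_half_lt (z A B r : R) : `|z - A| < r / 2 -> `|z - B| < r / 2 -> `|A - B| < r.
Proof.
move=> zA zB; have -> : A - B = (z - B) - (z - A) by ring.
by rewrite [r]splitr; apply: le_lt_trans (ler_normB _ _) (ltrD zB zA).
Qed.

(** A second difference is symmetric in i and j, so by [second_difference] the two mixed derivatives
    take a common value at points arbitrarily close to x; continuity then identifies them at x. *)
Lemma pd_comm (h : E -> R) i j :
  (forall y, differentiable h y) -> (forall l y, differentiable (pd l h) y) ->
  (forall l m, continuous (pd m (pd l h))) -> pd i (pd j h) = pd j (pd i h).
Proof.
move=> dh dp cp; apply/funext => x; apply/eqP; rewrite -subr_eq0 -normr_le0 leNgt.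
apply/negP; set e := `|_| => e0.
have e3 : 0 < e / 2 by rewrite divr_gt0.
have [d1 d10 h1] := continuous_dist (cp j i x) e3.
have [d2 d20 h2] := continuous_dist (cp i j x) e3.
pose M : R := `|delta_mx 0 i : E| + `|delta_mx 0 j : E| + 1.
(* M exceeds |e_i| + |e_j|, so a step t below min d1 d2 / M keeps both intermediate points within
   reach of the two moduli of continuity. *)
have M0 : 0 < M by rewrite ltr_wpDl // addr_ge0.
pose t := Num.min d1 d2 / (2 * M).
have t0 : 0 < t by rewrite divr_gt0 ?mulr_gt0 // lt_min d10.
have small c c' : 0 <= c <= t -> 0 <= c' <= t -> forall a b : E, `|a| + `|b| + 1 = M ->
    `|x + c *: a + c' *: b - x| < Num.min d1 d2.
  move=> /andP[c0 ct] /andP[c0' ct'] a b abM.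
  have -> : x + c *: a + c' *: b - x = c *: a + c' *: b by rewrite -[X in X - x]addrA [LHS]addrC addKr.
  rewrite (_ : Num.min d1 d2 = t * (2 * M)); last by rewrite /t divfK // mulf_neq0 ?gt_eqF.
  apply: (le_lt_trans (ler_normD _ _)); rewrite !normrZ (ger0_norm c0) (ger0_norm c0').
  have := normr_ge0 a; have := normr_ge0 b; nra.
have [c [c' [hc hc' E1]]] := second_difference j x dh (dp i) (ltW t0).
have [b [b' [hb hb' E2]]] := second_difference i x dh (dp j) (ltW t0).
have E3 : pd j (pd i h) (x + c *: delta_mx 0 i + c' *: delta_mx 0 j) =
          pd i (pd j h) (x + b *: delta_mx 0 j + b' *: delta_mx 0 i).
  apply: (@mulIf _ (t ^+ 2)); first by rewrite expf_neq0 // gt_eqF.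
  apply: etrans (esym E1) _; apply: etrans _ E2.
  have -> : x + t *: delta_mx 0 j + t *: delta_mx 0 i = x + t *: delta_mx 0 i + t *: delta_mx 0 j.
    exact: addrAC.
  have sw (p q r s : R) : p - q - (r - s) = p - r - (q - s) by ring.
  exact: sw.
have P : `|pd i (pd j h) (x + b *: delta_mx 0 j + b' *: delta_mx 0 i) - pd i (pd j h) x| < e / 2.
  apply: h1; apply: lt_le_trans (small b b' hb hb' _ _ _) _; first by rewrite (addrC `|_|).
  by rewrite ge_min lexx.
have Q : `|pd j (pd i h) (x + c *: delta_mx 0 i + c' *: delta_mx 0 j) - pd j (pd i h) x| < e / 2.
  apply: h2; apply: lt_le_trans (small c c' hc hc' _ _ _) _; first by [].
  by rewrite ge_min lexx orbT.
by rewrite E3 in Q; have := dist_half_lt P Q; rewrite ltxx.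
Qed.

End Schwarz.

(** * Hoelder classes *)

Section HolderClasses.
Context {R : realType} {n : nat}.
Local Notation E := 'rV[R]_n.

Definition hb0 (th : R) (S : set E) (C : R) (h : E -> R) : Prop :=
  [/\ continuous h, forall x, S x -> `|h x| <= C &
    forall x y, S x -> S y -> `|h x - h y| <= 2 * C * `|x - y| `^ th].

(* For [th = 0] the Hoelder clause follows from the bound, so [hb 0 k S C] is a
   plain C^k bound on S; the factor 2 serves that purpose. *)
Fixpoint hb (th : R) (k : nat) (S : set E) (C : R) (h : E -> R) : Prop :=
  hb0 th S C h /\
  if k is k'.+1 then (forall x, differentiable h x) /\
                     (forall l, hb th k' S C (pd l h)) else True.

(** On the empty set every bound is vacuous, so only the qualitative content of [hb] remains: global
    differentiability with continuous derivatives up to order k. *)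
Definition smooth (k : nat) (h : E -> R) := hb 0 k set0 0 h.

Lemma hb_hb0 th k S C h : hb th k S C h -> hb0 th S C h.
Proof. by case: k => [|k] []. Qed.

Lemma hb_bound th k S C h x : hb th k S C h -> S x -> `|h x| <= C.
Proof. by move=> /hb_hb0[_ H _]; exact: H. Qed.

Lemma hb_continuous th k S C h : hb th k S C h -> continuous h.
Proof. by move=> /hb_hb0[]. Qed.

Lemma hb_differentiable th k S C h x : hb th k.+1 S C h -> differentiable h x.
Proof. by case=> _ [d _]; exact: d. Qed.

Lemma hb_pd th k S C h l : hb th k.+1 S C h -> hb th k S C (pd l h).
Proof. by case=> _ [_ p]; exact: p. Qed.

Lemma hbS th k S C h : hb th k.+1 S C h -> hb th k S C h.
Proof.
elim: k h => [|k IH] h; first by move=> [b _]; split.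
by move=> [b [d p]]; split => //; split => // l; exact: IH.
Qed.

Lemma hb_order th j k S C h : (j <= k)%N -> hb th k S C h -> hb th j S C h.
Proof.
move=> /subnK <-; elim: (k - j)%N => // m IH; rewrite addSn => /hbS; exact: IH.
Qed.

Lemma hbW th k (S S' : set E) C C' h : (forall x, S' x -> S x) -> C <= C' ->
  hb th k S C h -> hb th k S' C' h.
Proof.
move=> SS CC; have b0 g : hb0 th S C g -> hb0 th S' C' g.
  case=> cg bg hg; split => //.
    by move=> x /SS /bg /le_trans; apply.
  move=> x y /SS Sx /SS Sy; apply: le_trans (hg _ _ Sx Sy) _.
  by rewrite ler_wpM2r ?powR_ge0 // ler_wpM2l.
elim: k h => [|k IH] h; first by move=> [/b0 b _]; split.
by move=> [/b0 b [d p]]; split => //; split => // l; exact/IH/p.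
Qed.

Lemma hb_le th k (S : set E) C C' h : C <= C' -> hb th k S C h -> hb th k S C' h.
Proof. exact: hbW. Qed.

Lemma hb_smooth th k S C h : hb th k S C h -> smooth k h.
Proof.
elim: k h => [|k IH] h [b H]; (split; first by case: b => ? _ _; split).
  by [].
by case: H => d p; split => // l; exact/IH/p.
Qed.

Lemma smooth_hb th k C h : smooth k h -> hb th k set0 C h.
Proof.
elim: k h => [|k IH] h [b H]; (split; first by case: b => ? _ _; split).
  by [].
by case: H => d p; split => // l; exact/IH/p.
Qed.

Lemma hb0_of_bound S C (h : E -> R) : continuous h -> (forall x, S x -> `|h x| <= C) -> hb0 0 S C h.
Proof.
move=> ch hC; split => // x y Sx Sy; rewrite powRr0 mulr1 mulr_natl mulr2n.
by apply: le_trans (ler_normB _ _) _; apply: lerD; exact: hC.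
Qed.

Lemma hb_th0 th k S C h : hb th k S C h -> hb 0 k S C h.
Proof.
elim: k h => [|k IH] h [[b1 b2 _] H]; (split; first exact: hb0_of_bound).
  by [].
by case: H => d p; split => // l; exact/IH/p.
Qed.

Lemma hb0D th S C D h g : hb0 th S C h -> hb0 th S D g -> hb0 th S (C + D) (fun x => h x + g x).
Proof.
case=> ch bh hh [cg bg hg]; split.
- by move=> x; apply: (@continuousD _ _ _ h g); [exact: ch|exact: cg].
- by move=> x Sx; apply: le_trans (ler_normD _ _) _; apply: lerD; [exact: bh|exact: bg].
- move=> x y Sx Sy; rewrite opprD addrACA mulrDr mulrDl.
  by apply: le_trans (ler_normD _ _) _; apply: lerD; [exact: hh|exact: hg].
Qed.

Lemma hbD th k S C D h g : hb th k S C h -> hb th k S D g ->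
  hb th k S (C + D) (fun x => h x + g x).
Proof.
elim: k h g => [|k IH] h g [bh Hh] [bg Hg]; (split; first exact: hb0D) => //.
case: Hh => dh ph; case: Hg => dg pg; split.
  by move=> x; apply: differentiableD.
move=> l; rewrite (_ : pd l _ = fun x => pd l h x + pd l g x); first by apply: IH; [exact: ph|exact: pg].
by apply/funext => x; rewrite pdD.
Qed.

Lemma hb_cst th k S c C : `|c| <= C -> hb th k S C (fun=> c).
Proof.
have b0 a : `|a| <= C -> hb0 th S C (fun=> a).
  move=> aC; split => //; first exact: cst_continuous.
  by move=> x y _ _; rewrite subrr normr0 mulr_ge0 ?powR_ge0 // mulr_ge0 // (le_trans _ aC).
elim: k c => [|k IH] c cC; (split; first exact: b0) => //.
split; first by move=> x; exact: differentiable_cst.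
move=> l; rewrite (_ : pd l _ = fun=> 0); first by apply: IH; rewrite normr0 (le_trans _ cC).
by apply/funext => x; rewrite pd_cst.
Qed.

(** The Leibniz rule doubles the number of terms at each order, and the Hoelder seminorm of a
    product costs one further factor 2; hence 2^(k+1). *)
Lemma hbM th k S C D h g : 0 <= C -> 0 <= D -> hb th k S C h -> hb th k S D g ->
  hb th k S (2 ^+ k.+1 * (C * D)) (fun x => h x * g x).
Proof.
move=> C0 D0.
have b0 h' g' : hb0 th S C h' -> hb0 th S D g' -> hb0 th S (2 * (C * D)) (fun x => h' x * g' x).
  case=> ch bh hh [cg bg hg]; split.
  - by move=> x; apply: (@continuousM _ _ h' g'); [exact: ch|exact: cg].
  - move=> x Sx; rewrite normrM; apply: (@le_trans _ _ (C * D)).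
      by apply: ler_pM => //; [exact: bh|exact: bg].
    by rewrite ler_peMl ?mulr_ge0 // ler1n.
  - move=> x y Sx Sy.
    rewrite (_ : _ - _ = (h' x - h' y) * g' x + h' y * (g' x - g' y)); last by ring.
    apply: le_trans (ler_normD _ _) _; rewrite !normrM.
    have p0 := powR_ge0 `|x - y| th.
    have := ler_pM (normr_ge0 _) (normr_ge0 _) (hh _ _ Sx Sy) (bg _ Sx).
    have := ler_pM (normr_ge0 _) (normr_ge0 _) (bh _ Sy) (hg _ _ Sx Sy).
    move=> H1 H2; apply: le_trans (lerD H2 H1) _.
    rewrite le_eqVlt; apply/orP; left; apply/eqP; ring.
elim: k h g => [|k IH] h g [bh Hh] [bg Hg].
  by split => //; rewrite expr1; exact: b0.
have bb : hb0 th S (2 ^+ k.+2 * (C * D)) (fun x => h x * g x).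
  have [H1 H2 H3] := b0 _ _ bh bg.
  have L : 2 * (C * D) <= 2 ^+ k.+2 * (C * D).
    by rewrite ler_wpM2r ?mulr_ge0 // exprS ler_peMr // exprn_ege1 // ler1n.
  split => // [x Sx|x y Sx Sy]; first exact: le_trans (H2 _ Sx) L.
  by apply: le_trans (H3 _ _ Sx Sy) _; rewrite ler_wpM2r ?powR_ge0 // ler_wpM2l.
split => //; have hh := hbS (conj bh Hh); have hg := hbS (conj bg Hg).
case: Hh => dh ph; case: Hg => dg pg; split.
  by move=> x; apply: differentiableM.
move=> l; rewrite (_ : pd l _ = fun x => pd l h x * g x + h x * pd l g x).
  rewrite exprS -mulrA mulr_natl mulr2n; apply: hbD; apply: IH => //; [exact: ph|exact: pg].
by apply/funext => x; rewrite pdM.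
Qed.

Lemma hbZ th k S C c h : 0 <= C -> hb th k S C h -> hb th k S (`|c| * C) (fun x => c * h x).
Proof.
move=> C0.
have b0 g : hb0 th S C g -> hb0 th S (`|c| * C) (fun x => c * g x).
  case=> cg bg hg; split.
  - by move=> x; apply: (@continuousM _ _ (cst c) g); [exact: cst_continuous|exact: cg].
  - by move=> x Sx; rewrite normrM ler_wpM2l // bg.
  - by move=> x y Sx Sy; rewrite -mulrBr normrM (mulrCA 2) -(mulrA `|c|) ler_wpM2l // hg.
elim: k h => [|k IH] h [bh Hh]; (split; first exact: b0) => //.
case: Hh => dh ph; split; first by move=> x; apply: differentiableZ.
move=> l; rewrite (_ : pd l _ = fun x => c * pd l h x); first by apply: IH; exact: ph.
by apply/funext => x; rewrite pdZ.
Qed.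

Lemma hbN th k S C h : 0 <= C -> hb th k S C h -> hb th k S C (fun x => - h x).
Proof.
move=> C0 /(hbZ (-1) C0); rewrite normrN1 mul1r.
by under [X in hb _ _ _ _ X]eq_fun do rewrite mulN1r.
Qed.

Lemma hbB th k S C D h g : 0 <= D -> hb th k S C h -> hb th k S D g ->
  hb th k S (C + D) (fun x => h x - g x).
Proof. by move=> D0 hh hg; apply: hbD => //; exact: hbN. Qed.

Lemma hb_sum th k S (I : Type) (r : seq I) (P : pred I) (C : I -> R) (h : I -> E -> R) :
  (forall i, P i -> hb th k S (C i) (h i)) ->
  hb th k S (\sum_(i <- r | P i) C i) (fun x => \sum_(i <- r | P i) h i x).
Proof.
move=> H; elim: r => [|i r IH].
  rewrite big_nil (_ : (fun x => _) = fun=> 0); first by apply: hb_cst; rewrite normr0.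
  by apply/funext => x; rewrite big_nil.
rewrite big_cons; case: ifP => Pi.
  rewrite (_ : (fun x => _) = fun x => h i x + \sum_(j <- r | P j) h j x).
    by apply: hbD => //; exact: H.
  by apply/funext => x; rewrite big_cons Pi.
rewrite (_ : (fun x => _) = fun x => \sum_(j <- r | P j) h j x) //.
by apply/funext => x; rewrite big_cons Pi.
Qed.

Lemma hb_sum_cst th k S (I : finType) (P : pred I) (C : R) (h : I -> E -> R) : 0 <= C ->
  (forall i, P i -> hb th k S C (h i)) ->
  hb th k S (#|I|%:R * C) (fun x => \sum_(i | P i) h i x).
Proof.
move=> C0 H; have := hb_sum (index_enum I) (C := fun=> C) H; apply: hb_le.
rewrite mulr_natl -sumr_const big_mkcond; apply: ler_sum => i _.
by case: ifP.
Qed.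

Lemma pd_comm_hb th k S C h i j : hb th k.+2 S C h -> pd i (pd j h) = pd j (pd i h).
Proof.
move=> H; apply: pd_comm => [y|l y|l m].
- exact: hb_differentiable H.
- exact: hb_differentiable (hb_pd l H).
- exact: hb_continuous (hb_pd m (hb_pd l H)).
Qed.

(** Split z as z^(1-th) z^th and bound each factor separately. *)
Lemma interpolate_le (th z A B : R) : 0 <= th <= 1 -> 0 <= z -> z <= A -> z <= B ->
  z <= A `^ (1 - th) * B `^ th.
Proof.
move=> /andP[t0 t1] z0 zA zB.
have [->|zn0] := eqVneq z 0; first by rewrite mulr_ge0 ?powR_ge0.
have -> : z = z `^ (1 - th) * z `^ th.
  by rewrite -powRD; [rewrite subrK powRr1 | rewrite subrK oner_eq0].
apply: ler_pM; rewrite ?powR_ge0 //; apply: ge0_ler_powR => //; rewrite ?nnegrE ?subr_ge0 //.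
  exact: le_trans zA.
exact: le_trans zB.
Qed.

Lemma powR_le_max1 (th x : R) : 0 <= th <= 1 -> 0 <= x -> x `^ th <= 1 + x.
Proof.
move=> /andP[t0 t1] x0; case: (lerP x 1) => x1.
  apply: (@le_trans _ _ (1 `^ th)); first by apply: ge0_ler_powR; rewrite ?nnegrE.
  by rewrite powR1 lerDl.
apply: (@le_trans _ _ (x `^ 1)); first by apply: ler_powR => //; exact: ltW.
by rewrite powRr1 // lerDr.
Qed.

(** Brings the interpolation of the bounds 2a and c b z to the form demanded by the Hoelder clause
    of [hb0]; it rests on 2^(1-th) <= 2 and c^th <= 1 + c. *)
Lemma interpolation_const (th a b c z : R) : 0 <= th <= 1 -> 0 <= a -> 0 <= b -> 0 <= c -> 0 <= z ->
  (2 * a) `^ (1 - th) * (c * b * z) `^ th <=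
  2 * ((1 + c) * (a `^ (1 - th) * b `^ th)) * z `^ th.
Proof.
move=> t01 a0 b0 c0 z0; have /andP[t0 t1] := t01.
rewrite (powRM _ _ a0) // (powRM th (mulr_ge0 c0 b0) z0) (powRM th c0 b0).
have A0 := powR_ge0 a (1 - th); have B0 := powR_ge0 b th; have Z0 := powR_ge0 z th.
have C0 := powR_ge0 c th; have C1 := powR_le_max1 t01 c0.
have T0 : 0 <= 2 `^ (1 - th) :> R by exact: powR_ge0.
have T1 : 2 `^ (1 - th) <= 2 :> R.
  rewrite -[leRHS](powRr1 (ler0n _ 2)); apply: ler_powR; first by rewrite ler1n.
  by rewrite lerBlDr lerDl.
have H : 2 `^ (1 - th) * c `^ th * (a `^ (1 - th) * b `^ th * z `^ th) <=
    2 * (1 + c) * (a `^ (1 - th) * b `^ th * z `^ th).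
  by apply: ler_wpM2r; [rewrite !mulr_ge0|apply: ler_pM].
by apply: le_trans (le_trans H _); rewrite le_eqVlt; apply/orP; left; apply/eqP; ring.
Qed.

(** An increment of a derivative is bounded both by 2a and, by the mean value theorem on the convex
    set S, by n b |x - y|. The case a = b turns a C^(k+1) bound into a C^(k,th) bound and is used in
    that way several times. *)
Lemma hb_interpolate th k S a b h : 0 <= th <= 1 -> convex_set S -> 0 <= a <= b ->
  hb 0 k S a h -> hb 0 k.+1 S b h ->
  hb th k S ((1 + n%:R) * (a `^ (1 - th) * b `^ th)) h.
Proof.
move=> th01 cS /andP[a0 ab]; have b0 := le_trans a0 ab; have n0 : 0 <= n%:R :> R by [].
have base g : hb0 0 S a g -> (forall x, differentiable g x) ->
    (forall l x, S x -> `|pd l g x| <= b) ->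
    hb0 th S ((1 + n%:R) * (a `^ (1 - th) * b `^ th)) g.
  case=> cg bg _ dg pg; split => //.
    move=> x Sx; apply: le_trans (interpolate_le th01 (normr_ge0 _) (bg x Sx) (le_trans (bg x Sx) ab)) _.
    by rewrite ler_peMl ?mulr_ge0 ?powR_ge0 // lerDl.
  move=> x y Sx Sy; apply: le_trans (interpolation_const th01 a0 b0 n0 (normr_ge0 _)).
  apply: interpolate_le => //.
    by rewrite mulr_natl mulr2n; apply: le_trans (ler_normB _ _) _; apply: lerD; exact: bg.
  by apply: (@lipschitz_of_pd _ _ S) => // ? ? ?; exact: pg.
elim: k h => [|k IH] h Ha Hb; (split; first by
  apply: base; [exact: hb_hb0 Ha|move=> x; exact: hb_differentiable Hb|
   move=> l x; exact: (hb_bound (hb_pd l Hb))]) => //.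
split; first by move=> x; exact: hb_differentiable Hb.
by move=> l; apply: IH; exact: hb_pd.
Qed.

End HolderClasses.

(** * Composition with near-identity maps *)

Section Composition.
Context {R : realType} {n : nat}.
Local Notation E := 'rV[R]_n.

Lemma continuous_row (V : normedModType R) (B : V -> E) :
  (forall l, continuous (fun x => B x 0 l)) -> continuous B.
Proof.
move=> cB x; apply: dist_continuous => e e0.
have [d d0 Hd] : exists2 d : R, 0 < d &
    forall l, l \in index_enum 'I_n -> forall y, `|y - x| < d -> `|B y 0 l - B x 0 l| < e / 2.
  elim: (index_enum _) => [|l r [d d0 IH]]; first by exists 1.
  have [d' d0' H] := continuous_dist (cB l x) (divr_gt0 e0 (ltr0n _ 2)).
  exists (Num.min d d'); first by rewrite lt_min d0.
  move=> m; rewrite inE => /orP[/eqP ->|mr] y; rewrite lt_min => /andP[y1 y2].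
    exact: H.
  exact: IH.
exists d => // y yd; apply: (@le_lt_trans _ _ (e / 2)); last by rewrite ltr_pdivrMr // ltr_pMr // ltr1n.
apply: row_norm_le => [|l]; first by rewrite divr_ge0 // ltW.
by rewrite !mxE; apply: ltW; apply: Hd => //; rewrite mem_index_enum.
Qed.

Lemma hb0_le th (S : set E) C C' h : C <= C' -> hb0 th S C h -> hb0 th S C' h.
Proof. by move=> CC H; have [] := @hb_le _ _ th 0 S C C' h CC (conj H I). Qed.

(** The Lipschitz clause is stated apart because at k = 0 the first clause yields at best a Hoelder
    modulus, whereas composing with B must not lower the exponent th. *)
Definition near_id th k (S : set E) (eta : R) (B : E -> E) : Prop :=
  (forall l, hb th k S eta (fun x => B x 0 l - x 0 l)) /\
  (forall x y, S x -> S y -> `|(B x - x) - (B y - y)| <= eta * `|x - y|).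

Lemma near_id_order th j k S eta B : (j <= k)%N -> near_id th k S eta B -> near_id th j S eta B.
Proof. by move=> jk [H L]; split => // l; exact: hb_order jk (H l). Qed.

Lemma coord_split (B : E -> E) l : (fun x => B x 0 l) = (fun x => (B x 0 l - x 0 l) + x 0 l).
Proof. by apply/funext => x; rewrite subrK. Qed.

Lemma near_id_continuous th k S eta B : near_id th k S eta B -> continuous B.
Proof.
move=> [H _]; apply: continuous_row => l; rewrite coord_split => x.
apply: (@continuousD _ _ _ (fun x : E => B x 0 l - x 0 l) (fun x => x 0 l)).
  exact: (hb_continuous (H l)).
exact: coord_continuous.
Qed.

Lemma near_id_differentiable th k S eta B x : near_id th k.+1 S eta B -> differentiable B x.
Proof.
move=> [H _]; apply: differentiable_row => l; rewrite coord_split.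
apply: (@differentiableD _ _ _ (fun x : E => B x 0 l - x 0 l) (fun x => x 0 l)).
  exact: (hb_differentiable _ (H l)).
exact: differentiable_coord.
Qed.

Lemma near_id_pd th k S eta B i l x : near_id th k.+1 S eta B ->
  pd i (fun x => B x 0 l) x = (i == l)%:R + pd i (fun x => B x 0 l - x 0 l) x.
Proof.
move=> [H _]; rewrite [in LHS]coord_split pdD; last exact: differentiable_coord.
  by rewrite pd_coord addrC.
exact: (hb_differentiable _ (H l)).
Qed.

Lemma near_id_lip th k S eta B x y : near_id th k S eta B -> S x -> S y ->
  `|B x - B y| <= (1 + eta) * `|x - y|.
Proof.
move=> [_ L] Sx Sy; have -> : B x - B y = (x - y) + ((B x - x) - (B y - y)).
  by apply/rowP => j; rewrite !mxE; ring.
by apply: le_trans (ler_normD _ _) _; rewrite mulrDl mul1r lerD2l L.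
Qed.

Lemma le_powR_subunit (e th : R) : 0 <= e <= 1 -> 0 <= th -> e <= e `^ (1 - th).
Proof.
move=> /andP[e0 e1] t0; have [->|en0] := eqVneq e 0; first exact: powR_ge0.
by apply: ger1_powR; rewrite ?lt_neqAle ?e0 ?e1 1?eq_sym ?en0 // lerBlDr lerDl.
Qed.

Lemma powR_stretch (th c z : R) : 0 <= th <= 1 -> 0 <= c -> 0 <= z ->
  ((1 + c) * z) `^ th <= (1 + c) * z `^ th.
Proof.
move=> /andP[t0 t1] c0 z0; rewrite powRM ?addr_ge0 //.
apply: ler_wpM2r; first exact: powR_ge0.
rewrite -[leRHS]powRr1 ?addr_ge0 //; apply: ler_powR => //.
by rewrite lerDl.
Qed.

Lemma hb0_comp th k S T C eta h B : 0 <= th <= 1 -> 0 <= C -> 0 <= eta ->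
  (forall x, S x -> T (B x)) -> near_id th k S eta B -> hb0 th T C h ->
  hb0 th S ((1 + eta) * C) (fun x => h (B x)).
Proof.
move=> t01 C0 e0 ST nB [ch bh hh]; split.
- move=> x; apply: (@continuous_comp _ _ _ B h); first exact: (near_id_continuous nB).
  exact: ch.
- move=> x Sx; apply: le_trans (bh _ (ST _ Sx)) _.
  by rewrite ler_peMl // lerDl.
- move=> x y Sx Sy; apply: le_trans (hh _ _ (ST _ Sx) (ST _ Sy)) _.
  rewrite (mulrC (1 + eta)) mulrA -(mulrA _ (1 + eta)); apply: ler_wpM2l; first by rewrite mulr_ge0.
  apply: le_trans (powR_stretch t01 e0 (normr_ge0 _)).
  have /andP[t0 _] := t01.
  apply: ge0_ler_powR; rewrite ?nnegrE ?mulr_ge0 ?addr_ge0 //.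
  exact: near_id_lip nB Sx Sy.
Qed.

(** Separating the identity part of the Jacobian of B is what produces the factor 1 + O(eta) in
    [hb_comp]. *)
Lemma pd_comp_near_id th k S eta B h i : near_id th k.+1 S eta B -> (forall x, differentiable h x) ->
  pd i (fun x => h (B x)) =
  fun x => pd i h (B x) + \sum_l pd l h (B x) * pd i (fun x => B x 0 l - x 0 l) x.
Proof.
move=> nB dh; apply/funext => x.
rewrite (pd_comp i (near_id_differentiable x nB) (dh _)).
under eq_bigr do rewrite (near_id_pd _ _ _ nB) mulrDr.
rewrite big_split /=; congr (_ + _).
rewrite (bigD1 i) //= eqxx mulr1 big1 ?addr0 // => l li.
by rewrite eq_sym (negbTE li) mulr0.
Qed.

(** The dyadic recursion applies this once per level, so a factor tending to 1 with eta is
    essential; a fixed constant larger than 1 could not be iterated. *)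
Lemma hb_comp k : exists2 K : R, 0 <= K & forall th S T C eta h B,
  0 <= th <= 1 -> 0 <= C -> 0 <= eta <= 1 ->
  (forall x, S x -> T (B x)) -> near_id th k S eta B -> hb th k T C h ->
  hb th k S ((1 + K * eta) * C) (fun x => h (B x)).
Proof.
elim: k => [|k [K K0 IH]].
  exists 1 => // th S T C eta h B t01 C0 /andP[e0 _] ST nB [bh _]; split => //.
  by rewrite mul1r; apply: hb0_comp nB bh.
exists (1 + K + n%:R * (2 ^+ k.+1 * (1 + K))).
  by rewrite addr_ge0 ?addr_ge0 // mulr_ge0 // mulr_ge0 ?exprn_ge0 ?addr_ge0.
move=> th S T C eta h B t01 C0 /andP[e0 e1] ST nB hh.
have P0 : 0 <= n%:R * (2 ^+ k.+1 * (1 + K)) by rewrite mulr_ge0 // mulr_ge0 ?exprn_ge0 ?addr_ge0.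
split.
  apply: hb0_le (hb0_comp t01 C0 e0 ST nB (hb_hb0 hh)).
  apply: ler_wpM2r => //; rewrite lerD2l -[leLHS]mul1r ler_wpM2r // -addrA lerDl.
  by rewrite addr_ge0.
split.
  move=> x; apply: (@differentiable_comp _ _ _ _ B h).
    exact: near_id_differentiable nB.
  exact: hb_differentiable hh.
move=> i; rewrite (pd_comp_near_id i nB); last by move=> x; exact: hb_differentiable hh.
have nB' := near_id_order (leqnSn k) nB.
have E1 l : hb th k S ((1 + K * eta) * C) (fun x => pd l h (B x)).
  by apply: (IH th S T C eta) => //; [rewrite e0|exact: hb_pd].
have E2 : hb th k S (n%:R * (2 ^+ k.+1 * (((1 + K * eta) * C) * eta)))
   (fun x => \sum_l pd l h (B x) * pd i (fun x => B x 0 l - x 0 l) x).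
  rewrite -[n in n%:R]card_ord.
  have Q0 : 0 <= 2 ^+ k.+1 * (((1 + K * eta) * C) * eta).
    by rewrite mulr_ge0 ?exprn_ge0 // mulr_ge0 // mulr_ge0 // addr_ge0 // mulr_ge0.
  apply: (@hb_sum_cst _ _ _ _ _ _ predT) => // l _; apply: hbM => //.
    by rewrite mulr_ge0 // addr_ge0 // mulr_ge0.
  exact: (hb_pd i (nB.1 l)).
apply: hb_le (hbD (E1 i) E2).
have -> : (1 + K * eta) * C + n%:R * (2 ^+ k.+1 * ((1 + K * eta) * C * eta)) =
  (1 + (K * eta + n%:R * (2 ^+ k.+1 * (1 + K * eta)) * eta)) * C by ring.
apply: ler_wpM2r => //; rewrite lerD2l [leRHS]mulrDl; apply: lerD.
  by apply: ler_wpM2r => //; rewrite lerDr.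
apply: ler_wpM2r => //; apply: ler_wpM2l => //; apply: ler_wpM2l; first exact: exprn_ge0.
by rewrite lerD2l ler_piMr.
Qed.

(** The increment of A o B' - A o B between x and y is bounded by a multiple of eps and, B and B'
    being Lipschitz, by a multiple of |x - y|. Interpolating gives eps^(1-th) |x - y|^th. *)
Lemma hb0_comp_diff th S T C eps A B B' : 0 <= th <= 1 -> 0 <= C -> 0 <= eps <= 1 -> convex_set T ->
  (forall x, S x -> T (B x)) -> (forall x, S x -> T (B' x)) ->
  (forall z, differentiable A z) -> (forall z l, T z -> `|pd l A z| <= C) ->
  near_id th 0 S 1 B -> near_id th 0 S 1 B' ->
  (forall x l, S x -> `|B' x 0 l - B x 0 l| <= eps) ->
  hb0 th S (2 * (1 + n%:R) * n%:R * C * eps `^ (1 - th)) (fun x => A (B' x) - A (B x)).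
Proof.
move=> t01 C0 /andP[e0 e1] cT ST ST' dA pA nB nB' BB; have /andP[t0 t1] := t01.
have n0 : 0 <= n%:R :> R by [].
have lipA x y : T x -> T y -> `|A x - A y| <= n%:R * C * `|x - y|.
  by apply: lipschitz_of_pd => // z l; exact: pA.
have BBn x : S x -> `|B' x - B x| <= eps.
  by move=> Sx; apply: row_norm_le => // l; rewrite !mxE; exact: BB.
have D0 : 0 <= n%:R * C by rewrite mulr_ge0.
have small x : S x -> `|A (B' x) - A (B x)| <= n%:R * C * eps.
  by move=> Sx; apply: le_trans (lipA _ _ (ST' _ Sx) (ST _ Sx)) _; rewrite ler_wpM2l // BBn.
have e_le : eps <= eps `^ (1 - th).
  by apply: le_powR_subunit; rewrite ?e0.
split.
- move=> x; apply: (@continuousB _ _ _ (fun x => A (B' x)) (fun x => A (B x))).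
    apply: (@continuous_comp _ _ _ B' A); first exact: (near_id_continuous nB').
    exact: differentiable_continuous.
  apply: (@continuous_comp _ _ _ B A); first exact: (near_id_continuous nB).
  exact: differentiable_continuous.
- move=> x Sx; apply: le_trans (small x Sx) _.
  apply: ler_pM => //; rewrite -mulrA ler_peMl // -[leLHS]mulr1.
  by apply: ler_pM => //; rewrite ?lerDl ?ler1n.
- move=> x y Sx Sy.
  pose a := n%:R * C * eps; pose z := `|x - y|.
  have a0 : 0 <= a by rewrite mulr_ge0.
  have H1 : `|A (B' x) - A (B x) - (A (B' y) - A (B y))| <= 2 * a.
    by rewrite mulr_natl mulr2n; apply: le_trans (ler_normB _ _) (lerD (small _ Sx) (small _ Sy)).
  have H2 : `|A (B' x) - A (B x) - (A (B' y) - A (B y))| <= 4 * (n%:R * C) * z.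
    rewrite (_ : _ - _ = (A (B' x) - A (B' y)) - (A (B x) - A (B y))); last by ring.
    apply: le_trans (ler_normB _ _) _.
    have L1 := lipA _ _ (ST' _ Sx) (ST' _ Sy); have L2 := lipA _ _ (ST _ Sx) (ST _ Sy).
    have M1 := near_id_lip nB Sx Sy; have M2 := near_id_lip nB' Sx Sy.
    apply: (@le_trans _ _ (n%:R * C * ((1 + 1) * z) + n%:R * C * ((1 + 1) * z))).
      by apply: lerD; [apply: le_trans L1 _ | apply: le_trans L2 _]; rewrite ler_wpM2l.
    by rewrite le_eqVlt; apply/orP; left; apply/eqP; ring.
  apply: le_trans (interpolate_le t01 (normr_ge0 _) H1 H2) _.
  have z0 : 0 <= z by exact: normr_ge0.
  have q0 : 0 <= 2 * (n%:R * C) by rewrite mulr_ge0.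
  rewrite (_ : 2 * a = 2 * (n%:R * C) * eps); last by rewrite /a; ring.
  rewrite (_ : 4 * (n%:R * C) = 2 * (2 * (n%:R * C))); last by ring.
  move: q0; set q := 2 * (n%:R * C) => q0.
  rewrite (powRM _ q0 e0) (powRM _ _ z0) ?(powRM th (ler0n _ 2) q0); last by rewrite mulr_ge0.
  have Q : q `^ (1 - th) * q `^ th = q.
    by rewrite -powRD; [rewrite subrK powRr1 | rewrite subrK oner_eq0].
  rewrite [leLHS](_ : _ = 2 `^ th * (q * (eps `^ (1 - th) * z `^ th))); last by rewrite -{3}Q; ring.
  rewrite [leRHS](_ : _ = 2 * (1 + n%:R) * (q * (eps `^ (1 - th) * z `^ th))); last by rewrite /q; ring.
  apply: ler_wpM2r; first by rewrite !mulr_ge0 ?powR_ge0.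
  apply: (@le_trans _ _ 2); last by rewrite ler_peMr // lerDl.
  rewrite -[leRHS](powRr1 (ler0n _ 2)); apply: ler_powR => //; by rewrite ler1n.
Qed.

(** A is assumed to have one derivative more than the conclusion controls. At the top order this
    derivative must serve both for smallness in eps and for the Hoelder modulus, hence the loss from
    eps to eps^(1-th). *)
Lemma hb_comp_diff k : exists2 K : R, 0 <= K & forall th S T C eps A B B',
  0 <= th <= 1 -> 0 <= C -> 0 <= eps <= 1 -> convex_set T ->
  (forall x, S x -> T (B x)) -> (forall x, S x -> T (B' x)) ->
  near_id th k S 1 B -> near_id th k S 1 B' ->
  (forall l, hb th k S eps (fun x => B' x 0 l - B x 0 l)) ->
  hb 0 k.+1 T C A ->
  hb th k S (K * C * eps `^ (1 - th)) (fun x => A (B' x) - A (B x)).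
Proof.
pose K0 : R := 2 * (1 + n%:R) * n%:R.
have K00 : 0 <= K0 by rewrite !mulr_ge0 // addr_ge0.
have base k' th S T C eps A B B' : 0 <= th <= 1 -> 0 <= C -> 0 <= eps <= 1 -> convex_set T ->
  (forall x, S x -> T (B x)) -> (forall x, S x -> T (B' x)) ->
  near_id th k' S 1 B -> near_id th k' S 1 B' ->
  (forall l, hb th k' S eps (fun x => B' x 0 l - B x 0 l)) ->
  hb 0 k'.+1 T C A ->
  hb0 th S (K0 * C * eps `^ (1 - th)) (fun x => A (B' x) - A (B x)).
  move=> t01 C0 e01 cT ST ST' nB nB' hBB hA; apply: (@hb0_comp_diff _ _ T) => //.
  - by move=> z; exact: hb_differentiable hA.
  - by move=> z l; exact: (hb_bound (hb_pd l hA)).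
  - exact: near_id_order nB.
  - exact: near_id_order nB'.
  - by move=> x l; exact: (hb_bound (hBB l)).
elim: k => [|k [K Kge IH]].
  by exists K0 => // th S T C eps A B B' *; split => //; apply: (base 0%N _ _ T).
have [Kc Kc0 HC] := hb_comp k.
pose P : R := 2 ^+ k.+1.
have P0 : 0 <= P by rewrite exprn_ge0.
pose Kn := n%:R * (P * (K * 2)) + n%:R * (P * (1 + Kc * 1) * (1 + n%:R)).
have Kn0 : 0 <= Kn.
  by rewrite addr_ge0 // !mulr_ge0 // ?mulr_ge0 // addr_ge0 // mulr1.
exists (K0 + Kn); first by rewrite addr_ge0.
move=> th S T C eps A B B' t01 C0 e01 cT ST ST' nB nB' hBB hA.
have ep0 := powR_ge0 eps (1 - th).
have /andP[e0 e1] := e01.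
split.
  apply: hb0_le (base _ _ _ _ _ _ _ _ _ t01 C0 e01 cT ST ST' nB nB' hBB hA).
  by rewrite ler_wpM2r // ler_wpM2r // lerDl.
have dA x : differentiable A x by exact: hb_differentiable hA.
have dAB x : differentiable (fun x => A (B x)) x.
  by apply: (@differentiable_comp _ _ _ _ B A) => //; exact: near_id_differentiable nB.
have dAB' x : differentiable (fun x => A (B' x)) x.
  by apply: (@differentiable_comp _ _ _ _ B' A) => //; exact: near_id_differentiable nB'.
split; first by move=> x; apply: differentiableB.
move=> i.
have nBk := near_id_order (leqnSn k) nB; have nBk' := near_id_order (leqnSn k) nB'.
have db l x : differentiable (fun x => B x 0 l) x.
  by apply: differentiable_coordfun; exact: near_id_differentiable nB.
have db' l x : differentiable (fun x => B' x 0 l) x.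
  by apply: differentiable_coordfun; exact: near_id_differentiable nB'.
have -> : pd i (fun x => A (B' x) - A (B x)) = fun x =>
   \sum_l (pd l A (B' x) - pd l A (B x)) * pd i (fun x => B' x 0 l) x +
   \sum_l pd l A (B x) * pd i (fun x => B' x 0 l - B x 0 l) x.
  apply/funext => x; rewrite (pdB i (dAB' x) (dAB x)).
  rewrite (pd_comp i (near_id_differentiable x nB) (dA _)).
  rewrite (pd_comp i (near_id_differentiable x nB') (dA _)).
  rewrite -sumrB -big_split /=; apply: eq_bigr => l _.
  by rewrite (pdB i (db' l x) (db l x)); ring.
have e_le : eps <= eps `^ (1 - th).
  by apply: le_powR_subunit => //; have /andP[] := t01.
have hdB' l : hb th k S 2 (pd i (fun x => B' x 0 l)).
  have -> : pd i (fun x => B' x 0 l) = fun x => (i == l)%:R + pd i (fun x => B' x 0 l - x 0 l) x.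
    by apply/funext => x; exact: near_id_pd nB'.
  rewrite (_ : 2 = 1 + 1) //; apply: hbD; last exact: hb_pd (nB'.1 l).
  by apply: hb_cst; case: (i == l); rewrite ?normr1 ?normr0.
have cn : 0 <= (1 + n%:R) * C by rewrite mulr_ge0 // addr_ge0.
(* A bound on k + 1 derivatives, interpolated with itself, is a C^(k,th) bound. *)
have hdA l : hb th k T ((1 + n%:R) * C) (pd l A).
  have := hb_interpolate t01 cT _ (hbS (hb_pd l hA)) (hb_pd l hA).
  rewrite lexx C0 => /(_ isT); apply: hb_le; rewrite -powRD ?subrK ?powRr1 //.
  by rewrite oner_eq0.
apply: (@hb_le _ _ _ _ _ (n%:R * (P * (K * C * eps `^ (1 - th) * 2)) +
    n%:R * (P * ((1 + Kc * 1) * ((1 + n%:R) * C) * eps)))).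
  apply: (@le_trans _ _ (Kn * C * eps `^ (1 - th))); last first.
    by rewrite ler_wpM2r // ler_wpM2r // lerDr.
  rewrite (_ : Kn * C * _ = n%:R * (P * (K * C * eps `^ (1 - th) * 2)) +
    n%:R * (P * ((1 + Kc * 1) * ((1 + n%:R) * C) * eps `^ (1 - th)))); last by rewrite /Kn; ring.
  rewrite lerD2l; do 3! apply: ler_wpM2l => //; rewrite mulr_ge0 //.
  by rewrite addr_ge0 // mulr1.
rewrite -[n in n%:R * (P * (K * _ * _ * _))]card_ord -[n in _ + n%:R * _]card_ord.
apply: hbD; apply: (@hb_sum_cst _ _ _ _ _ _ predT).
- by rewrite !mulr_ge0.
- move=> l _; apply: hbM => //; first by rewrite !mulr_ge0.
  by apply: (IH th S T C eps) => //; [move=> m; exact: hbS|exact: hb_pd].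
- by rewrite !mulr_ge0 // ?addr_ge0 // mulr1.
- move=> l _; apply: hbM => //; first by rewrite mulr_ge0 // addr_ge0 // mulr1.
  + by apply: (HC th S T _ 1) => //; rewrite ler01 lexx.
  + exact: hb_pd (hBB l).
Qed.

End Composition.

(** * Limits under uniform Hoelder bounds *)

Section Limits.
Context {R : realType}.

Definition tends (u : nat -> R) (l : R) : Prop :=
  forall e : R, 0 < e -> exists M : nat, forall m, (M <= m)%N -> `|u m - l| < e.

Lemma quarter_bound (K e : R) : 0 <= K -> 0 < e -> K * (e / (4 * (K + 1))) <= e / 4.
Proof.
move=> K0 e0; have K1 : 0 < K + 1 by rewrite ltr_wpDl.
have -> : K * (e / (4 * (K + 1))) = (K / (K + 1)) * (e / 4).
  by field; rewrite gt_eqF.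
rewrite ler_piMl ?divr_ge0 ?(ltW e0) // ler_pdivrMr // mul1r lerDl //.
Qed.

Lemma dist_four_lt (A B D a b e : R) : `|A - D| < e / 4 -> `|B - D| < e / 4 ->
  `|A - a| <= e / 4 -> `|B - b| <= e / 4 -> `|b - a| < e.
Proof. by rewrite !ltr_norml !ler_norml; lra. Qed.

Lemma tends_cauchy (u : nat -> R) :
  (forall e : R, 0 < e -> exists M : nat, forall m, (M <= m)%N -> `|u m - u M| < e) ->
  exists l, tends u l.
Proof.
move=> H; have : cvg (u m @[m --> \oo])%classic.
  apply: R_complete; apply/cauchy_exP => e e0.
  have [M HM] := H e e0; exists (u M); exists M => // m /= /HM.
  by rewrite -ball_normE /= distrC.
move=> /(cvgr_dist_lt) cu; exists (lim (u m @[m --> \oo]))%classic => e e0.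
have [M _ HM] := cu e e0; exists M => m /HM /=.
by rewrite distrC.
Qed.

Lemma tends_le (u : nat -> R) l a : tends u l -> (forall m, u m <= a) -> l <= a.
Proof.
move=> ul ua; rewrite leNgt; apply/negP => al.
have [M HM] := ul (l - a) (ltac:(by rewrite subr_gt0)).
have := HM _ (leqnn M); rewrite ltr_norml => /andP[+ _].
by rewrite opprB ltrBrDr subrK ltNge ua.
Qed.

Lemma tends_norm_le (u : nat -> R) l a : tends u l -> (forall m, `|u m| <= a) -> `|l| <= a.
Proof.
move=> ul ua; apply: (@tends_le (fun m => `|u m|)) => // e e0.
have [M HM] := ul e e0; exists M => m /HM; apply: le_lt_trans.
exact: ler_dist_dist.
Qed.

Lemma tends_unique (u : nat -> R) a b : tends u a -> tends u b -> a = b.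
Proof.
move=> ua ub; apply/eqP; rewrite -subr_eq0 -normr_le0 leNgt; apply/negP => e0.
have e2 : 0 < `|a - b| / 2 by rewrite divr_gt0.
have [M HM] := ua _ e2; have [M' HM'] := ub _ e2.
have := dist_half_lt (HM _ (leq_maxl M M')) (HM' _ (leq_maxr M M')).
by rewrite ltxx.
Qed.

Lemma tends_cst a : tends (fun=> a) a.
Proof. by move=> e e0; exists 0%N => m _; rewrite subrr normr0. Qed.

Lemma tendsD u v a b : tends u a -> tends v b -> tends (fun m => u m + v m) (a + b).
Proof.
move=> ua vb e e0; have e2 : 0 < e / 2 by rewrite divr_gt0.
have [M HM] := ua _ e2; have [M' HM'] := vb _ e2.
exists (maxn M M') => m; rewrite geq_max => /andP[/HM h1 /HM' h2].
rewrite opprD addrACA [ltRHS]splitr.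
by apply: le_lt_trans (ler_normD _ _) (ltrD h1 h2).
Qed.

Lemma tendsZ u a c : tends u a -> tends (fun m => c * u m) (c * a).
Proof.
move=> ua e e0; have c1 : 0 < 1 + `|c| by rewrite ltr_pwDl.
have [M HM] := ua (e / (1 + `|c|)) (divr_gt0 e0 c1); exists M => m /HM H.
rewrite -mulrBr normrM; apply: (@le_lt_trans _ _ ((1 + `|c|) * `|u m - a|)).
  by rewrite ler_wpM2r // lerDr.
by rewrite mulrC -ltr_pdivlMr.
Qed.

Lemma tendsN u a : tends u a -> tends (fun m => - u m) (- a).
Proof.
by move=> /(tendsZ (-1)); rewrite mulN1r; under eq_fun do rewrite mulN1r.
Qed.

Lemma tendsB u v a b : tends u a -> tends v b -> tends (fun m => u m - v m) (a - b).
Proof. by move=> ua /tendsN; exact: tendsD. Qed.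

Lemma tends_sum (I : Type) (r : seq I) (u : I -> nat -> R) a : (forall i, tends (u i) (a i)) ->
  tends (fun m => \sum_(i <- r) u i m) (\sum_(i <- r) a i).
Proof.
move=> H; elim: r => [|i r IH].
  by rewrite big_nil; under eq_fun do rewrite big_nil; exact: tends_cst.
by rewrite big_cons; under eq_fun do rewrite big_cons; apply: tendsD.
Qed.

Context {n : nat}.
Local Notation E := 'rV[R]_n.

Lemma differential_of_remainder (V W : normedModType R) (h : V -> W) x (df : {linear V -> W})
    (C th : R) : 0 < th -> continuous df ->
  (forall v, `|h (x + v) - h x - df v| <= C * `|v| `^ th * `|v|) ->
  differentiable h x /\ 'd h x = df :> (V -> W).
Proof.
move=> th0 cdf H; have C0 : 0 < `|C| + 1 by rewrite ltr_wpDl.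
have exp : h \o shift x = cst (h x) + df +o_ 0 id.
  apply/eqaddoP => e e0.
  pose d := (e / (`|C| + 1)) `^ th^-1.
  have d0 : 0 < d by rewrite powR_gt0 // divr_gt0.
  apply/nbhs_normP; exists d => // v /=; rewrite sub0r normrN => vd.
  rewrite !fctE /= /shift /= opprD addrA (addrC v x).
  apply: le_trans (H v) _; apply: ler_wpM2r => //.
  apply: (@le_trans _ _ ((`|C| + 1) * `|v| `^ th)).
    by apply: ler_wpM2r; [exact: powR_ge0|rewrite (le_trans (ler_norm _)) // lerDl].
  rewrite mulrC -ler_pdivlMr //.
  apply: (@le_trans _ _ (d `^ th)).
    by apply: ge0_ler_powR; rewrite ?nnegrE // ltW.
  by rewrite /d -powRrM mulVf ?gt_eqF // powRr1 // divr_ge0 // ltW.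
have E1 : 'd h x = df :> (V -> W) by exact: diff_unique.
by split => //; apply/diff_locallyP; rewrite E1.
Qed.

Lemma differentiable_of_remainder (h : E -> R) x (p : 'I_n -> R) (C th : R) : 0 < th ->
  (forall v, `|h (x + v) - h x - \sum_l v 0 l * p l| <= C * `|v| `^ th * `|v|) ->
  differentiable h x /\ forall l, pd l h x = p l.
Proof.
move=> th0 H.
have L : linear (fun v : E => \sum_l v 0 l * p l).
  move=> a u v; under [LHS]eq_bigr do rewrite !mxE mulrDl -mulrA.
  by rewrite big_split /= -mulr_sumr.
pose L' := GRing.isLinear.Build R E R *%R _ L.
pose df : {linear E -> R} := HB.pack (fun v : E => \sum_l v 0 l * p l) L'.
have cdf : continuous df.
  move=> v; apply: differentiable_continuous; apply: differentiable_bigsum => l _.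
  apply: (@differentiableM _ _ (fun v : E => v 0 l) (cst (p l))).
    exact: differentiable_coord.
  exact: differentiable_cst.
have [dh E1] := differential_of_remainder th0 cdf H.
split => // l; rewrite /pd deriveE // E1 /= (bigD1 l) //= mxE !eqxx mul1r big1 ?addr0 //.
by move=> m ml; rewrite mxE (negbTE ml) andbF mul0r.
Qed.

(* Uniform Hoelder continuity of the derivatives (th > 0) forces them to converge
   along with the functions. *)
Lemma hb_tends th k C (hm : nat -> E -> R) h : 0 < th ->
  (forall m, hb th k setT C (hm m)) -> (forall x, tends (hm^~ x) (h x)) ->
  hb th k setT C h.
Proof.
move=> th0.
have base (um : nat -> E -> R) u : (forall m, hb0 th setT C (um m)) ->
    (forall x, tends (um^~ x) (u x)) -> hb0 th setT C u.
  move=> Hm Hu.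
  have B x : `|u x| <= C.
    by apply: tends_norm_le (Hu x) _ => m; have [_ H _] := Hm m; exact: H.
  have Ho x y : `|u x - u y| <= 2 * C * `|x - y| `^ th.
    apply: tends_norm_le (tendsB (Hu x) (Hu y)) _ => m.
    by have [_ _ H] := Hm m; exact: H.
  have C0 : 0 <= C by exact: le_trans (normr_ge0 _) (B 0).
  split => // x; apply: dist_continuous => e e0.
  have K0 : 0 < 2 * C + 1 by rewrite ltr_wpDl // mulr_ge0.
  exists ((e / (2 * C + 1)) `^ th^-1); first by rewrite powR_gt0 // divr_gt0.
  move=> y yd; apply: le_lt_trans (Ho y x) _.
  apply: (@le_lt_trans _ _ ((2 * C + 1) * `|y - x| `^ th)).
    by rewrite ler_wpM2r ?powR_ge0 // lerDl.
  rewrite mulrC -ltr_pdivlMr //.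
  rewrite [ltRHS](_ : _ = ((e / (2 * C + 1)) `^ th^-1) `^ th); last first.
    by rewrite -powRrM mulVf ?gt_eqF // powRr1 // divr_ge0 // ltW.
  by apply: gt0_ltr_powR; rewrite ?nnegrE ?powR_ge0.
elim: k hm h => [|k IH] hm h Hm Hh.
  by split => //; apply: base Hh => m; exact: hb_hb0.
have Tx (x : E) : setT x by [].
have C0 : 0 <= C by exact: le_trans (normr_ge0 _) (hb_bound (Hm 0%N) (Tx 0)).
have dm m y : differentiable (hm m) y by exact: hb_differentiable (Hm m).
have pm m l : hb th k setT C (pd l (hm m)) by exact: hb_pd (Hm m).
have ho m l x y : `|pd l (hm m) x - pd l (hm m) y| <= 2 * C * `|x - y| `^ th.
  by have [_ _ H] := hb_hb0 (pm m l); exact: H.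
(* The function hm minus its linear part at x has a gradient of size |v|^th on the segment from x to
   x + v. The resulting first order remainder is uniform in m. *)
have rem m x v : `|hm m (x + v) - hm m x - \sum_l v 0 l * pd l (hm m) x| <=
    n%:R * (2 * C) * `|v| `^ th * `|v|.
  pose g y := hm m y - \sum_l y 0 l * pd l (hm m) x.
  have dcl l z : differentiable (fun y : E => y 0 l * pd l (hm m) x) z.
    apply: (@differentiableM _ _ (fun y : E => y 0 l) (cst (pd l (hm m) x))).
      exact: differentiable_coord.
    exact: differentiable_cst.
  have dg z : differentiable g z.
    by apply: differentiableB => //; apply: differentiable_bigsum.
  have pg l z : pd l g z = pd l (hm m) z - pd l (hm m) x.
    rewrite pdB //; last by apply: differentiable_bigsum.
    congr (_ - _); rewrite pd_sum //.
    transitivity (\sum_(i < n) (l == i)%:R * pd i (hm m) x).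
      apply: eq_bigr => i _; rewrite pdM; [|exact: differentiable_coord|exact: differentiable_cst].
      by rewrite pd_coord pd_cst mulr0 addr0.
    rewrite (bigD1 l) //= eqxx mul1r big1 ?addr0 // => i il.
    by rewrite eq_sym (negbTE il) mul0r.
  have -> : hm m (x + v) - hm m x - \sum_l v 0 l * pd l (hm m) x = g (x + v) - g x.
    rewrite /g; under [X in _ = _ - X - _]eq_bigr do rewrite mxE mulrDl.
    rewrite big_split /=; set a := hm m _; set b := hm m _; set c := \sum_(_ < _) _.
    by set d := \sum_(_ < _) _; ring.
  have := @line_increment _ _ g x v (n%:R * (2 * C) * `|v| `^ th * `|v|) 1 dg ler01.
  rewrite scale1r mulr1; apply => s /andP[s0 s1].
  rewrite -(mulrA n%:R); apply: directional_le => //.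
    by rewrite mulr_ge0 ?powR_ge0 // mulr_ge0.
  move=> l; rewrite pg; apply: le_trans (ho _ _ _ _) _; apply: ler_wpM2l; first by rewrite mulr_ge0.
  apply: ge0_ler_powR; rewrite ?nnegrE //; first exact: ltW.
  by rewrite addrAC subrr add0r normrZ ger0_norm // ler_piMl.
(* For a fixed small step s the difference quotient approximates the derivative within e / 4,
   uniformly in m, and the quotients converge as m grows; so the derivatives form a Cauchy
   sequence. *)
have cau x l : exists c, tends (fun m => pd l (hm m) x) c.
  apply: tends_cauchy => e e0.
  pose v : E := delta_mx 0 l.
  pose K := n%:R * (2 * C) * `|v| `^ th * `|v|.
  have K0 : 0 <= K by rewrite !mulr_ge0 ?powR_ge0.
  (* Chosen so that the remainder K s^th is at most e / 4. *)
  pose s := (e / (4 * (K + 1))) `^ th^-1.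
  have e40 : 0 < e / (4 * (K + 1)) by rewrite divr_gt0 // mulr_gt0 // ltr_wpDl.
  have s0 : 0 < s by rewrite powR_gt0.
  have quot m : `|s^-1 * (hm m (x + s *: v) - hm m x) - pd l (hm m) x| <= e / 4.
    have := rem m x (s *: v).
    have -> : \sum_i (s *: v) 0 i * pd i (hm m) x = s * pd l (hm m) x.
      rewrite (bigD1 l) //= !mxE !eqxx mulr1 big1 ?addr0 // => i il.
      by rewrite !mxE (negbTE il) andbF mulr0 mul0r.
    move=> H; rewrite -(ler_pM2l s0) -{1}(ger0_norm (ltW s0)) -normrM mulrBr mulrA divff ?gt_eqF // mul1r.
    apply: le_trans H _; rewrite normrZ (ger0_norm (ltW s0)) (powRM _ (ltW s0) (normr_ge0 _)).
    have -> : n%:R * (2 * C) * (s `^ th * `|v| `^ th) * (s * `|v|) = s * (K * s `^ th).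
      by rewrite /K; ring.
    rewrite ler_pM2l // /s -powRrM mulVf ?gt_eqF // powRr1; last exact: ltW.
    exact: quarter_bound.
  have [M HM] := tendsZ s^-1 (tendsB (Hh (x + s *: v)) (Hh x)) (divr_gt0 e0 (ltr0n _ 4)).
  exists M => m Mm.
  have := quot m; have := quot M; have := HM m Mm; have := HM M (leqnn M).
  by move=> h1 h2 h3 h4; apply: (dist_four_lt h1 h2 h3 h4).
have cau' l : exists q : E -> R, forall x, tends (fun m => pd l (hm m) x) (q x).
  by have [q Hq] := choice (fun x => cau x l); exists q.
have [p Hp] := choice cau'.
(* Passing to the limit in [rem] shows that the limits p of the derivatives form the gradient of
   h. *)
have key x : differentiable h x /\ forall l, pd l h x = p l x.
  apply: (differentiable_of_remainder (p := p^~ x) (C := n%:R * (2 * C)) th0) => v.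
  apply: tends_norm_le (tendsB (tendsB (Hh (x + v)) (Hh x)) _) (fun m => rem m x v).
  by apply: tends_sum => l; apply: tendsZ; exact: Hp.
split; first by apply: base Hh => m; exact: hb_hb0 (Hm m).
split; first by move=> x; have [] := key x.
move=> l; apply: (IH (fun m => pd l (hm m))) => // x.
by have [_ ->] := key x; exact: Hp.
Qed.

End Limits.

(** * Dyadic compositions of almost-flows *)

Section DyadicScheme.
Context {R : realType} {n : nat}.
Local Notation E := 'rV[R]_n.

Lemma small_powR (A d e : R) : 0 <= A -> 0 < d -> 0 < e ->
  exists2 h0 : R, 0 < h0 <= 1 & forall h, 0 <= h <= h0 -> A * h `^ d <= e.
Proof.
move=> A0 d0 e0; have A1 : 0 < A + 1 by rewrite ltr_wpDl.
pose z := (e / (A + 1)) `^ d^-1.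
have z0 : 0 < z by rewrite powR_gt0 // divr_gt0.
exists (Num.min 1 z); first by rewrite lt_min ltr01 z0 ge_min lexx.
move=> h /andP[h0]; rewrite le_min => /andP[_ hz].
apply: (@le_trans _ _ ((A + 1) * h `^ d)); first by rewrite ler_wpM2r ?powR_ge0 // lerDl.
rewrite mulrC -ler_pdivlMr //; apply: (@le_trans _ _ (z `^ d)).
  by apply: ge0_ler_powR; rewrite ?nnegrE // ltW.
by rewrite /z -powRrM mulVf ?gt_eqF // powRr1 // divr_ge0 // ltW.
Qed.

Lemma near_id_le th k (S : set E) eta eta' B : eta <= eta' ->
  near_id th k S eta B -> near_id th k S eta' B.
Proof.
move=> ee [H L]; split => [l|x y Sx Sy]; first exact: hb_le ee (H l).
by apply: le_trans (L x y Sx Sy) _; rewrite ler_wpM2r.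
Qed.

Lemma convex_setT : convex_set (setT : set E).
Proof. by []. Qed.

Lemma near_id_of_hb th k a eta (B : E -> E) : 0 <= a -> (1 + n%:R) * a <= eta ->
  (forall l, hb th k.+1 setT a (fun x => B x 0 l - x 0 l)) -> near_id th k.+1 setT eta B.
Proof.
move=> a0 ae H; have n0 : 0 <= n%:R :> R by [].
have a_le : a <= eta by apply: le_trans ae; rewrite ler_peMl // lerDl.
split => [l|x y _ _]; first exact: hb_le a_le (H l).
apply: row_norm_le => [|l].
  by rewrite mulr_ge0 // (le_trans _ a_le).
rewrite !mxE; apply: (@le_trans _ _ (n%:R * a * `|x - y|)); last first.
  by rewrite ler_wpM2r // (le_trans _ ae) // ler_wpM2r // lerDr.
apply: (@lipschitz_of_pd _ _ setT (fun x => B x 0 l - x 0 l)) => //.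
  by move=> z; exact: hb_differentiable (H l).
by move=> z m _; exact: (hb_bound (hb_pd m (H l))).
Qed.

(** Because the splitting is at the midpoint, the midpoint defect of mu is the only new source of
    error from one level to the next. *)
Fixpoint dyadic_comp (mu : R -> R -> E -> E) (m : nat) (s t : R) : E -> E :=
  match m with
  | 0%N => mu s t
  | m'.+1 => fun x =>
      dyadic_comp mu m' ((s + t) / 2) t (dyadic_comp mu m' s ((s + t) / 2) x)
  end.

Lemma midpoint_lt (s t : R) : s < t -> s < (s + t) / 2 < t.
Proof. by move=> st; rewrite ltr_pdivlMr // ltr_pdivrMr //; apply/andP; split; lra. Qed.

Lemma midpoint_sub (s t : R) : ((s + t) / 2 - s = (t - s) / 2) * (t - (s + t) / 2 = (t - s) / 2).
Proof. by split; field. Qed.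

Lemma powR_half (h d : R) : 0 <= h -> (h / 2) `^ d = 2 `^ (- d) * h `^ d.
Proof. by move=> h0; rewrite powRM // mulrC powRN -powR_inv1 // -!powRrM mulN1r powRN. Qed.

Lemma dyadic_budget_sum (a U V W Y Z B : R) : a + a = Z -> Y = Z + 4 * B ->
  U <= B -> V <= B -> W <= B -> 0 <= B -> a + U + (V + a) + W <= Y.
Proof. by lra. Qed.

(* The left-hand side collects the four errors made in passing from level m to
   level m + 1 of the dyadic compositions. *)
Lemma dyadic_budget (L h vt gam th q Kc Kd c eta : R) : 0 <= h -> 1 <= L -> 0 <= Kd -> 0 <= c ->
  0 <= Kc -> 0 <= eta -> 0 <= th <= 1 -> 0 < vt -> 0 < gam ->
  q = 2 `^ (1 - vt) -> 0 <= q -> Kc * eta <= (1 - q) / 4 -> c <= L * ((1 - q) / 4) ->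
  Kd * c * h `^ (gam - th * vt) <= (1 - q) / 4 -> q <= 1 ->
  (1 + Kc * eta) * (L * (h / 2) `^ vt) +
  (Kd * (c * (h / 2) `^ gam) * (L * (h / 2) `^ vt) `^ (1 - th) + L * (h / 2) `^ vt) + c * h `^ vt
  <= L * h `^ vt.
Proof.
move=> h0 L1 Kd0 c0 Kc0 eta0 /andP[th0 th1] vt0 gam0 qE q0 H1 H2 H3 q1.
have L0 : 0 <= L by exact: le_trans L1.
have X0 := powR_ge0 h vt.
have e2 : 2 `^ (- vt) * 2 = q.
  by rewrite qE addrC powRD ?pnatr_eq0 ?implybT // powRr1.
have Q0 : 0 <= 2 `^ (- vt) :> R by exact: powR_ge0.
have h20 : 0 <= h / 2 by rewrite divr_ge0.
have T2 : Kd * (c * (h / 2) `^ gam) * (L * (h / 2) `^ vt) `^ (1 - th) <= (1 - q) / 4 * (L * h `^ vt).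
  have hh : h / 2 <= h by rewrite ler_pdivrMr // ler_peMr // ler1n.
  apply: (@le_trans _ _ (Kd * (c * h `^ gam) * (L * h `^ (vt * (1 - th))))).
    apply: ler_pM; rewrite ?powR_ge0 ?mulr_ge0 ?powR_ge0 //.
      apply: ler_wpM2l => //; apply: ler_wpM2l => //.
      by apply: ge0_ler_powR; rewrite ?nnegrE // ltW.
    rewrite powRM ?powR_ge0 // -powRrM; apply: ler_pM; rewrite ?powR_ge0 //.
      by apply: ler1_powR => //; rewrite lerBlDr lerDl.
    by apply: ge0_ler_powR; rewrite ?nnegrE // mulr_ge0 ?subr_ge0 // ltW.
  have [->|hn0] := eqVneq h 0.
    by rewrite (powR0 (lt0r_neq0 gam0)) (powR0 (lt0r_neq0 vt0)) !mulr0 mul0r.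
  have E : h `^ gam * h `^ (vt * (1 - th)) = h `^ (gam - th * vt) * h `^ vt.
    by rewrite -!powRD ?hn0 ?implybT //; congr (_ `^ _); ring.
  have -> : Kd * (c * h `^ gam) * (L * h `^ (vt * (1 - th))) =
     Kd * c * (h `^ gam * h `^ (vt * (1 - th))) * L by ring.
  rewrite E (_ : Kd * c * (_ * _) * L = Kd * c * h `^ (gam - th * vt) * (L * h `^ vt)); last by ring.
  by apply: ler_wpM2r => //; rewrite mulr_ge0.
have EE : (h / 2) `^ vt = 2 `^ (- vt) * h `^ vt by exact: powR_half.
rewrite EE in T2 *; clear EE.
move: (h `^ vt) (2 `^ (- vt)) X0 e2 Q0 T2 => X p X0 e2 Q0 T2.
have p1 : p <= 1 by rewrite -(ler_pM2r (ltr0n R 2)) e2 mul1r (le_trans q1) // ler1n.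
have A1 : c * X <= L * ((1 - q) / 4) * X by rewrite ler_wpM2r.
have LX : 0 <= L * X by rewrite mulr_ge0.
have A2 : Kc * eta * (L * (p * X)) <= (1 - q) / 4 * (L * X).
  apply: ler_pM => //; rewrite ?mulr_ge0 //.
  by rewrite mulrCA ler_piMl.
rewrite mulrDl mul1r.
have A3 : L * (p * X) + L * (p * X) = q * (L * X) by rewrite -e2; ring.
have A4 : 0 <= (1 - q) / 4 * (L * X) by rewrite mulr_ge0 // divr_ge0 // subr_ge0.
have A5 : L * X = q * (L * X) + 4 * ((1 - q) / 4 * (L * X)) by field.
have A6 : L * ((1 - q) / 4) * X = (1 - q) / 4 * (L * X) by ring.
by apply: (dyadic_budget_sum A3 A5) => //; rewrite -A6.
Qed.

(** D and D' stand for the compositions over the left and right halves, B and A for mu there.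
    Removing the identity from A leaves D - B with coefficient exactly 1, while A - id is small and
    only meets the lossy estimate [hb_comp_diff]. *)
Lemma coord_telescope (D D' A B mu : E -> E) l :
  (fun x : E => D' (D x) 0 l - mu x 0 l) =
  (fun x => ((D' (D x) 0 l - A (D x) 0 l) +
     (((A (D x) 0 l - D x 0 l) - (A (B x) 0 l - B x 0 l)) + (D x 0 l - B x 0 l))) +
     (A (B x) 0 l - mu x 0 l)).
Proof. by apply/funext => x; ring. Qed.

(** Since vt > 1, two halves contribute 2 (h/2)^vt = q h^vt with q < 1. The gap 1 - q absorbs the
    other errors, so the same L works at every level m. The maps mu carry k + 2 derivatives for an
    estimate at order k + 1 on account of [hb_comp_diff]. *)
Theorem dyadic_scheme_bound (k : nat) (T th vt gam c eta1 : R) (mu : R -> R -> E -> E) :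
  0 <= th <= 1 -> 1 < vt -> 0 < gam -> th * vt < gam -> 0 <= c -> 0 < eta1 ->
  (forall s t, 0 <= s -> s < t -> t <= T -> t - s <= 1 -> forall l,
     hb 0 k.+2 setT (c * (t - s) `^ gam) (fun x => mu s t x 0 l - x 0 l)) ->
  (forall s t, 0 <= s -> s < t -> t <= T -> t - s <= 1 -> forall l,
     hb th k.+1 setT (c * (t - s) `^ vt)
       (fun x => mu ((s + t) / 2) t (mu s ((s + t) / 2) x) 0 l - mu s t x 0 l)) ->
  exists h0 L, [/\ 0 < h0 <= 1, 0 <= L &
    forall m s t, 0 <= s -> s < t -> t <= T -> t - s <= h0 ->
    (forall l, hb th k.+1 setT (L * (t - s) `^ vt)
       (fun x => dyadic_comp mu m s t x 0 l - mu s t x 0 l)) /\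
    near_id th k.+1 setT eta1 (dyadic_comp mu m s t)].
Proof.
move=> th01 vt1 gam0 thg c0 eta10 H1 H2.
have /andP[th0 th1] := th01; have vt0 : 0 < vt by exact: lt_trans vt1.
pose q : R := 2 `^ (1 - vt).
have q0 : 0 <= q by exact: powR_ge0.
have q1 : q < 1.
  rewrite -[ltRHS](powRr0 2) /q /powR !gt_eqF // ltr_expR mul0r.
  by rewrite pmulr_llt0 ?subr_lt0 // ln_gt0 // ltr1n.
have q14 : 0 < (1 - q) / 4 by rewrite divr_gt0 // subr_gt0.
have [Kc Kc0 HC] := @hb_comp R n k.+1.
have [Kd Kd0 HD] := @hb_comp_diff R n k.+1.
have n0 : 0 <= n%:R :> R by [].
have n1 : 1 <= 1 + n%:R :> R by rewrite lerDl.
have n1' : 0 <= 1 + n%:R :> R by exact: le_trans n1.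
(* The last bound on eta makes the loss Kc eta of [hb_comp] at most a quarter of the gap 1 - q. *)
pose eta := Num.min eta1 (Num.min 1 ((1 - q) / 4 / (Kc + 1))).
have Kc1 : 0 < Kc + 1 by rewrite ltr_wpDl.
have eta0 : 0 < eta by rewrite !lt_min eta10 ltr01 divr_gt0.
have ee1 : eta <= eta1 by rewrite ge_min lexx.
have e1 : eta <= 1 by rewrite !ge_min lexx orbT.
have Kce : Kc * eta <= (1 - q) / 4.
  apply: (@le_trans _ _ ((Kc + 1) * eta)); first by rewrite ler_wpM2r ?(ltW eta0) // lerDl.
  by rewrite mulrC -ler_pdivlMr // !ge_min lexx !orbT.
clearbody eta.
(* L is large enough for the defect constant c to use at most a quarter of the gap. *)
pose L := 1 + c / ((1 - q) / 4).
have L1 : 1 <= L by rewrite lerDl divr_ge0 // ltW.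
have L0 : 0 <= L by exact: le_trans L1.
have cL : c <= L * ((1 - q) / 4).
  by rewrite mulrDl divfK ?gt_eqF // lerDr mul1r ltW.
(* The thresholds ha and hb' each grant eta / 2: one for the distance from D to mu, the other for
   the distance from mu to the identity. *)
have [ha /andP[ha0 ha1] Ha] := small_powR (mulr_ge0 n1' L0) vt0 (divr_gt0 eta0 (ltr0n R 2)).
have [hb' /andP[hb0' hb1] Hb] := small_powR (mulr_ge0 n1' (mulr_ge0 n1' c0)) gam0 (divr_gt0 eta0 (ltr0n R 2)).
have dg : 0 < gam - th * vt by rewrite subr_gt0.
(* The exponent 1 - th in [hb_comp_diff] loses a factor h^(-th vt), which the factor h^gam of mu -
   id outweighs because th vt < gam. *)
have [hc /andP[hc0 hc1] Hc] := small_powR (mulr_ge0 Kd0 c0) dg q14.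
pose h0 := Num.min ha (Num.min hb' hc).
have h00 : 0 < h0 by rewrite !lt_min ha0 hb0' hc0.
have h01 : h0 <= 1 by rewrite ge_min ha1.
exists h0, L; split; rewrite ?h00 //.
have small s t : s < t -> t - s <= h0 -> [/\ 0 <= t - s,
    (1 + n%:R) * (L * (t - s) `^ vt + (1 + n%:R) * (c * (t - s) `^ gam)) <= eta,
    Kd * c * (t - s) `^ (gam - th * vt) <= (1 - q) / 4 & t - s <= 1].
  rewrite !le_min => st /and3P[h1 h2 h3].
  have ts0 : 0 <= t - s by rewrite subr_ge0 ltW.
  split => //; last exact: le_trans ha1.
    rewrite mulrDr [leRHS]splitr; apply: lerD; first by rewrite mulrA Ha // ts0.
    by rewrite !mulrA -(mulrA _ _ c) Hb // ts0.
  by apply: Hc; rewrite ts0.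
have near s t (D : E -> E) : 0 <= s -> s < t -> t <= T -> t - s <= h0 ->
   (forall l, hb th k.+1 setT (L * (t - s) `^ vt) (fun x => D x 0 l - mu s t x 0 l)) ->
   near_id th k.+1 setT eta D.
  move=> s0 st tT tsh HDl; have [ts0 S1 S2 S3] := small s t st tsh.
  apply: (@near_id_of_hb _ _ (L * (t - s) `^ vt + (1 + n%:R) * (c * (t - s) `^ gam))) => //.
    by rewrite addr_ge0 ?mulr_ge0 ?powR_ge0.
  move=> l; have -> : (fun x => D x 0 l - x 0 l) =
      fun x => (D x 0 l - mu s t x 0 l) + (mu s t x 0 l - x 0 l).
    by apply/funext => x; rewrite addrA subrK.
  apply: hbD => //.
  have C0 : 0 <= c * (t - s) `^ gam by rewrite mulr_ge0 ?powR_ge0.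
  have := hb_interpolate th01 convex_setT _ (hbS (H1 s t s0 st tT S3 l)) (H1 s t s0 st tT S3 l).
  rewrite C0 lexx => /(_ isT); apply: hb_le; rewrite -powRD ?subrK ?powRr1 //.
  by rewrite oner_eq0.
elim=> [|m IH] s t s0 st tT tsh.
  suff Z l : hb th k.+1 setT (L * (t - s) `^ vt) (fun x => dyadic_comp mu 0 s t x 0 l - mu s t x 0 l).
    by split=> //; apply: near_id_le ee1 _; exact: near Z.
  rewrite (_ : (fun x => _) = fun=> 0); last by apply/funext => x; rewrite subrr.
  by apply: hb_cst; rewrite normr0 mulr_ge0 ?powR_ge0.
suff Z l : hb th k.+1 setT (L * (t - s) `^ vt)
    (fun x => dyadic_comp mu m.+1 s t x 0 l - mu s t x 0 l).
  by split=> //; apply: near_id_le ee1 _; exact: near Z.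
have [ts0 S1 S2 S3] := small s t st tsh.
have /andP[sm mt] := midpoint_lt st; set w := (s + t) / 2 in sm mt *.
have [ws tw] := midpoint_sub s t.
have hle : (t - s) / 2 <= t - s by rewrite ler_pdivrMr // ler_peMr // ler1n.
have w0 : 0 <= w by rewrite (le_trans s0) // ltW.
have wT : w <= T by rewrite (le_trans (ltW mt)).
have wsh : w - s <= h0 by rewrite ws (le_trans hle).
have twh : t - w <= h0 by rewrite tw (le_trans hle).
have [IH1 _] := IH s w s0 sm wT wsh.
have [IH2 _] := IH w t w0 mt tT twh.
have nD := near _ _ _ s0 sm wT wsh IH1.
have nB : near_id th k.+1 setT eta (mu s w).
  apply: (near _ _ _ s0 sm wT wsh) => l'.
  rewrite (_ : (fun x => _) = fun=> 0); last by apply/funext => x; rewrite subrr.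
  by apply: hb_cst; rewrite normr0 mulr_ge0 ?powR_ge0.
have [_ S1' _ _] := small s w sm wsh.
have X0 : 0 <= L * ((t - s) / 2) `^ vt by rewrite mulr_ge0 ?powR_ge0.
have X1 : L * ((t - s) / 2) `^ vt <= 1.
  apply: le_trans e1; apply: le_trans S1'; rewrite -ws.
  apply: (@le_trans _ _ (1 * (L * (w - s) `^ vt))); first by rewrite mul1r.
  apply: ler_pM => //; first by rewrite ws.
  by rewrite lerDl mulr_ge0 // mulr_ge0 ?powR_ge0.
rewrite [X in hb _ _ _ _ X](coord_telescope (dyadic_comp mu m s w) (dyadic_comp mu m w t) (mu w t) (mu s w)).
apply: (hb_le (dyadic_budget ts0 L1 Kd0 c0 Kc0 (ltW eta0) th01 vt0 gam0 erefl q0 Kce cL S2 (ltW q1))).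
apply: hbD; last exact: H2.
apply: hbD; last first.
  apply: hbD; last by rewrite -ws; exact: IH1.
  have A0 : 0 <= c * ((t - s) / 2) `^ gam by rewrite mulr_ge0 ?powR_ge0.
  apply: (HD th setT setT _ _ (fun x => mu w t x 0 l - x 0 l) (mu s w)) => //.
  - by rewrite X0 X1.
  - exact: near_id_le e1 nB.
  - exact: near_id_le e1 nD.
  - by move=> l'; rewrite -ws; exact: IH1.
  - by rewrite -tw; apply: H1 => //; rewrite (le_trans twh).
apply: (HC th setT setT _ eta (fun x => dyadic_comp mu m w t x 0 l - mu w t x 0 l)) => //.
  by rewrite (ltW eta0).
by rewrite -tw; exact: IH2.
Qed.

End DyadicScheme.

(** * Dyadic limits and paths satisfying Davie's estimate *)

Section DyadicLimit.
Context {R : realType} {n : nat}.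
Local Notation E := 'rV[R]_n.

Lemma geometric_vanish (q e : R) : 0 <= q < 1 -> 0 < e -> exists M, forall m, (M <= m)%N -> q ^+ m < e.
Proof.
move=> /andP[q0 q1] e0; have : (q ^+ m @[m --> \oo] --> (0 : R))%classic.
  by apply: cvg_expr; rewrite ger0_norm.
move=> /(cvgr_dist_lt) /(_ e e0) [M _ HM]; exists M => m /HM /=.
by rewrite sub0r normrN ger0_norm // exprn_ge0.
Qed.

(** Davie's description of a solution: the path follows mu up to an error of order vt over short
    steps. In all uses of limits vt > 1. It mentions no controlled path, and C may depend on the
    path. *)
Definition davie_path (mu : R -> R -> E -> E) (vt a b C h : R) (y : R -> E) :=
  forall r t, a <= r -> r < t -> t <= b -> t - r <= h -> `|y t - mu r t (y r)| <= C * (t - r) `^ vt.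

(** Inserting the composition over the right half started at y w, the error is that of the right
    half plus 1 + eta times that of the left half. Each level thus multiplies the error by (2 + eta)
    2^(-vt). *)
Lemma dyadic_comp_davie (mu : R -> R -> E -> E) th k vt T h0 eta a b C h1 y :
  0 <= a -> b <= T -> 0 <= C -> 0 <= eta ->
  (forall m s t, 0 <= s -> s < t -> t <= T -> t - s <= h0 ->
     near_id th k setT eta (dyadic_comp mu m s t)) ->
  davie_path mu vt a b C h1 y ->
  forall m r t, a <= r -> r < t -> t <= b -> t - r <= h0 -> t - r <= h1 ->
  `|y t - dyadic_comp mu m r t (y r)| <= C * ((2 + eta) * 2 `^ (- vt)) ^+ m * (t - r) `^ vt.
Proof.
move=> a0 bT C0 eta0 nid Hy; elim=> [|m IH] r t ar rt tb trh0 trh1.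
  by rewrite expr0 mulr1; exact: Hy.
have /andP[rm mt] := midpoint_lt rt; have [mr tm] := midpoint_sub r t.
rewrite /=; set w := (r + t) / 2 in rm mt mr tm *.
have tr0 : 0 <= t - r by rewrite subr_ge0 ltW.
have hle : (t - r) / 2 <= t - r by rewrite ler_pdivrMr // ler_peMr // ler1n.
have aw : a <= w by rewrite (le_trans ar) // ltW.
have wb : w <= b by rewrite (le_trans (ltW mt)).
set D1 := dyadic_comp mu m r w (y r).
rewrite -(subrKA (dyadic_comp mu m w t (y w))).
apply: le_trans (ler_normD _ _) _.
have I1 : `|y w - D1| <= C * ((2 + eta) * 2 `^ (- vt)) ^+ m * (w - r) `^ vt.
  by apply: IH => //; rewrite mr; apply: le_trans hle _.
have I2 : `|y t - dyadic_comp mu m w t (y w)| <= C * ((2 + eta) * 2 `^ (- vt)) ^+ m * (t - w) `^ vt.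
  by apply: IH => //; rewrite tm; apply: le_trans hle _.
have nD := nid m w t (le_trans a0 aw) mt (le_trans tb bT) (ltac:(by rewrite tm; apply: le_trans hle _)).
have I3 := near_id_lip nD (x := y w) (y := D1) I I.
have I4 := le_trans I3 (ler_wpM2l (addr_ge0 ler01 eta0) I1).
apply: le_trans (lerD I2 I4) _.
rewrite mr tm powR_half // le_eqVlt exprS; apply/orP; left; apply/eqP; ring.
Qed.

Lemma row_tends_unique (u : nat -> E) (a b : E) : (forall l, tends (fun m => u m 0 l) (a 0 l)) ->
  (forall l, tends (fun m => u m 0 l) (b 0 l)) -> a = b.
Proof. by move=> ua ub; apply/rowP => l; exact: tends_unique (ua l) (ub l). Qed.

(** The bounds are uniform in m, and every path with Davie's estimate is a pointwise limit of the
    dyadic compositions; h0 and L are chosen before the path. *)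
Theorem dyadic_flow (k : nat) (T th vt gam c : R) (mu : R -> R -> E -> E) :
  0 <= th <= 1 -> 1 < vt -> 0 < gam -> th * vt < gam -> 0 <= c ->
  (forall s t, 0 <= s -> s < t -> t <= T -> t - s <= 1 -> forall l,
     hb 0 k.+2 setT (c * (t - s) `^ gam) (fun x => mu s t x 0 l - x 0 l)) ->
  (forall s t, 0 <= s -> s < t -> t <= T -> t - s <= 1 -> forall l,
     hb th k.+1 setT (c * (t - s) `^ vt)
       (fun x => mu ((s + t) / 2) t (mu s ((s + t) / 2) x) 0 l - mu s t x 0 l)) ->
  exists h0 L, [/\ 0 < h0 <= 1, 0 <= L,
    forall m s t, 0 <= s -> s < t -> t <= T -> t - s <= h0 ->
     forall l, hb th k.+1 setT (L * (t - s) `^ vt)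
       (fun x => dyadic_comp mu m s t x 0 l - mu s t x 0 l) &
    forall a b C h1 y, 0 <= a -> b <= T -> 0 <= C -> davie_path mu vt a b C h1 y ->
    forall r t, a <= r -> r < t -> t <= b -> t - r <= h0 -> t - r <= h1 ->
    forall l, tends (fun m => dyadic_comp mu m r t (y r) 0 l) (y t 0 l)].
Proof.
move=> th01 vt1 gam0 thg c0 H1 H2.
pose q : R := 2 `^ (1 - vt).
have q0 : 0 <= q by exact: powR_ge0.
have q1 : q < 1.
  rewrite -[ltRHS](powRr0 2) /q /powR !gt_eqF // ltr_expR mul0r.
  by rewrite pmulr_llt0 ?subr_lt0 // ln_gt0 // ltr1n.
have e2 : 2 `^ (- vt) * 2 = q by rewrite /q addrC powRD ?pnatr_eq0 ?implybT // powRr1.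
have p0 : 0 <= 2 `^ (- vt) :> R by exact: powR_ge0.
have p1 : 2 `^ (- vt) <= 1 :> R.
  by rewrite -(ler_pM2r (ltr0n R 2)) e2 mul1r (le_trans (ltW q1)) // ler1n.
have eta0 : 0 < (1 - q) / 2 by rewrite divr_gt0 // subr_gt0.
(* With eta = (1 - q) / 2 the ratio is at most q + (1 - q) / 2, which is below 1. *)
have Q1 : (2 + (1 - q) / 2) * 2 `^ (- vt) < 1.
  rewrite mulrDl mulrC e2; apply: (@le_lt_trans _ _ (q + (1 - q) / 2)).
    by rewrite lerD2l ler_piMr // ltW.
  by clear -q1; lra.
have Q0 : 0 <= (2 + (1 - q) / 2) * 2 `^ (- vt) by rewrite mulr_ge0 // addr_ge0 // ltW.
have [h0 [L [h01 L0 HL]]] := dyadic_scheme_bound th01 vt1 gam0 thg c0 eta0 H1 H2.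
exists h0, L; split => // [m s t s0 st tT tsh|]; first by have [] := HL m s t s0 st tT tsh.
move=> a b C h1 y a0 bT C0 Hy r t ar rt tb trh0 trh1 l e e0.
have nid m s t' : 0 <= s -> s < t' -> t' <= T -> t' - s <= h0 ->
    near_id th k.+1 setT ((1 - q) / 2) (dyadic_comp mu m s t').
  by move=> s0 st tT tsh; have [] := HL m s t' s0 st tT tsh.
pose A := C * (t - r) `^ vt + 1.
have A0 : 0 < A by rewrite ltr_wpDl // mulr_ge0 // powR_ge0.
have [||M HM] := @geometric_vanish ((2 + (1 - q) / 2) * 2 `^ (- vt)) (e / A); rewrite ?Q0 ?divr_gt0 //.
exists M => m /HM Hm.
have := dyadic_comp_davie a0 bT C0 (ltW eta0) nid Hy m ar rt tb trh0 trh1.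
rewrite -normrN opprB => H.
have : `|(dyadic_comp mu m r t (y r) - y t) 0 l| <= A * ((2 + (1 - q) / 2) * 2 `^ (- vt)) ^+ m.
  apply: le_trans (row_entry_le _ _) _; apply: le_trans H _.
  by rewrite mulrAC ler_wpM2r ?exprn_ge0 // lerDl.
rewrite !mxE; move=> /le_lt_trans; apply.
by rewrite mulrC -ltr_pdivlMr.
Qed.

Lemma davie_path_restrict mu vt a b C h y a' : a <= a' ->
  davie_path mu vt a b C h y -> davie_path mu vt a' b C h y.
Proof. by move=> aa H r t ar; apply: H; exact: le_trans ar. Qed.

(** Over a short step both paths are limits of the same sequence of compositions from a common
    point. Unrelated constants do no harm; induction on the number of short steps reaches b. *)
Lemma davie_path_unique (mu : R -> R -> E -> E) vt T h0 :  0 < h0 ->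
  (forall a b C h1 y, 0 <= a -> b <= T -> 0 <= C -> davie_path mu vt a b C h1 y ->
    forall r t, a <= r -> r < t -> t <= b -> t - r <= h0 -> t - r <= h1 ->
    forall l, tends (fun m => dyadic_comp mu m r t (y r) 0 l) (y t 0 l)) ->
  forall a b C C' h1 h1' y z, 0 <= a -> b <= T -> 0 <= C -> 0 <= C' -> 0 < h1 -> 0 < h1' ->
  davie_path mu vt a b C h1 y -> davie_path mu vt a b C' h1' z -> y a = z a ->
  forall t, a <= t <= b -> y t = z t.
Proof.
move=> h00 Hlim a b C C' h1 h1' y z a0 bT C0 C0' h10 h10' Hy Hz ya.
pose h := Num.min h0 (Num.min h1 h1').
have h_0 : 0 < h by rewrite !lt_min h00 h10 h10'.
suff H j t : a <= t <= b -> t - a <= j%:R * h -> y t = z t.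
  move=> t atb; apply: (H (Num.truncn ((t - a) / h)).+1) => //.
  by rewrite -ler_pdivrMr // ltW // truncnS_gt.
elim: j t => [|j IH] t /andP[at_ tb] th.
  by rewrite (_ : t = a) //; apply/eqP; rewrite eq_le at_ andbT -subr_le0 (le_trans th) // mul0r.
have [->//|ta] := eqVneq t a.
have alt : a < t by rewrite lt_neqAle eq_sym ta.
pose r := Num.max a (t - h).
have rt : r < t by rewrite gt_max alt /= ltrBlDr ltrDl.
have ar : a <= r by rewrite le_max lexx.
have trh : t - r <= h by rewrite lerBlDr -lerBlDl le_max lexx orbT.
have yz : y r = z r.
  apply: IH; first by rewrite ar (le_trans (ltW rt)).
  rewrite /r; case: (lerP a (t - h)) => _; last by rewrite subrr mulr_ge0 // ltW.
  by rewrite addrAC lerBlDr (le_trans th) // -natr1 mulrDl mul1r.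
move: trh; rewrite !le_min => /and3P[t1 t2 t3].
apply: (@row_tends_unique (fun m => dyadic_comp mu m r t (y r))).
  by move=> l; apply: (Hlim a b C h1).
by rewrite yz => l; apply: (Hlim a b C' h1').
Qed.

End DyadicLimit.

(** * Functionals on words *)

Section Words.
Context {R : realType} {d : nat}.
Local Notation word := (word d).
Implicit Types (g h P Q W : word -> R) (u v w : word).

Lemma star_nil g h : star g h [::] = g [::] * h [::].
Proof. by rewrite /star big_ord1. Qed.

Lemma star_cons g h a w :
  star g h (a :: w) = g [::] * h (a :: w) + star (fun v => g (a :: v)) h w.
Proof. by rewrite /star big_ord_recl. Qed.

Lemma star_linear c g g' h w :
  star (fun v => c * g v + g' v) h w = c * star g h w + star g' h w.
Proof.
rewrite /star mulr_sumr -big_split /=; apply: eq_bigr => k _.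
by rewrite mulrDl mulrA.
Qed.

Lemma starA g h k : star (star g h) k = star g (star h k).
Proof.
apply/funext => w; elim: w g h => [|a w IH] g h; first by rewrite !star_nil mulrA.
rewrite !star_cons star_nil.
rewrite (_ : (fun v => _) = fun v => g [::] * h (a :: v) + star (fun v => g (a :: v)) h v).
  by rewrite star_linear IH mulrDr addrA mulrA.
by apply/funext => v; rewrite star_cons.
Qed.

Lemma star1g g : star (star1 R (d:=d)) g = g.
Proof.
apply/funext => -[|a w]; first by rewrite star_nil /star1 eqxx mul1r.
rewrite star_cons /star1 eqxx mul1r -[RHS]addr0; congr (_ + _).
by rewrite /star big1 // => k _; rewrite mul0r.
Qed.

Lemma star_cancel g h : g [::] = 1 -> star g (star (starV g) h) = h.
Proof.
move=> g1; rewrite -starA (_ : star g (starV g) = star1 R (d:=d)) ?star1g //.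
by apply/funext => w; exact: star_starV.
Qed.

Lemma incr_chen (W : R -> word -> R) s r t : W r [::] = 1 ->
  incr W s t = star (incr W s r) (incr W r t).
Proof. by move=> Wr; rewrite /incr starA star_cancel. Qed.

Lemma starV_nil g : g [::] = 1 -> starV g [::] = 1.
Proof. by move=> g1; have := star_starV g1 [::]; rewrite star_nil g1 mul1r /star1 eqxx. Qed.

Lemma incr_nil (W : R -> word -> R) s t : W s [::] = 1 -> W t [::] = 1 -> incr W s t [::] = 1.
Proof. by move=> Ws Wt; rewrite /incr star_nil starV_nil // Wt mul1r. Qed.

Definition shuffle_eval W u v := \sum_(w <- shuffle u v) W w.

Lemma shuffle_eval0l W v : shuffle_eval W [::] v = W v.
Proof. by rewrite /shuffle_eval big_seq1. Qed.

Lemma shuffle_eval0r W u : shuffle_eval W u [::] = W u.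
Proof. by case: u => [|a u]; rewrite /shuffle_eval big_seq1. Qed.

Lemma shuffle_eval_cons W a u b v : shuffle_eval W (a :: u) (b :: v) =
  shuffle_eval (fun w => W (a :: w)) u (b :: v) + shuffle_eval (fun w => W (b :: w)) (a :: u) v.
Proof. by rewrite /shuffle_eval /= big_cat !big_map. Qed.

Lemma shuffle_eval_linear c W W' u v :
  shuffle_eval (fun w => c * W w + W' w) u v = c * shuffle_eval W u v + shuffle_eval W' u v.
Proof. by rewrite /shuffle_eval big_split /= mulr_sumr. Qed.

(** Bookkeeping for [shuffle_eval_star]: F is the term with prefixes of lengths i and j, while A and
    B are the parts whose shuffled prefix begins with a letter of the first or of the second word.
    On the two boundary rows only one of them occurs. *)
Lemma sum_ord_double_recl (p q : nat) (F A B : nat -> nat -> R) c :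
  F 0%N 0%N = c ->
  (forall i j, (i <= p)%N -> (j <= q)%N -> F i.+1 j.+1 = A i j.+1 + B i.+1 j) ->
  (forall i, (i <= p)%N -> F i.+1 0%N = A i 0%N) ->
  (forall j, (j <= q)%N -> F 0%N j.+1 = B 0%N j) ->
  \sum_(i < p.+2) \sum_(j < q.+2) F i j =
  c + \sum_(i < p.+1) \sum_(j < q.+2) A i j + \sum_(i < p.+2) \sum_(j < q.+1) B i j.
Proof.
move=> Fc FAB FA FB; have bE j : bump 0 j = j.+1 by rewrite /bump leq0n add1n.
have FB' (j : 'I_q.+1) : F 0%N j.+1 = B 0%N j by apply: FB; rewrite -ltnS.
have FA' (i : 'I_p.+1) : F i.+1 0%N = A i 0%N by apply: FA; rewrite -ltnS.
have FAB' (i : 'I_p.+1) (j : 'I_q.+1) : F i.+1 j.+1 = A i j.+1 + B i.+1 j.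
  by apply: FAB; rewrite -ltnS.
rewrite [LHS]big_ord_recl [\sum_(j < q.+2) F _ _]big_ord_recl /= Fc -!addrA; congr (_ + _).
rewrite [\sum_(i < p.+2) _]big_ord_recl /=.
under eq_bigr => j _ do rewrite bE FB'.
rewrite addrCA; congr (_ + _); rewrite -big_split /=; apply: eq_bigr => i _.
rewrite big_ord_recl [X in _ = X + _]big_ord_recl /= !bE FA' -addrA; congr (_ + _).
by rewrite -big_split /=; apply: eq_bigr => j _; rewrite !bE FAB'.
Qed.

(** Deconcatenation is multiplicative for the shuffle product: cutting a shuffle of u and v cuts u
    and v. *)
Lemma shuffle_eval_star g h u v : shuffle_eval (star g h) u v =
  \sum_(i < (size u).+1) \sum_(j < (size v).+1)
    shuffle_eval g (take i u) (take j v) * shuffle_eval h (drop i u) (drop j v).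
Proof.
elim: u v g h => [|a u IHu] v g h.
  rewrite big_ord1 shuffle_eval0l; apply: eq_bigr => j _.
  by rewrite !shuffle_eval0l.
elim: v g h => [|b v IHv] g h.
  rewrite shuffle_eval0r; apply: eq_bigr => i _; rewrite big_ord1 take0 drop0.
  by rewrite !shuffle_eval0r.
rewrite shuffle_eval_cons.
under [X in shuffle_eval X u (b :: v)]eq_fun do rewrite star_cons.
under [X in shuffle_eval X (a :: u) v]eq_fun do rewrite star_cons.
rewrite !shuffle_eval_linear addrACA -mulrDr -shuffle_eval_cons IHu IHv.
rewrite (@sum_ord_double_recl _ _ (fun i j => shuffle_eval g (take i (a :: u)) (take j (b :: v)) *
     shuffle_eval h (drop i (a :: u)) (drop j (b :: v)))
  (fun i j => shuffle_eval (fun w => g (a :: w)) (take i u) (take j (b :: v)) *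
     shuffle_eval h (drop i u) (drop j (b :: v)))
  (fun i j => shuffle_eval (fun w => g (b :: w)) (take i (a :: u)) (take j v) *
     shuffle_eval h (drop i (a :: u)) (drop j v))
  (g [::] * shuffle_eval h (a :: u) (b :: v))) ?addrA //=.
- by rewrite shuffle_eval0l.
- by move=> i j _ _; rewrite shuffle_eval_cons mulrDl.
- by move=> i _; rewrite !shuffle_eval0r.
- by move=> j _; rewrite !shuffle_eval0l.
Qed.

Definition shuffle_character N W := forall u v, (size u + size v <= N)%N ->
  shuffle_eval W u v = W u * W v.

(** Expand both sides for star g h by [shuffle_eval_star]. By induction on |u| + |v| all terms with
    i + j > 0 agree, so the remaining one agrees too. Applied to g = W_s and h = W_st, this gives
    geometricity of increments without examining [starV]. *)
Lemma shuffle_character_quotient N g h : g [::] = 1 -> shuffle_character N g ->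
  shuffle_character N (star g h) -> shuffle_character N h.
Proof.
move=> g1 gN ghN u v; have [m um] := ubnP (size u + size v).
elim: m u v um => // m IH u v um uvN.
have /eqP := ghN u v uvN; rewrite shuffle_eval_star.
have -> : star g h u * star g h v = \sum_(i < (size u).+1) \sum_(j < (size v).+1)
    (g (take i u) * h (drop i u)) * (g (take j v) * h (drop j v)).
  by rewrite /star mulr_suml; apply: eq_bigr => i _; rewrite mulr_sumr.
rewrite -subr_eq0 -sumrB.
under eq_bigr do rewrite -sumrB.
have E (i : 'I_(size u).+1) (j : 'I_(size v).+1) :
    shuffle_eval g (take i u) (take j v) * shuffle_eval h (drop i u) (drop j v) -
      g (take i u) * h (drop i u) * (g (take j v) * h (drop j v)) =
    if (i == ord0) && (j == ord0) then shuffle_eval h u v - h u * h v else 0.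
  have iu := ltn_ord i; have jv := ltn_ord j; rewrite ltnS in iu; rewrite ltnS in jv.
  case: ifP => [/andP[/eqP -> /eqP ->] /=|].
    by rewrite !take0 !drop0 shuffle_eval0l g1 !mul1r.
  move=> ij0; rewrite gN; last first.
    by rewrite !size_take_min (leq_trans _ uvN) // leq_add // geq_minr.
  rewrite IH; first by ring.
    rewrite !size_drop.
    have : (0 < i + j)%N by rewrite lt0n addn_eq0; move: ij0; rewrite -!val_eqE /= => ->.
    by move: um iu jv; clear; lia.
  by rewrite !size_drop (leq_trans _ uvN) // leq_add // leq_subr.
under eq_bigr do under eq_bigr do rewrite E.
rewrite big_ord_recl /= [X in _ + X]big1 ?addr0 => [|i _]; last first.
  by rewrite big1 // => j _; rewrite -val_eqE.
rewrite big_ord_recl /= [X in _ + X]big1 ?addr0 => [|i _]; last by [].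
by rewrite subr_eq0 => /eqP.
Qed.

Lemma incr_shuffle_character N (W : R -> word -> R) s t : in_G N (W s) -> in_G N (W t) ->
  shuffle_character N (incr W s t).
Proof.
move=> [s1 sN] [t1 tN]; apply: (@shuffle_character_quotient _ (W s)) => //.
by rewrite /incr star_cancel.
Qed.

(** The sum over words of length at most m in a form that recurses on the first letter, as [star],
    [shuffle] and the Lie derivatives do; [wsum_bseq] ties it to the sums in the definitions. It is
    locked below against unfolding. *)
Fixpoint wsum_rec (m : nat) (G : word -> R) : R :=
  match m with
  | 0%N => G [::]
  | m'.+1 => G [::] + \sum_(i < d) wsum_rec m' (fun w => G (i :: w))
  end.

Definition wsum := locked wsum_rec.

Lemma wsum_ord0 G : wsum 0 G = G [::].
Proof. by rewrite /wsum -lock. Qed.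

Lemma wsumS m G : wsum m.+1 G = G [::] + \sum_(i < d) wsum m (fun w => G (i :: w)).
Proof. by rewrite /wsum -lock. Qed.

Lemma wsum_bseq m (G : word -> R) : \sum_(w : m.-bseq 'I_d) G w = wsum m G.
Proof.
elim: m G => [|m IH] G; rewrite ?wsum_ord0 ?wsumS.
  rewrite (bigD1 [bseq]) //= big1 ?addr0 // => w /eqP wn; case: wn; apply: val_inj => /=.
  by apply/eqP; rewrite -size_eq0 -leqn0; exact: size_bseq.
rewrite (bigD1 [bseq]) //=; congr (_ + _).
pose cons_ (p : 'I_d * m.-bseq 'I_d) : m.+1.-bseq 'I_d := [bseq of p.1 :: p.2].
pose uncons (w : m.+1.-bseq 'I_d) : option ('I_d * m.-bseq 'I_d) :=
  if val w is i :: w' then omap (pair i) (insub w') else None.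
have consK p : uncons (cons_ p) = Some p.
  by case: p => i w; rewrite /uncons /= valK.
rewrite (reindex_omap cons_ uncons) => [|w wn]; last first.
  case: w wn => -[|i w] wm //; rewrite -val_eqE //= => _.
  by rewrite /uncons /= insubT //=; congr Some; exact: val_inj.
under eq_bigl do rewrite consK eqxx andbT -val_eqE /=.
transitivity (\sum_(i < d) \sum_(w : m.-bseq 'I_d) G (i :: w)); first by rewrite pair_bigA.
by apply: eq_bigr => i _; exact: IH.
Qed.

Lemma wsumD m F G : wsum m (fun w => F w + G w) = wsum m F + wsum m G.
Proof.
elim: m F G => [|m IH] F G; rewrite ?wsum_ord0 // !wsumS addrACA -big_split /=.
by congr (_ + _); apply: eq_bigr => i _; exact: IH.
Qed.

Lemma wsumZ m c F : wsum m (fun w => c * F w) = c * wsum m F.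
Proof.
elim: m F => [|m IH] F; rewrite ?wsum_ord0 // !wsumS mulrDr mulr_sumr.
by congr (_ + _); apply: eq_bigr => i _; exact: IH.
Qed.

Lemma wsum0 m : wsum m (fun=> 0) = 0.
Proof. by elim: m => [|m IH]; rewrite ?wsum_ord0 // wsumS add0r big1. Qed.

Lemma eq_wsum m F G : (forall w, (size w <= m)%N -> F w = G w) -> wsum m F = wsum m G.
Proof.
elim: m F G => [|m IH] F G H; first by rewrite !wsum_ord0 H.
by rewrite !wsumS H //; congr (_ + _); apply: eq_bigr => i _; apply: IH => w wm; apply: H.
Qed.

(** The sum over pairs of words with |u| + |v| <= m, recursing on the first letter of u. *)
Fixpoint wsum2_rec (m : nat) (G : word -> word -> R) : R :=
  match m with
  | 0%N => G [::] [::]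
  | m'.+1 => wsum m (G [::]) + \sum_(i < d) wsum2_rec m' (fun u => G (i :: u))
  end.

Definition wsum2 := locked wsum2_rec.

Lemma wsum2_ord0 G : wsum2 0 G = G [::] [::].
Proof. by rewrite /wsum2 -lock. Qed.

Lemma wsum2S m G : wsum2 m.+1 G = wsum m.+1 (G [::]) + \sum_(i < d) wsum2 m (fun u => G (i :: u)).
Proof. by rewrite /wsum2 -lock. Qed.

Lemma wsum2D m F G : wsum2 m (fun u v => F u v + G u v) = wsum2 m F + wsum2 m G.
Proof.
elim: m F G => [|m IH] F G; rewrite ?wsum2_ord0 // !wsum2S wsumD (eq_bigr _ (fun i _ => IH _ _)) big_split.
exact: addrACA.
Qed.

Lemma wsum2_0 m G : (forall u v, G u v = 0) -> wsum2 m G = 0.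
Proof.
elim: m G => [|m IH] G H; first by rewrite wsum2_ord0 H.
rewrite wsum2S (eq_wsum (G := fun=> 0)) // wsum0 add0r big1 // => i _.
exact: IH.
Qed.

Lemma eq_wsum2 m F G : (forall u v, F u v = G u v) -> wsum2 m F = wsum2 m G.
Proof. by move=> H; congr wsum2; apply/funext => u; apply/funext. Qed.

Lemma wsum2_recr m G : wsum2 m.+1 G =
  wsum m.+1 (G^~ [::]) + \sum_(i < d) wsum2 m (fun u v => G u (i :: v)).
Proof.
elim: m G => [|m IH] G; first
  (rewrite wsum2S !wsumS addrAC; congr (_ + _ + _); apply: eq_bigr => i _;
   by rewrite wsum_ord0 wsum2_ord0).
rewrite wsum2S [X in _ + X = _](eq_bigr _ (fun i _ => IH _)) big_split /= exchange_big /=.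
rewrite [in RHS](eq_bigr _ (fun i _ => wsum2S _ _)) big_split /=.
by rewrite wsumS [wsum m.+2 _]wsumS -!addrA; congr (_ + _); exact: addrCA.
Qed.

Lemma wsum2_swap m G : wsum2 m G = wsum2 m (fun u v => G v u).
Proof.
elim: m G => [|m IH] G; rewrite ?wsum2_ord0 // wsum2_recr wsum2S; congr (_ + _).
by apply: eq_bigr => i _; exact: IH.
Qed.

Lemma wsum2_nested m G : wsum2 m G = wsum m (fun u => wsum (m - size u) (G u)).
Proof.
elim: m G => [|m IH] G; rewrite ?(wsum2_ord0, wsum_ord0) // wsum2S [RHS]wsumS subn0.
by congr (_ + _); apply: eq_bigr => i _; rewrite IH.
Qed.

Lemma wsum_star m F g h :
  wsum m (fun w => F w * star g h w) = wsum2 m (fun u v => F (u ++ v) * (g u * h v)).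
Proof.
elim: m F g => [|m IH] F g; first by rewrite wsum2_ord0 wsum_ord0 star_nil.
rewrite wsum2S !wsumS star_nil.
have E i : wsum m (fun w => F (i :: w) * star g h (i :: w)) =
    wsum m (fun w => F (i :: w) * (g [::] * h (i :: w))) +
    wsum2 m (fun u v => F (i :: u ++ v) * (g (i :: u) * h v)).
  rewrite -(IH (fun w => F (i :: w)) (fun v => g (i :: v))) -wsumD.
  by apply: eq_wsum => w _; rewrite star_cons mulrDr.
by rewrite (eq_bigr _ (fun i _ => E i)) big_split addrA.
Qed.

(** The coefficient of w in the shuffle product of the formal series with coefficients P and Q: each
    letter of w is assigned either to u or to v. *)
Fixpoint fshuffle (w : word) (P Q : word -> R) : R :=
  match w with
  | [::] => P [::] * Q [::]
  | i :: w' => fshuffle w' (fun u => P (i :: u)) Q + fshuffle w' P (fun u => Q (i :: u))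
  end.

Lemma wsum2_indicator m c : wsum2 m (fun u v => if u is [::] then if v is [::] then c else 0 else 0) = c.
Proof.
case: m => [|m]; rewrite ?wsum2_ord0 // wsum2S wsumS.
by rewrite !big1 ?addr0 // => i _; [exact: wsum2_0|exact: wsum0].
Qed.

Lemma wsum_fshuffle m P Q W : wsum m (fun w => fshuffle w P Q * W w) =
  wsum2 m (fun u v => P u * Q v * shuffle_eval W u v).
Proof.
elim: m P Q W => [|m IH] P Q W; first by rewrite wsum_ord0 wsum2_ord0 shuffle_eval0l.
(* The pairs are sorted by how the shuffle starts: G0 collects the empty shuffle, G1 those beginning
   with a letter of u, G2 those beginning with a letter of v. This mirrors the recursion of
   [fshuffle]. *)
pose G0 (u v : word) := if u is [::] then if v is [::] then P [::] * Q [::] * W [::] else 0 else 0.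
pose G1 u v := if u is i :: u' then P u * Q v * shuffle_eval (fun w => W (i :: w)) u' v else 0.
pose G2 u v := if v is i :: v' then P u * Q v * shuffle_eval (fun w => W (i :: w)) u v' else 0.
rewrite (@eq_wsum2 m.+1 _ (fun u v => G0 u v + (G1 u v + G2 u v))); last first.
  case=> [|a u] [|b v]; rewrite /G0 /G1 /G2 ?add0r ?addr0.
  - by rewrite shuffle_eval0l.
  - by rewrite !shuffle_eval0l.
  - by rewrite !shuffle_eval0r.
  - by rewrite shuffle_eval_cons mulrDr.
have Z1 : wsum m.+1 (G1 [::]) = 0 by exact: wsum0.
have Z2 : wsum m.+1 (G2^~ [::]) = 0 by exact: wsum0.
rewrite wsum2D wsum2_indicator wsum2D (wsum2_recr m G2) (wsum2S m G1) Z1 ?Z2 !add0r.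
rewrite -big_split wsumS /=.
congr (_ + _); apply: eq_bigr => i _; rewrite -!IH -wsumD.
by apply: eq_wsum => w _; rewrite mulrDl.
Qed.

End Words.

(** * Iterated Lie derivatives *)

Section LieDerivatives.
Context {R : realType} {n d : nat}.
Local Notation E := 'rV[R]_n.
Local Notation word := (word d).
Implicit Types (phi psi : E -> R) (x y : E).
Variable f : 'I_d -> E -> E.

Lemma smooth_differentiable k phi x : smooth k.+1 phi -> differentiable phi x.
Proof. exact: hb_differentiable. Qed.

Lemma smooth_pd k phi m : smooth k.+1 phi -> smooth k (pd m phi).
Proof. exact: hb_pd. Qed.

Lemma smooth_pd_comm k phi i j : smooth k.+2 phi -> pd i (pd j phi) = pd j (pd i phi).
Proof. exact: pd_comm_hb. Qed.

Definition lie (i : 'I_d) (phi : E -> R) : E -> R :=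
  fun x => \sum_m f i x 0 m * pd m phi x.

Definition lies (w : word) (phi : E -> R) : E -> R := foldr lie phi w.

Lemma lies_cat u v phi : lies (u ++ v) phi = lies u (lies v phi).
Proof. by rewrite /lies foldr_cat. Qed.

Lemma lie_coord i l : lie i (fun x => x 0 l) = fun x => f i x 0 l.
Proof.
apply/funext => x; rewrite /lie (bigD1 l) //= pd_coord eqxx mulr1 big1 ?addr0 // => m ml.
by rewrite pd_coord (negbTE ml) mulr0.
Qed.

Lemma lieD i phi psi x : differentiable phi x -> differentiable psi x ->
  lie i (fun y => phi y + psi y) x = lie i phi x + lie i psi x.
Proof.
by move=> dp ds; rewrite /lie -big_split; apply: eq_bigr => m _; rewrite pdD // mulrDr.
Qed.

Lemma lieB i phi psi x : differentiable phi x -> differentiable psi x ->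
  lie i (fun y => phi y - psi y) x = lie i phi x - lie i psi x.
Proof.
by move=> dp ds; rewrite /lie -sumrB; apply: eq_bigr => m _; rewrite pdB // mulrBr.
Qed.

Lemma lieZ i c phi x : differentiable phi x ->
  lie i (fun y => c * phi y) x = c * lie i phi x.
Proof.
by move=> dp; rewrite /lie mulr_sumr; apply: eq_bigr => m _; rewrite pdZ // mulrCA.
Qed.

Lemma lieM i phi psi x : differentiable phi x -> differentiable psi x ->
  lie i (fun y => phi y * psi y) x = lie i phi x * psi x + phi x * lie i psi x.
Proof.
move=> dp ds; rewrite /lie mulr_suml mulr_sumr -big_split; apply: eq_bigr => m _ /=.
by rewrite pdM // mulrDr mulrA mulrCA.
Qed.

Lemma lie_sum i (I : Type) (r : seq I) (phi : I -> E -> R) x :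
  (forall j, differentiable (phi j) x) ->
  lie i (fun y => \sum_(j <- r) phi j y) x = \sum_(j <- r) lie i (phi j) x.
Proof.
move=> dp; rewrite /lie exchange_big /=; apply: eq_bigr => m _.
by rewrite pd_sum // mulr_sumr.
Qed.

Lemma lie_cst0 i x : lie i (fun=> 0) x = 0.
Proof. by rewrite /lie big1 // => m _; rewrite pd_cst mulr0. Qed.

Lemma differentiable_fshuffle w (P Q : word -> E -> R) x :
  (forall u, (size u <= size w)%N -> differentiable (P u) x) ->
  (forall u, (size u <= size w)%N -> differentiable (Q u) x) ->
  differentiable (fun y => fshuffle w (P^~ y) (Q^~ y)) x.
Proof.
elim: w P Q => [|a w IH] P Q dP dQ.
  by apply: differentiableM; [exact: dP|exact: dQ].
apply: differentiableD; apply: IH => u uw; [exact: dP|exact/dQ/leqW|exact/dP/leqW|exact: dQ].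
Qed.

Lemma lie_fshuffle i w (P Q : word -> E -> R) x :
  (forall u, (size u <= size w)%N -> differentiable (P u) x) ->
  (forall u, (size u <= size w)%N -> differentiable (Q u) x) ->
  lie i (fun y => fshuffle w (P^~ y) (Q^~ y)) x =
  fshuffle w (fun u => lie i (P u) x) (Q^~ x) + fshuffle w (P^~ x) (fun u => lie i (Q u) x).
Proof.
elim: w P Q => [|a w IH] P Q dP dQ; first by rewrite /= lieM //; [exact: dP|exact: dQ].
rewrite /= lieD; last 2 first.
- by apply: differentiable_fshuffle => u uw; [exact: dP|exact/dQ/leqW].
- by apply: differentiable_fshuffle => u uw; [exact/dP/leqW|exact: dQ].
rewrite (IH (fun u => P (a :: u)) Q) ?(IH P (fun u => Q (a :: u))); first exact: addrACA.
all: by move=> u uw; first [exact: dP|exact/dQ/leqW|exact/dP/leqW|exact: dQ].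
Qed.

Lemma fshuffleDl w (P P' Q : word -> R) :
  fshuffle w (fun u => P u + P' u) Q = fshuffle w P Q + fshuffle w P' Q.
Proof.
elim: w P P' Q => [|a w IH] P P' Q /=; first exact: mulrDl.
by rewrite (IH (fun u => P (a :: u)) (fun u => P' (a :: u)) Q) (IH P P' (fun u => Q (a :: u))) addrACA.
Qed.

Lemma fshuffleDr w (P Q Q' : word -> R) :
  fshuffle w P (fun u => Q u + Q' u) = fshuffle w P Q + fshuffle w P Q'.
Proof.
elim: w P Q Q' => [|a w IH] P Q Q' /=; first by rewrite mulrDr.
by rewrite (IH (fun u => P (a :: u)) Q Q') (IH P (fun u => Q (a :: u)) (fun u => Q' (a :: u))) addrACA.
Qed.

Lemma fshuffleZr w c (P Q : word -> R) :
  fshuffle w P (fun u => c * Q u) = c * fshuffle w P Q.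
Proof.
elim: w P Q => [|a w IH] P Q /=; first by rewrite mulrCA.
rewrite mulrDr.
by rewrite (IH (fun u => P (a :: u)) Q) (IH P (fun u => Q (a :: u))).
Qed.

Lemma fshuffle0r w (P : word -> R) : fshuffle w P (fun=> 0) = 0.
Proof. by elim: w P => [|a w IH] P /=; rewrite ?mulr0 // !IH addr0. Qed.

Lemma fshuffle0l w (Q : word -> R) : fshuffle w (fun=> 0) Q = 0.
Proof. by elim: w Q => [|a w IH] Q /=; rewrite ?mul0r // !IH addr0. Qed.

Lemma fshuffle_sumr w (I : Type) (r : seq I) (P : word -> R) (Q : I -> word -> R) :
  fshuffle w P (fun u => \sum_(i <- r) Q i u) = \sum_(i <- r) fshuffle w P (Q i).
Proof.
elim: r => [|i r IH].
  by rewrite big_nil -[RHS](fshuffle0r w P); congr fshuffle; apply/funext => u; rewrite big_nil.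
rewrite big_cons -IH -fshuffleDr; congr fshuffle.
by apply/funext => u; rewrite big_cons.
Qed.

(** The combination in the second argument has the shape of the right-hand side of [faa_cons]. *)
Lemma fshuffle_comb w (P Q : word -> R) (c : 'I_n -> R) (Q1 Q2 : 'I_n -> word -> R) a :
  fshuffle w P (fun u => Q u + (-1 * (\sum_m c m * Q1 m u) + a * \sum_m c m * Q2 m u)) =
  fshuffle w P Q + (- (\sum_m c m * fshuffle w P (Q1 m)) + a * \sum_m c m * fshuffle w P (Q2 m)).
Proof.
rewrite !fshuffleDr !fshuffleZr !fshuffle_sumr mulN1r.
under [X in - X]eq_bigr do rewrite fshuffleZr.
by under [X in a * X]eq_bigr do rewrite fshuffleZr.
Qed.

Lemma eq_fshuffle w (P P' Q Q' : word -> R) :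
  (forall u, (size u <= size w)%N -> P u = P' u) ->
  (forall u, (size u <= size w)%N -> Q u = Q' u) -> fshuffle w P Q = fshuffle w P' Q'.
Proof.
elim: w P P' Q Q' => [|a w IH] P P' Q Q' HP HQ /=; first by rewrite HP ?HQ.
by congr (_ + _); apply: IH => u uw; first [exact: HP|exact/HQ/leqW|exact/HP/leqW|exact: HQ].
Qed.

Lemma fshuffle_unitl w c (Q : word -> R) :
  fshuffle w (fun u => if u is [::] then c else 0) Q = c * Q w.
Proof. by elim: w Q => [//|a w IH] Q /=; rewrite fshuffle0l add0r IH. Qed.

(** Distributing fewer than a + b letters leaves the first word shorter than a or the second shorter
    than b. *)
Lemma fshuffle_vanish a b w (P Q : word -> R) :
  (forall u, (size u < a)%N -> P u = 0) -> (forall u, (size u < b)%N -> Q u = 0) ->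
  (size w < a + b)%N -> fshuffle w P Q = 0.
Proof.
elim: w a b P Q => [|i w IH] a b P Q HP HQ /=.
  by case: a HP => [|a] HP; [case: b HQ => // b HQ _; rewrite HQ // mulr0|rewrite HP // mul0r].
move=> wab; rewrite (IH a.-1 b) ?(IH a b.-1) ?addr0 //.
- by move=> u ub; apply: HQ; case: b ub {wab}.
- by move: wab; clear; lia.
- by move=> u ua; apply: HP; case: a ua {wab}.
- by move: wab; clear; lia.
Qed.

(** For nonempty u this is the l-th coordinate of F_u. At the empty word it is 0 rather than x_l, so
    that word sums of [xi] give increments, and factors u_j = [::] drop out of the Faa di Bruno
    sums. *)
Definition xi (l : 'I_n) (u : word) : E -> R :=
  if u is [::] then fun=> 0 else lies u (fun x => x 0 l).

(* [faa j phi w] is the sum over u_1, .., u_j of the multiplicity of w in the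
   shuffle of the u's times [D^j phi (F_{u_1}, .., F_{u_j})]. *)
Fixpoint faa (j : nat) (phi : E -> R) (w : word) : E -> R :=
  match j with
  | 0%N => if w is [::] then phi else fun=> 0
  | j'.+1 => fun x => \sum_l fshuffle w (fun u => xi l u x) (fun u => faa j' (pd l phi) u x)
  end.

Lemma faa_vanish j phi w x : (size w < j)%N -> faa j phi w x = 0.
Proof.
elim: j phi w => [//|j IH] phi w wj /=; apply: big1 => l _.
by apply: (@fshuffle_vanish 1 j) => //; [case|move=> u; exact: IH].
Qed.

Variables (K : nat) (Mf : R).
Hypothesis hf : forall i m, hb 0 K setT Mf (fun x => f i x 0 m).
Hypothesis Mf0 : 0 <= Mf.

Definition lie_const : R := n%:R * (2 ^+ K.+1 * Mf).

Lemma lie_const_ge0 : 0 <= lie_const.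
Proof. by rewrite mulr_ge0 // mulr_ge0 // exprn_ge0. Qed.

Lemma hb_lie k S C i phi : (k <= K)%N -> 0 <= C -> hb 0 k.+1 S C phi ->
  hb 0 k S (lie_const * C) (lie i phi).
Proof.
move=> kK C0 hp; rewrite /lie_const -[n in n%:R]card_ord -mulrA.
have c0 : 0 <= 2 ^+ K.+1 * Mf * C by rewrite !mulr_ge0 // exprn_ge0.
apply: (@hb_sum_cst _ _ _ _ _ _ predT) => // m _.
apply: (@hb_le _ _ _ _ _ (2 ^+ k.+1 * (Mf * C))).
  rewrite -mulrA ler_wpM2r ?mulr_ge0 //; apply: ler_weXn2l; first by rewrite ler1n.
  by rewrite ltnS.
apply: hbM => //; last exact: hb_pd.
by apply: hbW (hb_order kK (hf i m)).
Qed.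

Lemma hb_lies k S C w phi : (k + size w <= K.+1)%N -> 0 <= C -> hb 0 (k + size w) S C phi ->
  hb 0 k S (lie_const ^+ size w * C) (lies w phi).
Proof.
elim: w k => [|i w IH] k /= kK C0; first by rewrite addn0 mul1r.
rewrite addnS => hp; rewrite exprS -mulrA; apply: hb_lie.
- by move: kK; rewrite addnS ltnS; apply: leq_trans; exact: leq_addr.
- by rewrite mulr_ge0 // exprn_ge0 // lie_const_ge0.
- by apply: IH; rewrite ?addSn // -addnS.
Qed.

(** The last letter of u costs no derivative, since Gamma_i applied to a coordinate is a coordinate
    of f_i. This gains the unit in K + 1 on which the derivative count of the defect depends. *)
Lemma hb_xi k l u : (k + size u <= K.+1)%N -> hb 0 k setT ((1 + lie_const) ^+ size u * Mf) (xi l u).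
Proof.
case/lastP: u => [|u i].
  by move=> _; rewrite /= mul1r; apply: hb_cst; rewrite normr0.
rewrite size_rcons => ku.
have -> : xi l (rcons u i) = lies u (fun x => f i x 0 l).
  by rewrite /xi -lie_coord; case: u {ku} => [|a u] //=; rewrite /lies foldr_rcons.
have L0 := lie_const_ge0.
apply: (@hb_le _ _ _ _ _ (lie_const ^+ size u * Mf)).
  apply: ler_wpM2r => //; rewrite exprS; apply: (@le_trans _ _ (1 * (1 + lie_const) ^+ size u)).
    by rewrite mul1r lerXn2r ?nnegrE ?addr_ge0 // lerDr.
  by apply: ler_wpM2r; rewrite ?exprn_ge0 ?addr_ge0 // lerDl.
apply: hb_lies => //; first by rewrite addnS in ku; exact: ltnW.
by apply: hb_order (hf i l); rewrite -ltnS -addnS.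
Qed.

Lemma xi_differentiable l u x : (size u <= K)%N -> differentiable (xi l u) x.
Proof. by move=> uK; apply: hb_differentiable (hb_xi (k := 1) l _); rewrite add1n ltnS. Qed.

Lemma faa_differentiable j phi w x : smooth j.+1 phi -> (size w <= K)%N -> differentiable (faa j phi w) x.
Proof.
elim: j phi w => [|j IH] phi w sp wK /=.
  by case: w wK => [|a w] _; [exact: smooth_differentiable sp|exact: differentiable_cst].
apply: differentiable_bigsum => l _; apply: (@differentiable_fshuffle w (xi l) (faa j (pd l phi))) => u uw.
  by apply: xi_differentiable; exact: leq_trans wK.
by apply: IH; [exact: smooth_pd|exact: leq_trans wK].
Qed.

(** Prefixing i to w either enlarges one of the j factors or opens a new factor made of i alone. The
    former is Gamma_i acting on everything except D^j phi, whence the subtracted sum; the latter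
    puts f_i into one of j slots and leaves a term of index j - 1 for a derivative of phi. *)
Lemma faa_cons j phi i w x : smooth j.+1 phi -> (size w <= K)%N ->
  faa j phi (i :: w) x = lie i (faa j phi w) x
    - \sum_m f i x 0 m * faa j (pd m phi) w x
    + j%:R * \sum_m f i x 0 m * faa j.-1 (pd m phi) w x.
Proof.
elim: j phi w => [|j IH] phi w sp wK.
  rewrite mul0r addr0 /=; case: w wK => [|a w] _; first by rewrite /lie subrr.
  by rewrite lie_cst0 big1 ?subr0 // => m _; rewrite mulr0.
have dxi l u : (size u <= size w)%N -> differentiable (xi l u) x.
  by move=> uw; apply: xi_differentiable; exact: leq_trans wK.
have dfa l u : (size u <= size w)%N -> differentiable (faa j (pd l phi) u) x.
  by move=> uw; apply: faa_differentiable; [exact: smooth_pd|exact: leq_trans wK].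
have xi_cons l u : xi l (i :: u) x = lie i (xi l u) x + (if u is [::] then f i x 0 l else 0).
  case: u => [|a u]; last by rewrite addr0.
  by rewrite /= lie_cst0 add0r lie_coord.
transitivity (\sum_l (lie i (fun y => fshuffle w (fun u => xi l u y) (fun u => faa j (pd l phi) u y)) x
   + (f i x 0 l * faa j (pd l phi) w x +
     (- (\sum_m f i x 0 m * fshuffle w (fun u => xi l u x) (fun u => faa j (pd m (pd l phi)) u x))
     + j%:R * \sum_m f i x 0 m * fshuffle w (fun u => xi l u x) (fun u => faa j.-1 (pd m (pd l phi)) u x))))).
  apply: eq_bigr => l _.
  transitivity (fshuffle w (fun u => xi l (i :: u) x) (fun u => faa j (pd l phi) u x) +
    fshuffle w (fun u => xi l u x) (fun u => faa j (pd l phi) (i :: u) x)); first by [].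
  rewrite (@lie_fshuffle i w (xi l) (faa j (pd l phi))) //; [|exact: dxi|exact: dfa].
  under [X in fshuffle w X _ + _]eq_fun do rewrite xi_cons.
  rewrite fshuffleDl fshuffle_unitl.
  rewrite (@eq_fshuffle w _ (fun u => xi l u x) (fun u => faa j (pd l phi) (i :: u) x)
    (fun u => lie i (faa j (pd l phi) u) x + (-1 * (\sum_m f i x 0 m * faa j (pd m (pd l phi)) u x)
    + j%:R * \sum_m f i x 0 m * faa j.-1 (pd m (pd l phi)) u x))) //; last first.
    move=> u uw; rewrite IH ?mulN1r ?addrA //; first exact: smooth_pd.
    exact: leq_trans wK.
  rewrite (fshuffle_comb w (xi l ^~ x) (fun u => lie i (faa j (pd l phi) u) x) (fun m => f i x 0 m)
    (fun m u => faa j (pd m (pd l phi)) u x) (fun m u => faa j.-1 (pd m (pd l phi)) u x) j%:R).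
  exact: addrACA.
rewrite big_split /=; rewrite -lie_sum; last first.
  by move=> l; apply: (@differentiable_fshuffle w (xi l) (faa j (pd l phi))); [exact: dxi|exact: dfa].
rewrite -[RHS]addrA; congr (_ + _).
rewrite big_split /= big_split /= sumrN addrCA; congr (_ + _).
  rewrite exchange_big /=; congr (- _); apply: eq_bigr => m _.
  rewrite mulr_sumr; apply: eq_bigr => l _.
  by rewrite (smooth_pd_comm m l sp).
rewrite -natr1 mulrDl mul1r addrC; congr (_ + _).
case: j {IH dfa} sp => [|j] sp; first by rewrite mul0r big1 // => l _; rewrite mul0r.
rewrite -mulr_sumr exchange_big /=; congr (_ * _); apply: eq_bigr => m _.
rewrite mulr_sumr; apply: eq_bigr => l _.
by rewrite (smooth_pd_comm m l sp).
Qed.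

Definition faa_sum (J : nat) phi w x : R := \sum_(j < J.+1) (j`!%:R)^-1 * faa j phi w x.

(** With weights 1/j! the two correction sums of [faa_cons] cancel between consecutive values of j.
    The one left over, at j = J, vanishes because the shorter word has fewer than J letters. *)
Theorem faa_di_bruno (J : nat) phi w x : (size w <= J)%N -> (size w <= K.+1)%N -> smooth J.+1 phi ->
  faa_sum J phi w x = lies w phi x.
Proof.
elim: w x => [|i w IH] x wJ wK sp.
  rewrite /faa_sum big_ord_recl big1 => [|j _]; last by rewrite lift0 faa_vanish ?mulr0.
  by rewrite addr0 /= fact0 invr1 mul1r.
have wJ' : (size w <= J)%N by exact: ltnW.
have wK' : (size w <= K)%N by [].
have sj (j : nat) : (j <= J)%N -> smooth j.+1 phi by move=> jJ; apply: hb_order sp.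
rewrite /= -[lie i _ x](_ : lie i (faa_sum J phi w) x = _); last first.
  by congr (lie i _ x); apply/funext => y; apply: IH => //; exact: ltnW.
rewrite /faa_sum lie_sum; last first.
  move=> j; apply: differentiableM; first exact: differentiable_cst.
  by apply: faa_differentiable => //; apply: sj; rewrite -ltnS.
(* The telescoping quantity: index j contributes a (j - 1) - a j, with no first term at j = 0. *)
pose a (j : nat) := (j`!%:R)^-1 * \sum_m f i x 0 m * faa j (pd m phi) w x : R.
have E (j : 'I_J.+1) : (j`!%:R)^-1 * faa j phi (i :: w) x =
    lie i (fun y => (j`!%:R)^-1 * faa j phi w y) x + ((if j == 0%N :> nat then 0 else a j.-1) - a j).
  rewrite faa_cons //; last by apply: sj; rewrite -ltnS.
  rewrite lieZ; last by apply: faa_differentiable => //; apply: sj; rewrite -ltnS.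
  rewrite mulrDr mulrBr -addrA; congr (_ + _); rewrite addrC; congr (_ - _).
  case: j => -[|j] jJ /=; first by rewrite mul0r mulr0.
  by rewrite /a factS natrM invfM mulrACA mulVf ?mul1r // pnatr_eq0.
under eq_bigr do rewrite E.
rewrite big_split /= -[RHS]addr0; congr (_ + _).
rewrite sumrB big_ord_recl /= add0r [X in _ - X]big_ord_recr /= opprD addrA.
rewrite (_ : \sum_(j < J) _ = \sum_(j < J) a j) ?subrr ?add0r; last by apply: eq_bigr.
rewrite /a big1 ?mulr0 ?oppr0 // => m _.
by rewrite faa_vanish ?mulr0.
Qed.

End LieDerivatives.

(** * Estimates for sums over words *)

Section WordSumEstimates.
Context {R : realType} {n d : nat}.
Local Notation E := 'rV[R]_n.
Local Notation word := (word d).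
Implicit Types (phi psi : E -> R) (x y : E) (S : set E) (a b : word -> E -> R).

Lemma hb_ext k S C phi psi : phi = psi -> hb 0 k S C psi -> hb 0 k S C phi.
Proof. by move=> ->. Qed.

Lemma hb_zero k S C : 0 <= C -> hb 0 k S C (fun _ : E => 0).
Proof. by move=> C0; apply: hb_cst; rewrite normr0. Qed.

Lemma hb_sum_letters k S C (h : 'I_d -> E -> R) : 0 <= C -> (forall i, hb 0 k S C (h i)) ->
  hb 0 k S (d%:R * C) (fun x => \sum_(i < d) h i x).
Proof.
move=> C0 H; rewrite -[d in d%:R]card_ord.
by apply: (@hb_sum_cst _ _ _ _ _ _ predT) => // i _; exact: H.
Qed.

Lemma hb_sum_coords k S C (h : 'I_n -> E -> R) : 0 <= C -> (forall i, hb 0 k S C (h i)) ->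
  hb 0 k S (n%:R * C) (fun x => \sum_i h i x).
Proof.
move=> C0 H; rewrite -[n in n%:R]card_ord.
by apply: (@hb_sum_cst _ _ _ _ _ _ predT) => // i _; exact: H.
Qed.

Lemma one_dge1 m : 1 <= (1 + d%:R) ^+ m :> R.
Proof. by rewrite exprn_ege1 // lerDl. Qed.

Lemma one_dge0 m : 0 <= (1 + d%:R) ^+ m :> R.
Proof. by rewrite exprn_ge0 // addr_ge0. Qed.

(** (1 + d)^m dominates the number of words of length at most m. *)
Lemma hb_wsum k S m a c eta : 0 <= c -> 0 <= eta <= 1 ->
  (forall w, (size w <= m)%N -> hb 0 k S (c * eta ^+ size w) (a w)) ->
  hb 0 k S ((1 + d%:R) ^+ m * c) (fun x => wsum m (a^~ x)).
Proof.
move=> c0 /andP[e0 e1]; elim: m a c c0 => [|m IH] a c c0 H.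
  apply: (@hb_ext _ _ _ _ (a [::])); first by apply/funext => x; rewrite wsum_ord0.
  by have := H [::] isT; rewrite /= expr0 mul1r mulr1.
apply: (@hb_ext _ _ _ _ (fun x => a [::] x + \sum_(i < d) wsum m (fun w => a (i :: w) x))).
  by apply/funext => x; rewrite wsumS.
have Q0 : 0 <= (1 + d%:R) ^+ m * c by rewrite mulr_ge0 // one_dge0.
apply: (@hb_le _ _ _ _ _ (c + d%:R * ((1 + d%:R) ^+ m * c))).
  by rewrite exprS -mulrA mulrDl mul1r lerD2r ler_peMl // one_dge1.
apply: hbD; first by have := H [::] isT; rewrite /= expr0 mulr1.
apply: hb_sum_letters => // i.
apply: (@hb_le _ _ _ _ _ ((1 + d%:R) ^+ m * (c * eta))).
  by rewrite ler_wpM2l ?one_dge0 // ler_piMr.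
apply: (IH (fun w => a (i :: w))); first by rewrite mulr_ge0.
by move=> w wm; rewrite -mulrA -exprS; exact: H (i :: w) wm.
Qed.

(** Only words with more than m letters remain, and eta <= 1. *)
Lemma hb_wsum_tail k S m p a c eta : 0 <= c -> 0 <= eta <= 1 ->
  (forall w, (size w <= m + p)%N -> hb 0 k S (c * eta ^+ size w) (a w)) ->
  hb 0 k S ((1 + d%:R) ^+ (m + p) * (c * eta ^+ m.+1))
    (fun x => wsum (m + p) (a^~ x) - wsum m (a^~ x)).
Proof.
move=> c0 e01; have /andP[e0 e1] := e01; elim: m a c c0 => [|m IH] a c c0 H.
  rewrite !add0n in H *; case: p H => [|p] H.
    apply: (@hb_ext _ _ _ _ (fun=> 0)); first by apply/funext => x; rewrite subrr.
    by apply: hb_zero; rewrite mulr_ge0 ?one_dge0 // mulr_ge0 ?exprn_ge0.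
  apply: (@hb_ext _ _ _ _ (fun x => \sum_(i < d) wsum p (fun w => a (i :: w) x))).
    by apply/funext => x; rewrite wsumS wsum_ord0 addrAC subrr add0r.
  have Q0 : 0 <= (1 + d%:R) ^+ p * (c * eta) by rewrite mulr_ge0 ?one_dge0 // mulr_ge0.
  apply: (@hb_le _ _ _ _ _ (d%:R * ((1 + d%:R) ^+ p * (c * eta)))).
    by rewrite exprS -mulrA expr1 ler_wpM2r // lerDr.
  apply: hb_sum_letters => // i; apply: (hb_wsum (a := fun w => a (i :: w)) _ e01); first by rewrite mulr_ge0.
  by move=> w wm; rewrite -mulrA -exprS; exact: H (i :: w) wm.
apply: (@hb_ext _ _ _ _ (fun x => \sum_(i < d)
    (wsum (m + p) (fun w => a (i :: w) x) - wsum m (fun w => a (i :: w) x)))).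
  by apply/funext => x; rewrite addSn !wsumS sumrB opprD addrACA subrr add0r.
have Q0 : 0 <= (1 + d%:R) ^+ (m + p) * (c * eta * eta ^+ m.+1).
  by rewrite mulr_ge0 ?one_dge0 // !mulr_ge0 // exprn_ge0.
apply: (@hb_le _ _ _ _ _ (d%:R * ((1 + d%:R) ^+ (m + p) * (c * eta * eta ^+ m.+1)))).
  rewrite (_ : (1 + d%:R) ^+ (m.+1 + p) * _ =
    (1 + d%:R) * ((1 + d%:R) ^+ (m + p) * (c * eta * eta ^+ m.+1))).
    by rewrite ler_wpM2r // lerDr.
  by rewrite addSn !exprS; ring.
apply: hb_sum_letters => // i; apply: (IH (fun w => a (i :: w))); first by rewrite mulr_ge0.
by move=> w wm; rewrite -mulrA -exprS; exact: H (i :: w) wm.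
Qed.

(** The pairs absent from the double sum satisfy |u| + |v| > m and carry eta^(|u|+|v|). The
    induction peels the first letter of u, which leaves a tail in v as the second error. *)
Lemma hb_wsum_product k m : exists2 K : R, 0 <= K & forall S a b c c' eta, 0 <= c -> 0 <= c' ->
  0 <= eta <= 1 ->
  (forall w, (size w <= m)%N -> hb 0 k S (c * eta ^+ size w) (a w)) ->
  (forall w, (size w <= m)%N -> hb 0 k S (c' * eta ^+ size w) (b w)) ->
  hb 0 k S (K * (c * c' * eta ^+ m.+1))
   (fun x => wsum m (a^~ x) * wsum m (b^~ x) - wsum2 m (fun u v => a u x * b v x)).
Proof.
elim: m => [|m [K K0 IH]].
  exists 0 => // S a b c c' eta c0 c0' _ _ _; rewrite mul0r.
  apply: (@hb_ext _ _ _ _ (fun=> 0)); last exact: hb_zero.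
  by apply/funext => x; rewrite !wsum_ord0 wsum2_ord0 subrr.
pose P : R := 2 ^+ k.+1.
have P0 : 0 <= P by rewrite exprn_ge0.
pose A : R := (1 + d%:R) ^+ m * (1 + d%:R) ^+ (m + 1).
have A0 : 0 <= A by rewrite mulr_ge0 // one_dge0.
exists (d%:R * K + d%:R * (P * A)); first by rewrite addr_ge0 // !mulr_ge0.
move=> S a b c c' eta c0 c0' e01 Ha Hb; have /andP[e0 e1] := e01.
have ce0 : 0 <= c * eta by rewrite mulr_ge0.
have Ha' i w : (size w <= m)%N -> hb 0 k S (c * eta * eta ^+ size w) (a (i :: w)).
  by move=> wm; rewrite -mulrA -exprS; exact: Ha (i :: w) wm.
have Hb' w : (size w <= m)%N -> hb 0 k S (c' * eta ^+ size w) (b w).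
  by move=> wm; apply: Hb; exact: leqW.
apply: (@hb_ext _ _ _ _ (fun x =>
    \sum_(i < d) (wsum m (fun w => a (i :: w) x) * wsum m (b^~ x) -
       wsum2 m (fun u v => a (i :: u) x * b v x)) +
    \sum_(i < d) wsum m (fun w => a (i :: w) x) * (wsum (m + 1) (b^~ x) - wsum m (b^~ x)))).
  apply/funext => x; rewrite wsum2S (wsumZ _ (a [::] x)) wsumS mulrDl addn1.
  rewrite sumrB -!mulr_suml; set A1 := \sum_(i < d) _; set B1 := wsum m.+1 _; set B0 := wsum m _.
  by set D := \sum_(i < d) _; ring.
have ee m' : 0 <= eta ^+ m' by exact: exprn_ge0.
rewrite mulrDl; apply: hbD.
  have Q0 : 0 <= K * (c * eta * c' * eta ^+ m.+1) by rewrite !mulr_ge0.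
  apply: (@hb_le _ _ _ _ _ (d%:R * (K * (c * eta * c' * eta ^+ m.+1)))).
    by rewrite (exprS eta m.+1) le_eqVlt; apply/orP; left; apply/eqP; ring.
  by apply: hb_sum_letters => // i; apply: (IH S (fun w => a (i :: w)) b) => //; exact: Ha'.
have Q1 : 0 <= (1 + d%:R) ^+ m * (c * eta) by rewrite mulr_ge0 ?one_dge0.
have Q2 : 0 <= (1 + d%:R) ^+ (m + 1) * (c' * eta ^+ m.+1) by rewrite mulr_ge0 ?one_dge0 // mulr_ge0.
have Q3 := mulr_ge0 P0 (mulr_ge0 Q1 Q2).
apply: (@hb_le _ _ _ _ _ (d%:R * (P * ((1 + d%:R) ^+ m * (c * eta) *
    ((1 + d%:R) ^+ (m + 1) * (c' * eta ^+ m.+1)))))).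
  by rewrite (exprS eta m.+1) /A le_eqVlt; apply/orP; left; apply/eqP; ring.
apply: hb_sum_letters => // i; apply: hbM => //.
  exact: (hb_wsum (a := fun w => a (i :: w)) ce0 e01 (Ha' i)).
by apply: (hb_wsum_tail c0' e01) => w; rewrite addn1; exact: Hb.
Qed.

Lemma hb_fshuffle k S w a b p q : 0 <= p -> 0 <= q ->
  (forall u, (size u <= size w)%N -> hb 0 k S p (a u)) ->
  (forall u, (size u <= size w)%N -> hb 0 k S q (b u)) ->
  hb 0 k S (2 ^+ size w * (2 ^+ k.+1 * (p * q))) (fun x => fshuffle w (a^~ x) (b^~ x)).
Proof.
move=> p0 q0; elim: w a b => [|i w IH] a b Ha Hb.
  by rewrite mul1r; apply: hbM => //; [exact: Ha|exact: Hb].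
rewrite [size _]/= exprS -mulrA mulr_natl mulr2n; apply: hbD.
  by apply: (IH (fun u => a (i :: u)) b) => u uw; [exact: Ha|exact/Hb/leqW].
by apply: (IH a (fun u => b (i :: u))) => u uw; [exact/Ha/leqW|exact: Hb].
Qed.

Lemma eq_wsum2_size m (F G : word -> word -> R) :
  (forall u v, (size u + size v <= m)%N -> F u v = G u v) -> wsum2 m F = wsum2 m G.
Proof.
move=> H; rewrite !wsum2_nested; apply: eq_wsum => u um; apply: eq_wsum => v vm.
by apply: H; rewrite -leq_subRL.
Qed.

End WordSumEstimates.

(** * Bounds on Faa di Bruno terms and Taylor terms *)

Section TaylorWords.
Context {R : realType} {n d : nat}.
Local Notation E := 'rV[R]_n.
Local Notation word := (word d).
Implicit Types (phi psi : E -> R) (x y : E) (S : set E).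
Variables (f : 'I_d -> E -> E) (K : nat) (Mf : R).
Hypothesis hf : forall i m, hb 0 K setT Mf (fun x => f i x 0 m).
Hypothesis Mf0 : 0 <= Mf.

Lemma hb_xi_bounded k M : (k + M <= K.+1)%N -> exists2 X : R, 0 <= X &
  forall l u, (size u <= M)%N -> hb 0 k setT X (xi f l u).
Proof.
move=> kM; have L0 : 0 <= lie_const (n := n) K Mf by exact: lie_const_ge0.
exists ((1 + lie_const (n := n) K Mf) ^+ M * Mf); first by rewrite mulr_ge0 // exprn_ge0 // addr_ge0.
move=> l u uM; apply: hb_le (hb_xi hf Mf0 l _).
  by rewrite ler_wpM2r // ler_weXn2l // lerDl.
by apply: leq_trans kM; rewrite leq_add2l.
Qed.

Lemma hb_faa j k M : (k + M <= K.+1)%N -> exists2 F : R, 0 <= F &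
  forall S C phi w, (size w <= M)%N -> 0 <= C -> hb 0 (j + k) S C phi ->
  hb 0 k S (F * C) (faa f j phi w).
Proof.
move=> kM; have [X X0 HX] := hb_xi_bounded kM.
elim: j => [|j [F F0 IH]].
  exists 1 => // S C phi [|a w] _ C0 hp; rewrite mul1r //; exact: hb_zero.
exists (n%:R * (2 ^+ M * (2 ^+ k.+1 * (X * F)))).
  by rewrite !mulr_ge0 ?exprn_ge0.
move=> S C phi w wM C0 hp.
have Q0 : 0 <= 2 ^+ k.+1 * (X * (F * C)) by rewrite !mulr_ge0 ?exprn_ge0.
apply: (@hb_le _ _ _ _ _ (n%:R * (2 ^+ size w * (2 ^+ k.+1 * (X * (F * C)))))).
  rewrite -!mulrA ler_wpM2l // ler_wpM2r //.
  by rewrite ler_weXn2l // ler1n.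
apply: hb_sum_coords => [|l]; first by rewrite mulr_ge0 // exprn_ge0.
apply: (@hb_fshuffle _ _ _ k S w (xi f l) (faa f j (pd l phi)) X (F * C)) => //.
- by rewrite mulr_ge0.
- by move=> u uw; apply: hbW (HX l u (leq_trans uw wM)).
- by move=> u uw; apply: IH => //; [exact: leq_trans wM|exact: hb_pd].
Qed.

Variable delta : 'I_n -> E -> R.

(** D^j phi(x) evaluated on j copies of the row delta(x); the derivatives act on phi only. *)
Fixpoint taylor_term (j : nat) phi : E -> R :=
  match j with
  | 0%N => phi
  | j'.+1 => fun x => \sum_l delta l x * taylor_term j' (pd l phi) x
  end.

Lemma hb_taylor_term j k : exists2 B : R, 0 <= B & forall S C D phi, 0 <= C -> 0 <= D <= 1 ->
  (forall l, hb 0 k S D (delta l)) -> hb 0 (j + k) S C phi -> hb 0 k S (B * C) (taylor_term j phi).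
Proof.
elim: j => [|j [B B0 IH]]; first by exists 1 => // S C D phi *; rewrite mul1r.
exists (n%:R * (2 ^+ k.+1 * B)); first by rewrite !mulr_ge0 ?exprn_ge0.
move=> S C D phi C0 /andP[D0 D1] hD hp.
have Q0 : 0 <= 2 ^+ k.+1 * (D * (B * C)) by rewrite !mulr_ge0 ?exprn_ge0.
apply: (@hb_le _ _ _ _ _ (n%:R * (2 ^+ k.+1 * (D * (B * C))))).
  by rewrite -!mulrA ler_wpM2l // ler_wpM2l ?exprn_ge0 // ler_piMl // mulr_ge0.
apply: hb_sum_coords => // l; apply: hbM => //; first by rewrite mulr_ge0.
by apply: (IH S C D) => //; [rewrite D0|exact: hb_pd].
Qed.

End TaylorWords.

(** * Taylor expansion along an Euler step *)

Section TaylorRemainder.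
Context {R : realType} {n : nat}.
Local Notation E := 'rV[R]_n.
Implicit Types (phi psi : E -> R) (x y v : E) (S : set E).

Lemma is_derive_monomial (c : R) j (t : R) :
  is_derive t (1 : R) (fun s : R => s ^+ j * c) (j%:R * t ^+ j.-1 * c).
Proof.
have H := @derivableP _ _ _ _ _ _ (@exprn_derivable R j t 1).
have -> : (fun s : R => s ^+ j * c) = c \*: (@GRing.exp R ^~ j).
  by apply/funext => s; rewrite mulrC.
apply: is_derive_eq (is_deriveZ c H) _.
by rewrite exp_derive /= /GRing.scale /= mulr1 mulrC.
Qed.

Lemma is_derive_sum_ord m (h : 'I_m -> R -> R) (dh : 'I_m -> R) (t : R) :
  (forall j, is_derive t (1 : R) (h j) (dh j)) ->
  is_derive t (1 : R) (fun s => \sum_(j < m) h j s) (\sum_(j < m) dh j).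
Proof.
move=> H; rewrite (_ : (fun s => _) = \sum_(j < m) h j); first exact: is_derive_sum.
by apply/funext => s; rewrite fct_sumE.
Qed.

(** The Taylor polynomial of degree less than m of t |-> phi(x + t v), with a direction v that does
    not depend on x. *)
Definition frozen_taylor v (m : nat) phi x (t : R) : R :=
  \sum_(j < m) t ^+ j * ((j`!%:R)^-1 * taylor_term (fun l _ => v 0 l) j phi x).

Lemma is_derive_frozen_taylor v m phi x (t : R) :
  is_derive t (1 : R) (frozen_taylor v m.+1 phi x) (\sum_l v 0 l * frozen_taylor v m (pd l phi) x t).
Proof.
apply: is_derive_eq; first by apply: is_derive_sum_ord => j; exact: is_derive_monomial.
rewrite big_ord_recl /= !mul0r add0r.
rewrite /frozen_taylor; under [RHS]eq_bigr do rewrite mulr_sumr.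
rewrite exchange_big /=; apply: eq_bigr => j _.
rewrite /bump leq0n add1n add0n /= factS natrM invfM mulr_sumr mulr_sumr; apply: eq_bigr => l _.
have j0 : j.+1%:R != 0 :> R by rewrite pnatr_eq0.
have f0 : j`!%:R != 0 :> R by rewrite pnatr_eq0 -lt0n fact_gt0.
by move: (j.+1%:R) (j`!%:R) j0 f0 => z w z0 w0; field; rewrite z0 w0.
Qed.

(** The t-derivative of the remainder is the sum of v_l times the remainder of one order less for
    [pd l phi]. Induction with the mean value theorem then suffices, at the price of losing the
    factorial. *)
Lemma taylor_remainder_le (C a : R) m S phi x v : 0 <= C -> 0 <= a -> (forall l, `|v 0 l| <= a) ->
  (forall t, 0 <= t <= 1 -> S (x + t *: v)) -> hb 0 m S C phi ->
  forall t, 0 <= t <= 1 -> `|phi (x + t *: v) - frozen_taylor v m phi x t| <= C * (n%:R * a) ^+ m.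
Proof.
move=> C0 a0 va Sx; elim: m phi => [|m IH] phi hp t t01.
  rewrite /frozen_taylor big_ord0 subr0 expr0 mulr1.
  by apply: (hb_bound hp); exact: Sx.
have na : 0 <= n%:R * a by rewrite mulr_ge0.
have /andP[t0 t1] := t01.
pose h (s : R) := phi (x + s *: v) - frozen_taylor v m.+1 phi x s.
pose dh (s : R) := \sum_l v 0 l * (pd l phi (x + s *: v) - frozen_taylor v m (pd l phi) x s).
have dphi y : differentiable phi y by exact: hb_differentiable hp.
have hd s : is_derive s (1 : R) h (dh s).
  apply: is_derive_eq.
    exact: (is_deriveB (line_derive (dphi _)) (is_derive_frozen_taylor v m phi x s)).
  rewrite derive_pd // -sumrB; apply: eq_bigr => l _.
  by rewrite mulrBr.
have [c /andP[c0 ct] E1] := mean_value hd t0.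
have h0 : h 0 = 0.
  rewrite /h /frozen_taylor big_ord_recl /= fact0 invr1 expr0 !mul1r big1 ?scale0r ?addr0 ?subrr // => j _.
  by rewrite exprS mul0r mul0r.
rewrite h0 subr0 in E1; rewrite -/(h t) E1 normrM (ger0_norm t0).
apply: (@le_trans _ _ (`|dh c| * 1)); first by rewrite ler_wpM2l.
rewrite mulr1 /dh; apply: (le_trans (ler_norm_sum _ _ _)).
apply: (@le_trans _ _ (\sum_(l < n) a * (C * (n%:R * a) ^+ m))).
  apply: ler_sum => l _; rewrite normrM; apply: ler_pM => //.
  by apply: IH; [exact: hb_pd|rewrite c0 (le_trans ct)].
by rewrite sumr_const card_ord -mulr_natl exprS le_eqVlt; apply/orP; left; apply/eqP; ring.
Qed.

Variable delta : 'I_n -> E -> R.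

Definition displace x : E := \row_l (x 0 l + delta l x).

Definition taylor_rem m phi x : R :=
  phi (displace x) - \sum_(j < m) (j`!%:R)^-1 * taylor_term delta j phi x.

Lemma displaceE x : displace x = x + 1 *: \row_l delta l x.
Proof. by apply/rowP => l; rewrite scale1r !mxE. Qed.

Lemma taylor_term_frozen j phi x :
  taylor_term (fun l _ => (\row_m delta m x) 0 l) j phi x = taylor_term delta j phi x.
Proof.
elim: j phi => [//|j IH] phi /=; apply: eq_bigr => l _.
by rewrite mxE IH.
Qed.

Lemma taylor_rem_frozen m phi x :
  taylor_rem m phi x = phi (x + 1 *: \row_l delta l x) - frozen_taylor (\row_l delta l x) m phi x 1.
Proof.
rewrite /taylor_rem displaceE; congr (_ - _); apply: eq_bigr => j _.
by rewrite expr1n mul1r taylor_term_frozen.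
Qed.

Lemma taylor_term_pd j phi i : (forall l x, differentiable (delta l) x) -> smooth j.+1 phi ->
  (forall x, differentiable (taylor_term delta j phi) x) /\
  pd i (taylor_term delta j phi) = fun x => taylor_term delta j (pd i phi) x +
    j%:R * \sum_l pd i (delta l) x * taylor_term delta j.-1 (pd l phi) x.
Proof.
move=> dd; elim: j phi => [|j IH] phi sp.
  split; first by move=> x; exact: smooth_differentiable sp.
  by apply/funext => x; rewrite mul0r addr0.
have dt l x : differentiable (taylor_term delta j (pd l phi)) x.
  by have [] := IH (pd l phi) (smooth_pd l sp).
have dm l x : differentiable (fun y => delta l y * taylor_term delta j (pd l phi) y) x.
  exact: differentiableM.
split; first by move=> x; apply: differentiable_bigsum => l _; exact: dm.
apply/funext => x; rewrite [LHS]pd_sum //.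
rewrite (eq_bigr (fun l => delta l x * taylor_term delta j (pd l (pd i phi)) x +
   (pd i (delta l) x * taylor_term delta j (pd l phi) x +
    j%:R * \sum_m pd i (delta m) x * (delta l x * taylor_term delta j.-1 (pd l (pd m phi)) x)))); last first.
  move=> l _; rewrite pdM //; have [_ ->] := IH (pd l phi) (smooth_pd l sp).
  rewrite (smooth_pd_comm i l sp) mulrDr addrCA; congr (_ + (_ + _)).
  rewrite mulrCA; congr (_ * _); rewrite mulr_sumr; apply: eq_bigr => m _.
  by rewrite (smooth_pd_comm m l sp) mulrCA.
rewrite big_split big_split /=; congr (_ + _); rewrite -natr1 mulrDl mul1r addrC; congr (_ + _).
rewrite -mulr_sumr exchange_big /=.
case: j {IH dt dm} sp => [|j] sp; first by rewrite !mul0r.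
by congr (_ * _); apply: eq_bigr => m _; rewrite -mulr_sumr.
Qed.

Lemma displace_near_id_differentiable x : (forall l y, differentiable (delta l) y) ->
  differentiable displace x.
Proof.
move=> dd; apply: differentiable_row => l.
rewrite (_ : (fun y => _) = fun y => y 0 l + delta l y); last by apply/funext => y; rewrite mxE.
by apply: (@differentiableD _ _ _ (fun y : E => y 0 l) (delta l)) => //; exact: differentiable_coord.
Qed.

Lemma pd_displace phi i x : (forall l y, differentiable (delta l) y) ->
  (forall y, differentiable phi y) ->
  pd i (fun y => phi (displace y)) x =
  pd i phi (displace x) + \sum_l pd i (delta l) x * pd l phi (displace x).
Proof.
move=> dd dp; rewrite (pd_comp i (displace_near_id_differentiable x dd) (dp _)).
rewrite (eq_bigr (fun l => (i == l)%:R * pd l phi (displace x) + pd i (delta l) x * pd l phi (displace x))).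
  rewrite big_split /=; congr (_ + _).
  rewrite (bigD1 i) //= eqxx mul1r big1 ?addr0 // => l li.
  by rewrite eq_sym (negbTE li) mul0r.
move=> l _; rewrite mulrC -mulrDl; congr (_ * _).
rewrite (_ : (fun y => _) = fun y => y 0 l + delta l y); last by apply/funext => y; rewrite mxE.
by rewrite (pdD i (differentiable_coord _ _ _) (dd l x)) pd_coord.
Qed.

(** Taylor remainders are stable under differentiation. When the derivative falls on delta the order
    drops by one, but the factor [pd i (delta l)] is as small as delta and restores it. *)
Lemma pd_taylor_rem m phi i x : (forall l y, differentiable (delta l) y) -> smooth m.+1 phi ->
  pd i (taylor_rem m phi) x =
  taylor_rem m (pd i phi) x + \sum_l pd i (delta l) x * taylor_rem m.-1 (pd l phi) x.
Proof.
move=> dd sp; have dp y : differentiable phi y by exact: smooth_differentiable sp.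
have sj (j : 'I_m) : smooth j.+1 phi by apply: hb_order sp; rewrite ltnS ltnW.
have dt (j : 'I_m) y : differentiable (fun y => (j`!%:R)^-1 * taylor_term delta j phi y) y.
  apply: (@differentiableM _ _ (cst _) (taylor_term delta j phi)); first exact: differentiable_cst.
  by have [] := taylor_term_pd i dd (sj j).
rewrite /taylor_rem pdB; last 2 first.
- by apply: (@differentiable_comp _ _ _ _ displace phi) => //; exact: displace_near_id_differentiable.
- by apply: differentiable_bigsum => j _; exact: dt.
rewrite pd_displace // pd_sum //.
rewrite (eq_bigr (fun j : 'I_m => (j`!%:R)^-1 * taylor_term delta j (pd i phi) x +
   \sum_l pd i (delta l) x * ((j`!%:R)^-1 * j%:R * taylor_term delta j.-1 (pd l phi) x))); last first.
  move=> j _; have [dj E1] := taylor_term_pd i dd (sj j).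
  rewrite pdZ // E1 mulrDr; congr (_ + _); rewrite mulrA mulr_sumr; apply: eq_bigr => l _.
  by rewrite mulrCA.
rewrite big_split /= exchange_big /= opprD addrACA; congr (_ + _).
rewrite -sumrB; apply: eq_bigr => l _; rewrite -mulr_sumr -mulrBr; congr (_ * (_ - _)).
case: m {sp sj dt} => [|m]; first by rewrite !big_ord0.
rewrite big_ord_recl /= mulr0 mul0r add0r; apply: eq_bigr => j _.
rewrite /bump leq0n add1n add0n /= factS natrM invfM [X in X * _ = _]mulrAC mulVf ?mul1r //.
Qed.

End TaylorRemainder.

(** * Estimate of the Taylor remainder with its derivatives *)

Section TaylorEstimate.
Context {R : realType} {n : nat}.
Local Notation E := 'rV[R]_n.
Implicit Types (phi psi : E -> R) (x y v : E) (S : set E).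

Lemma smooth_continuous k phi : smooth k phi -> continuous phi.
Proof. exact: hb_continuous. Qed.

Lemma displace_continuous (delta : 'I_n -> E -> R) : (forall l, continuous (delta l)) ->
  continuous (displace delta).
Proof.
move=> cd; apply: continuous_row => l x.
rewrite (_ : (fun y => _) = fun y => y 0 l + delta l y); last by apply/funext => y; rewrite mxE.
by apply: (@continuousD _ _ _ (fun y : E => y 0 l) (delta l)); [exact: coord_continuous|exact: cd].
Qed.

Lemma smooth_taylor_term (delta : 'I_n -> E -> R) j k phi : (forall l, smooth k (delta l)) ->
  smooth (j + k) phi -> smooth k (taylor_term delta j phi).
Proof.
move=> sd sp; have [B _ H] := @hb_taylor_term R n delta j k.
have := H set0 0 1 phi (lexx 0) _ _ sp; rewrite ler01 lexx => /(_ isT) H'.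
by apply: hb_smooth (H' _) => l; exact: smooth_hb.
Qed.

Lemma taylor_rem_continuous (delta : 'I_n -> E -> R) m phi : (forall l, smooth 0 (delta l)) ->
  smooth m phi -> continuous (taylor_rem delta m phi).
Proof.
move=> sd sp x; apply: (@continuousB _ _ _ (fun y => phi (displace delta y))
  (fun y => \sum_(j < m) (j`!%:R)^-1 * taylor_term delta j phi y)).
  apply: (@continuous_comp _ _ _ (displace delta) phi).
    by apply: displace_continuous => l; exact: smooth_continuous (sd l).
  by have := smooth_continuous sp; apply.
apply: (@hb_continuous _ _ 0 0 set0); apply: hb_sum => j _.
have T : smooth 0 (taylor_term delta j phi).
  by apply: smooth_taylor_term => //; rewrite addn0; apply: hb_order sp; exact: ltnW.
exact: hbZ (lexx 0) T.
Qed.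

(** Induction on k through [pd_taylor_rem], using both orders m and m - 1. D is fixed before B,
    which makes B uniform in delta and eta; S must contain the segments along which points of S0 are
    moved. *)
Theorem hb_taylor_rem k m (D : R) : 0 <= D -> exists2 B : R, 0 <= B &
  forall (delta : 'I_n -> E -> R) S S0 C eta phi, 0 <= C -> 0 <= eta <= 1 ->
  (forall l, hb 0 k S0 (D * eta) (delta l)) ->
  (forall x t, S0 x -> 0 <= t <= 1 -> S (x + t *: \row_l delta l x)) ->
  hb 0 (m + k) S C phi -> hb 0 k S0 (B * C * eta ^+ m) (taylor_rem delta m phi).
Proof.
move=> D0.
have nD m' : 0 <= (n%:R * D) ^+ m' by rewrite exprn_ge0 // mulr_ge0.
have bound k' m' (delta : 'I_n -> E -> R) S S0 C eta phi : 0 <= C -> 0 <= eta <= 1 ->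
    (forall l, hb 0 k' S0 (D * eta) (delta l)) ->
    (forall x t, S0 x -> 0 <= t <= 1 -> S (x + t *: \row_l delta l x)) ->
    hb 0 (m' + k') S C phi ->
    hb0 0 S0 ((n%:R * D) ^+ m' * C * eta ^+ m') (taylor_rem delta m' phi).
  move=> C0 /andP[e0 e1] hd SS hp; apply: hb0_of_bound.
    apply: taylor_rem_continuous => [l|].
      by apply: hb_order (hb_smooth (hd l)).
    by apply: hb_order (hb_smooth hp); exact: leq_addr.
  move=> x Sx; rewrite taylor_rem_frozen.
  apply: le_trans (@taylor_remainder_le _ _ C (D * eta) m' S phi x _ C0 _ _ _ _ 1 _) _ => //.
  - by rewrite mulr_ge0.
  - by move=> l; rewrite mxE; exact: (hb_bound (hd l)).
  - by move=> t t01; exact: SS.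
  - by apply: hb_order hp; exact: leq_addr.
  - by rewrite ler01 lexx.
  - by rewrite mulrA exprMn le_eqVlt; apply/orP; left; apply/eqP; ring.
elim: k m => [|k IH] m.
  exists ((n%:R * D) ^+ m) => // delta S S0 C eta phi C0 e01 hd SS hp.
  by split => //; apply: bound hp.
have [B1 B10 H1] := IH m; have [B2 B20 H2] := IH m.-1.
pose P : R := 2 ^+ k.+1.
have P0 : 0 <= P by rewrite exprn_ge0.
have Q0 : 0 <= n%:R * (P * (D * B2)) by rewrite !mulr_ge0.
exists ((n%:R * D) ^+ m + (B1 + n%:R * (P * (D * B2)))); first by rewrite !addr_ge0.
move=> delta S S0 C eta phi C0 e01 hd SS hp; have /andP[e0 e1] := e01.
have ee m' : 0 <= eta ^+ m' by exact: exprn_ge0.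
split.
  apply: hb0_le (bound k.+1 m delta S S0 C eta phi C0 e01 hd SS hp).
  by rewrite ler_wpM2r // ler_wpM2r // lerDl addr_ge0.
have dd l y : differentiable (delta l) y by exact: hb_differentiable (hd l).
have sp : smooth m.+1 phi by apply: hb_order (hb_smooth hp); rewrite addnS ltnS leq_addr.
split.
  move=> x; apply: differentiableB.
    apply: (@differentiable_comp _ _ _ _ (displace delta) phi).
      exact: displace_near_id_differentiable.
    exact: smooth_differentiable sp.
  apply: differentiable_bigsum => j _.
  apply: (@differentiableM _ _ (cst _) (taylor_term delta j phi)); first exact: differentiable_cst.
  have sj : smooth (j + 1) phi by rewrite addn1; apply: hb_order sp; rewrite ltnS ltnW.
  apply: smooth_differentiable (smooth_taylor_term _ sj) => l.
  exact: hb_order (hb_smooth (hd l)).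
move=> i; rewrite (_ : pd i _ = fun x => taylor_rem delta m (pd i phi) x +
    \sum_l pd i (delta l) x * taylor_rem delta m.-1 (pd l phi) x); last first.
  by apply/funext => x; exact: pd_taylor_rem.
have hpl l : hb 0 (m + k) S C (pd l phi) by apply: hb_pd; rewrite -addnS.
have hd' l : hb 0 k S0 (D * eta) (delta l) by exact: hbS.
apply: (@hb_le _ _ _ _ _ (B1 * C * eta ^+ m + n%:R * (P * (D * eta * (B2 * C * eta ^+ m.-1))))).
  (* An equality for m > 0; for m = 0, where m.-1 is again 0, it uses eta <= 1. *)
  have e_m : eta * eta ^+ m.-1 <= eta ^+ m by case: m {IH H1 H2 hp sp hpl} => [|m]; rewrite ?mulr1 // exprS.
  apply: (@le_trans _ _ (B1 * C * eta ^+ m + n%:R * (P * (D * B2)) * C * eta ^+ m)).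
    rewrite lerD2l (_ : n%:R * _ = n%:R * (P * (D * B2)) * C * (eta * eta ^+ m.-1)); last by ring.
    by rewrite ler_wpM2l // mulr_ge0.
  rewrite -!mulrDl ler_wpM2r // ler_wpM2r // lerDr //.
apply: hbD; first exact: H1 hd' SS (hpl i).
apply: hb_sum_coords => [|l]; first by rewrite !mulr_ge0.
apply: hbM; rewrite ?mulr_ge0 //; first exact: hb_pd (hd l).
by apply: (H2 delta S S0 C eta (pd l phi)) => //; apply: hb_order (hpl l); rewrite leq_add2r leq_pred.
Qed.

End TaylorEstimate.

(** * Expansion of a function after an Euler step *)

Section Bracket.
Context {R : realType} {n d : nat}.
Local Notation E := 'rV[R]_n.
Local Notation word := (word d).
Implicit Types (phi psi : E -> R) (x y : E) (S : set E) (g h : word -> R).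
Variables (f : 'I_d -> E -> E) (K : nat) (Mf : R).
Hypothesis hf : forall i m, hb 0 K setT Mf (fun x => f i x 0 m).
Hypothesis Mf0 : 0 <= Mf.
Variables (N : nat) (c0 : R).
Hypothesis c00 : 0 <= c0.

(** What is used of a single increment W_st, with |t - s|^gamma in the role of eta: normalization,
    size, and geometricity. *)
Definition rough_functional (eta : R) g : Prop :=
  [/\ g [::] = 1, forall w, (size w <= N)%N -> `|g w| <= c0 * eta ^+ size w & shuffle_character N g].

Definition euler_step g (l : 'I_n) x : R := wsum N (fun w => xi f l w x * g w).

Definition euler_map g : E -> E := displace (euler_step g).

Lemma hb_mul_functional k S X eta phi g w : 0 <= X -> rough_functional eta g -> (size w <= N)%N ->
  hb 0 k S X phi -> hb 0 k S (X * c0 * eta ^+ size w) (fun x => phi x * g w).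
Proof.
move=> X0 [_ gw _] wN hp.
apply: (@hb_ext _ _ _ _ _ _ (fun x => g w * phi x)); first by apply/funext => x; rewrite mulrC.
apply: hb_le (hbZ (g w) X0 hp).
by rewrite mulrC -mulrA ler_wpM2l // gw.
Qed.

Lemma hb_euler_step k M : (M <= N)%N -> (k + N <= K.+1)%N -> exists2 D : R, 0 <= D &
  forall g eta l, 0 <= eta <= 1 -> rough_functional eta g ->
  hb 0 k setT (D * eta) (euler_step g l) /\
  hb 0 k setT (D * eta ^+ M.+1) (fun x => euler_step g l x - wsum M (fun w => xi f l w x * g w)).
Proof.
move=> MN kN; have [X X0 HX] := hb_xi_bounded hf Mf0 kN.
have Xc : 0 <= X * c0 by rewrite mulr_ge0.
exists ((1 + d%:R) ^+ N * (X * c0)); first by rewrite mulr_ge0 // one_dge0.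
move=> g eta l e01 rg.
have H w : (size w <= N)%N -> hb 0 k setT (X * c0 * eta ^+ size w) (fun x => xi f l w x * g w).
  by move=> wN; apply: hb_mul_functional => //; exact: HX.
split.
  have := hb_wsum_tail (m := 0) (p := N) (a := fun w x => xi f l w x * g w) Xc e01.
  rewrite add0n expr1 => /(_ k setT H); rewrite !mulrA; apply: hb_ext.
  by apply/funext => x; rewrite wsum_ord0 /= mul0r subr0.
have := hb_wsum_tail (m := M) (p := N - M) (a := fun w x => xi f l w x * g w) Xc e01.
by rewrite subnKC // => /(_ k setT H); rewrite !mulrA.
Qed.

(** Here geometricity enters: the character property turns products of values of g into values on
    shuffles, so a product of Euler steps becomes a single word sum. Words longer than M go into the
    error. *)
Lemma hb_taylor_faa j k M : (M <= N)%N -> (k + N <= K.+1)%N -> exists2 B : R, 0 <= B &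
  forall S C eta phi g, 0 <= C -> 0 <= eta <= 1 -> rough_functional eta g ->
  hb 0 (j + k) S C phi ->
  hb 0 k S (B * C * eta ^+ M.+1)
    (fun x => taylor_term (euler_step g) j phi x - wsum M (fun w => faa f j phi w x * g w)).
Proof.
move=> MN kN; elim: j => [|j [B B0 IH]].
  exists 0 => // S C eta phi g C0 e01 rg hp; rewrite !mul0r.
  apply: (@hb_ext _ _ _ _ _ _ (fun=> 0)); last exact: hb_zero.
  apply/funext => x; rewrite (@eq_wsum _ _ _ _ (fun w => phi x * (if w is [::] then 1 else 0))).
    rewrite wsumZ; case: M {MN} => [|M]; rewrite ?wsum_ord0 ?wsumS ?mulr1 ?subrr //.
    by rewrite big1 ?addr0 ?mulr1 ?subrr // => i _; exact: wsum0.
  by case: rg => g1 _ _ [|a w] _; rewrite /= ?g1 // mul0r mulr0.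
have kM : (k + M <= K.+1)%N by apply: leq_trans kN; rewrite leq_add2l.
have [D D0 HD] := hb_euler_step MN kN.
have [X X0 HX] := hb_xi_bounded hf Mf0 kN.
have [F F0 HF] := hb_faa hf Mf0 j kM.
have [P P0 HP] := @hb_wsum_product R n d k M.
pose Q : R := 2 ^+ k.+1; have Q0 : 0 <= Q by rewrite exprn_ge0.
pose G : R := (1 + d%:R) ^+ M * (F * c0).
have G0 : 0 <= G by rewrite mulr_ge0 ?one_dge0 // mulr_ge0.
have t0 : 0 <= Q * (D * B) + (Q * (D * G) + P * (X * c0 * (F * c0))).
  by rewrite !addr_ge0 // !mulr_ge0.
exists (n%:R * (Q * (D * B) + (Q * (D * G) + P * (X * c0 * (F * c0))))); first by rewrite mulr_ge0.
move=> S C eta phi g C0 e01 rg hp; have /andP[e0 e1] := e01.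
have em : 0 <= eta ^+ M.+1 by exact: exprn_ge0.
have hpl l : hb 0 (j + k) S C (pd l phi) by exact: hb_pd.
have Fc : 0 <= F * C * c0 by rewrite !mulr_ge0.
have Xc : 0 <= X * c0 by rewrite mulr_ge0.
have Hfaa l w : (size w <= M)%N -> hb 0 k S (F * C * c0 * eta ^+ size w) (fun x => faa f j (pd l phi) w x * g w).
  move=> wM; apply: hb_mul_functional => //; [by rewrite mulr_ge0|exact: leq_trans MN|exact: HF].
have Hxi l w : (size w <= M)%N -> hb 0 k S (X * c0 * eta ^+ size w) (fun x => xi f l w x * g w).
  move=> wM; have wN := leq_trans wM MN; apply: hb_mul_functional => //.
  by apply: hbW (HX l w wN).
(* Three errors: the induction error multiplied by an Euler step, the tail of the Euler step, and
   the truncation of the product of two word sums. The character property identifies the double sum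
   with the next [faa] sum. *)
apply: (@hb_ext _ _ _ _ _ _ (fun x => \sum_l
   (euler_step g l x * (taylor_term (euler_step g) j (pd l phi) x - wsum M (fun w => faa f j (pd l phi) w x * g w)) +
   ((euler_step g l x - wsum M (fun w => xi f l w x * g w)) * wsum M (fun w => faa f j (pd l phi) w x * g w) +
   (wsum M (fun w => xi f l w x * g w) * wsum M (fun w => faa f j (pd l phi) w x * g w) -
    wsum2 M (fun u v => xi f l u x * g u * (faa f j (pd l phi) v x * g v))))))).
  apply/funext => x; rewrite (_ : wsum M _ = \sum_(l < n) wsum2 M (fun u v => xi f l u x * g u * (faa f j (pd l phi) v x * g v))).
    by rewrite /= -sumrB; apply: eq_bigr => l _; ring.
  rewrite (_ : (fun w => _) = (fun w => \sum_(l < n) (fshuffle w (fun u => xi f l u x)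
     (fun u => faa f j (pd l phi) u x) * g w))); last by apply/funext => w; rewrite /= mulr_suml.
  transitivity (\sum_(l < n) wsum M (fun w => fshuffle w (fun u => xi f l u x) (fun u => faa f j (pd l phi) u x) * g w)).
    elim: (index_enum _) => [|l r IHr].
      by rewrite big_nil -[RHS](@wsum0 R d M); congr wsum; apply/funext => w; rewrite big_nil.
    by rewrite big_cons -IHr -wsumD; congr wsum; apply/funext => w; rewrite big_cons.
  apply: eq_bigr => l _; rewrite wsum_fshuffle; apply: eq_wsum2_size => u v uv.
  by case: rg => _ _ ch; rewrite (ch u v (leq_trans uv MN)); ring.
rewrite -2!(mulrA n%:R); apply: hb_sum_coords => [|l]; first by rewrite mulr_ge0 // mulr_ge0.
rewrite 2!mulrDl; apply: hbD.
  rewrite (_ : Q * (D * B) * _ * _ = Q * (D * (B * C * eta ^+ M.+1))); last by ring.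
  apply: (@hb_le _ _ _ _ _ (2 ^+ k.+1 * (D * eta * (B * C * eta ^+ M.+1)))).
    by rewrite ler_wpM2l // ler_wpM2r ?mulr_ge0 // ler_piMr.
  apply: hbM; rewrite ?mulr_ge0 //.
    by apply: hbW (proj1 (HD g eta l e01 rg)).
  exact: IH.
rewrite 2!mulrDl; apply: hbD.
  rewrite (_ : Q * (D * G) * _ * _ = 2 ^+ k.+1 * (D * eta ^+ M.+1 * ((1 + d%:R) ^+ M * (F * C * c0)))); last first.
    by rewrite /G /Q; ring.
  apply: hbM; rewrite ?mulr_ge0 ?one_dge0 //.
    by apply: hbW (proj2 (HD g eta l e01 rg)).
  exact: hb_wsum (Hfaa l).
rewrite (_ : P * _ * _ * _ = P * (X * c0 * (F * C * c0) * eta ^+ M.+1)); last by ring.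
exact: HP (Hxi l) (Hfaa l).
Qed.

(** The sum over |w| < m, so that m = 0 gives the empty sum. *)
Definition wsum_lt (m : nat) (G : word -> R) : R := if m is m'.+1 then wsum m' G else 0.

(** In Taylor's formula for the Euler displacement, [hb_taylor_faa] replaces each Taylor term by a
    word sum, and [faa_di_bruno] adds these up over j to the Lie derivatives of phi. The local form
    with S0 and S serves the transport equation, where phi is bounded on balls only. *)
Theorem hb_bracket k m : (m <= N.+1)%N -> (k + N <= K.+1)%N -> exists2 B : R, 0 <= B &
  forall S S0 C eta phi g, 0 <= C -> 0 <= eta <= 1 -> rough_functional eta g ->
  (forall x t, S0 x -> 0 <= t <= 1 -> S (x + t *: \row_l euler_step g l x)) ->
  hb 0 (m + k) S C phi ->
  hb 0 k S0 (B * C * eta ^+ m)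
    (fun x => phi (euler_map g x) - wsum_lt m (fun w => lies f w phi x * g w)).
Proof.
move=> mN kN; have [D D0 HD] := hb_euler_step (leq0n N) kN.
have [B B0 HB] := @hb_taylor_rem R n k m D D0.
case: m mN B B0 HB => [|M] mN B B0 HB.
  exists B => // S S0 C eta phi g C0 e01 rg SS hp.
  have := HB (euler_step g) S S0 C eta phi C0 e01 _ SS hp; rewrite /taylor_rem.
  under [X in (_ -> hb _ _ _ _ X) -> _]eq_fun do rewrite big_ord0.
  by apply=> l; apply: hbW (proj1 (HD g eta l e01 rg)).
have [Bj HBj] : exists Bj : nat -> R, forall j, 0 <= Bj j /\ forall S C eta phi g, 0 <= C -> 0 <= eta <= 1 ->
    rough_functional eta g -> hb 0 (j + k) S C phi -> hb 0 k S (Bj j * C * eta ^+ M.+1)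
    (fun x => taylor_term (euler_step g) j phi x - wsum M (fun w => faa f j phi w x * g w)).
  have Hex j : exists b : R, 0 <= b /\ forall S C eta phi g, 0 <= C -> 0 <= eta <= 1 ->
      rough_functional eta g -> hb 0 (j + k) S C phi -> hb 0 k S (b * C * eta ^+ M.+1)
      (fun x => taylor_term (euler_step g) j phi x - wsum M (fun w => faa f j phi w x * g w)).
    by have [b b0 Hb] := hb_taylor_faa j mN kN; exists b.
  by have [Bj HBj] := choice Hex; exists Bj.
exists (B + \sum_(j < M.+1) Bj j); first by rewrite addr_ge0 // sumr_ge0 // => j _; case: (HBj j).
move=> S S0 C eta phi g C0 e01 rg SS hp; have /andP[e0 e1] := e01.
have S0S x : S0 x -> S x by move=> Sx; have := SS x 0 Sx; rewrite scale0r addr0; apply; rewrite lexx ler01.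
have sp : smooth M.+1 phi by apply: hb_order (hb_smooth hp); exact: leq_addr.
have MK : (M <= K.+1)%N by apply: leq_trans kN; apply: leq_trans (leq_addl _ _).
apply: (@hb_ext _ _ _ _ _ _ (fun x => taylor_rem (euler_step g) M.+1 phi x +
   \sum_(j < M.+1) (j`!%:R)^-1 * (taylor_term (euler_step g) j phi x - wsum M (fun w => faa f j phi w x * g w)))).
  apply/funext => x; rewrite /taylor_rem -addrA; congr (_ + _) => /=.
  rewrite (@eq_wsum _ _ _ _ (fun w => \sum_(j < M.+1) (j`!%:R)^-1 * (faa f j phi w x * g w))).
    transitivity (- \sum_(j < M.+1) (j`!%:R)^-1 * wsum M (fun w => faa f j phi w x * g w)).
      congr (- _); elim: (index_enum _) => [|j r IHr].
        by rewrite big_nil -[RHS](@wsum0 R d M); congr wsum; apply/funext => w; rewrite big_nil.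
      by rewrite big_cons -IHr -wsumZ -wsumD; congr wsum; apply/funext => w; rewrite big_cons.
    by rewrite -!sumrN -big_split; apply: eq_bigr => j _; rewrite /= mulrBr addrA addNr add0r.
  move=> w wM; have := faa_di_bruno hf Mf0 x wM (leq_trans wM MK) sp.
  by rewrite /faa_sum => <-; rewrite mulr_suml; apply: eq_bigr => j _; rewrite mulrA.
rewrite mulrDl mulrDl; apply: hbD.
  apply: (HB (euler_step g) S S0 C eta phi) => // l.
  by apply: hbW (proj1 (HD g eta l e01 rg)).
rewrite mulr_suml mulr_suml; apply: hb_sum => j _.
have [bj0 Hj] := HBj j.
have Q0 : 0 <= Bj j * C * eta ^+ M.+1 by rewrite !mulr_ge0 // exprn_ge0.
apply: (@hb_le _ _ _ _ _ (`|(j`!%:R)^-1| * (Bj j * C * eta ^+ M.+1))).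
  rewrite ler_piMl // ger0_norm ?invr_ge0 // invf_le1 ?ltr0n ?fact_gt0 // ler1n.
  exact: fact_gt0.
apply: hbZ => //; apply: Hj => //; apply: hbW (hb_order _ hp) => //.
by rewrite leq_add2r ltnW.
Qed.

Lemma hb_bracket_uniform k : (k + N <= K.+1)%N -> exists2 B : R, 0 <= B &
  forall m S S0 C eta phi g, (m <= N.+1)%N -> 0 <= C -> 0 <= eta <= 1 -> rough_functional eta g ->
  (forall x t, S0 x -> 0 <= t <= 1 -> S (x + t *: \row_l euler_step g l x)) ->
  hb 0 (m + k) S C phi ->
  hb 0 k S0 (B * C * eta ^+ m)
    (fun x => phi (euler_map g x) - wsum_lt m (fun w => lies f w phi x * g w)).
Proof.
move=> kN.
have Hex (m : 'I_N.+2) : exists b : R, 0 <= b /\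
    forall S S0 C eta phi g, 0 <= C -> 0 <= eta <= 1 -> rough_functional eta g ->
    (forall x t, S0 x -> 0 <= t <= 1 -> S (x + t *: \row_l euler_step g l x)) ->
    hb 0 (m + k) S C phi -> hb 0 k S0 (b * C * eta ^+ m)
    (fun x => phi (euler_map g x) - wsum_lt m (fun w => lies f w phi x * g w)).
  by have [b b0 Hb] := hb_bracket (ltn_ord m : (m <= N.+1)%N) kN; exists b.
have [b Hb] := choice Hex.
have b0 m : 0 <= b m by case: (Hb m).
exists (\sum_m b m); first by apply: sumr_ge0 => m _; exact: b0.
move=> m S S0 C eta phi g mN C0 e01 rg HS hp; have /andP[e0 _] := e01.
have [_ H] := Hb (Ordinal (mN : (m < N.+2)%N)).
apply: hb_le (H S S0 C eta phi g C0 e01 rg HS hp).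
rewrite ler_wpM2r ?exprn_ge0 // ler_wpM2r //.
by rewrite (bigD1 (Ordinal (mN : (m < N.+2)%N))) //= lerDl sumr_ge0.
Qed.

End Bracket.

(** * Defect of the Euler scheme at an intermediate time *)

Section Defect.
Context {R : realType} {n d : nat}.
Local Notation E := 'rV[R]_n.
Local Notation word := (word d).
Implicit Types (phi psi : E -> R) (x y : E) (S : set E) (g h : word -> R) (u v w : word).
Variables (f : 'I_d -> E -> E) (N : nat) (Mf : R).
Hypothesis hf : forall i m, hb 0 (2 * N + 1) setT Mf (fun x => f i x 0 m).
Hypothesis Mf0 : 0 <= Mf.
Variable c0 : R.
Hypothesis c00 : 0 <= c0.

(** The error in expanding F_v, after the step g, over words u such that u v still has at most N
    letters. *)
Let br g l v x : R := if v is [::] then 0 else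
  xi f l v (euler_map f N g x) - wsum (N - size v) (fun u => lies f u (xi f l v) x * g u).

Lemma wsum_indicator m (c : R) : wsum m (fun v : word => if v is [::] then c else 0) = c.
Proof.
case: m => [|m]; rewrite ?wsum_ord0 // wsumS big1 ?addr0 // => i _.
exact: wsum0.
Qed.

Lemma euler_map_coord g x l : euler_map f N g x 0 l = x 0 l + euler_step f N g l x.
Proof. by rewrite /euler_map /displace mxE. Qed.

(** A word in the Euler map of star g h splits as u v, with u paired with g and v with h. Grouping
    by v leaves, next to each h v, the expansion error of F_v across the first step. *)
Lemma euler_defectE g h l x : h [::] = 1 ->
  euler_map f N h (euler_map f N g x) 0 l - euler_map f N (star g h) x 0 l =
  wsum N (fun v => br g l v x * h v).
Proof.
move=> h1; rewrite (euler_map_coord h) (euler_map_coord (star g h)) (euler_map_coord g).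
set y := euler_map f N g x; pose a := euler_step f N g l x.
pose W v := wsum (N - size v) (fun u => lies f u (xi f l v) x * g u).
have -> : euler_step f N (star g h) l x = a + wsum N (fun v => (if v is [::] then 0 else W v) * h v).
  rewrite /euler_step wsum_star wsum2_swap wsum2_nested -[X in _ = X + _](wsum_indicator N a) -wsumD.
  apply: eq_wsum => -[|i v] vN.
    rewrite mul0r addr0 subn0 /a /euler_step; apply: eq_wsum => u _.
    by rewrite cats0 h1 mulr1.
  rewrite add0r mulrC -wsumZ; apply: eq_wsum => u _.
  have -> : xi f l (u ++ i :: v) = lies f u (xi f l (i :: v)).
    by case: u => [//|j u]; rewrite -lies_cat.
  by rewrite mulrA mulrC.
have -> : wsum N (fun v => br g l v x * h v) =
    euler_step f N h l y - wsum N (fun v => (if v is [::] then 0 else W v) * h v).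
  rewrite /euler_step -[X in _ = _ + X]mulN1r -wsumZ -wsumD; apply: eq_wsum => -[|i v] _.
    by rewrite /br /= !mul0r mulr0 addr0.
  by rewrite /br /y /W mulN1r -mulNr -mulrDl.
move: (x 0 l) (euler_step f N h l y) (wsum N _) => z D B.
by rewrite /a; move: (euler_step f N g l x) => A; ring.
Qed.

Lemma hb_xi_word : exists2 X : R, 0 <= X & forall k l v, (size v <= N)%N ->
  (k + size v <= (2 * N + 1).+1)%N -> hb 0 k setT X (xi f l v).
Proof.
have lc0 := @lie_const_ge0 R n (2 * N + 1) Mf Mf0.
exists ((1 + lie_const (n := n) (2 * N + 1) Mf) ^+ N * Mf).
  by rewrite mulr_ge0 // exprn_ge0 // addr_ge0.
move=> k l v vN kv; apply: hb_le (hb_xi hf Mf0 l kv).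
by rewrite ler_wpM2r // ler_weXn2l // lerDl.
Qed.

(** Expanding F_v to order N + 1 - |v| gives the rate eta^(N+1-|v|), and h v supplies eta^|v|. The
    derivatives used and left add up to (N + 1 - |v|) + (N + 1) = 2N + 2 - |v|, all that F_v has. *)
Lemma euler_defect_low : exists2 B : R, 0 <= B & forall g h eta l, 0 <= eta <= 1 ->
  rough_functional N c0 eta g -> rough_functional N c0 eta h ->
  hb 0 N.+1 setT (B * eta ^+ N.+1)
    (fun x => euler_map f N h (euler_map f N g x) 0 l - euler_map f N (star g h) x 0 l).
Proof.
have [X X0 hX] := hb_xi_word.
have kN : (N.+1 + N <= (2 * N + 1).+1)%N by lia.
have [B B0 HB] := hb_bracket_uniform hf Mf0 c00 kN.
have BX : 0 <= B * X * c0 by rewrite !mulr_ge0.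
exists ((1 + d%:R) ^+ N * (B * X * c0)); first by rewrite mulr_ge0 // one_dge0.
move=> g h eta l e01 rg rh; have /andP[e0 e1] := e01.
have h1 : h [::] = 1 by case: rh.
apply: (@hb_ext _ _ _ _ _ _ (fun x => wsum N (fun v => br g l v x * h v))).
  by apply/funext => x; exact: euler_defectE.
(* The word sum is taken with ratio 1, since each term already has the full power of eta whatever
   the length of v. *)
rewrite -mulrA; apply: (@hb_wsum _ _ _ _ _ _ (fun v x => br g l v x * h v) _ 1).
- by rewrite mulr_ge0 // exprn_ge0.
- by rewrite ler01 lexx.
move=> v vN; rewrite expr1n mulr1.
have -> : B * X * c0 * eta ^+ N.+1 = B * X * eta ^+ (N - size v).+1 * c0 * eta ^+ size v.
  have -> : eta ^+ N.+1 = eta ^+ (N - size v).+1 * eta ^+ size v by rewrite -exprD addSn subnK.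
  by move: (eta ^+ (N - size v).+1) => z; ring.
apply: (hb_mul_functional (N := N) (g := h) (phi := br g l v) _ rh vN).
  by rewrite !mulr_ge0 // exprn_ge0.
rewrite /br; case: v vN => [|i v] vN.
  by apply: hb_zero; rewrite !mulr_ge0 // exprn_ge0.
set w := i :: v in vN *.
apply: (HB (N - size w).+1 setT setT X eta (xi f l w) g _ X0 e01 rg) => //.
  by rewrite ltnS leq_subr.
by apply: hX => //; move: vN; clear; lia.
Qed.

(** Expanding F_v one order less saves a derivative and costs one power of eta. The defect still
    contains the omitted words, which are therefore estimated directly. *)
Lemma euler_defect_high : exists2 B : R, 0 <= B & forall g h eta l, 0 <= eta <= 1 ->
  rough_functional N c0 eta g -> rough_functional N c0 eta h ->
  hb 0 N.+2 setT (B * eta ^+ N)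
    (fun x => euler_map f N h (euler_map f N g x) 0 l - euler_map f N (star g h) x 0 l).
Proof.
have [X X0 hX] := hb_xi_word.
have lc0 := @lie_const_ge0 R n (2 * N + 1) Mf Mf0.
set lc := lie_const _ _ in lc0.
have kN : (N.+2 + N <= (2 * N + 1).+1)%N by lia.
have [B B0 HB] := hb_bracket_uniform hf Mf0 c00 kN.
pose Y := (1 + lc) ^+ N * X.
have Y0 : 0 <= Y by rewrite mulr_ge0 // exprn_ge0 // addr_ge0.
pose Z := (1 + d%:R) ^+ N * (Y * c0).
have Z0 : 0 <= Z by rewrite mulr_ge0 ?one_dge0 // mulr_ge0.
have BX : 0 <= B * X + Z by rewrite addr_ge0 // mulr_ge0.
exists ((1 + d%:R) ^+ N * ((B * X + Z) * c0)).
  by rewrite mulr_ge0 ?one_dge0 // mulr_ge0.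
move=> g h eta l e01 rg rh; have /andP[e0 e1] := e01.
have [h1 _ _] := rh; have [g1 gw _] := rg.
have ee m : 0 <= eta ^+ m by exact: exprn_ge0.
apply: (@hb_ext _ _ _ _ _ _ (fun x => wsum N (fun v => br g l v x * h v))).
  by apply/funext => x; exact: euler_defectE.
rewrite -mulrA; apply: (@hb_wsum _ _ _ _ _ _ (fun v x => br g l v x * h v) _ 1).
- by rewrite !mulr_ge0.
- by rewrite ler01 lexx.
move=> v vN; rewrite expr1n mulr1.
have -> : (B * X + Z) * c0 * eta ^+ N = (B * X + Z) * eta ^+ (N - size v) * c0 * eta ^+ size v.
  have -> : eta ^+ N = eta ^+ (N - size v) * eta ^+ size v by rewrite -exprD subnK.
  by move: (eta ^+ (N - size v)) => z; ring.
apply: (hb_mul_functional (N := N) (g := h) (phi := br g l v) _ rh vN).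
  by rewrite mulr_ge0.
rewrite /br; case: v vN => [|i v] vN; first by apply: hb_zero; rewrite mulr_ge0.
set w := i :: v in vN *; set m := (N - size w)%N.
have mN : (m < N.+1)%N by rewrite ltnS leq_subr.
have mw : (m + size w = N)%N by rewrite subnK.
have hx k : (k + size w <= (2 * N + 1).+1)%N -> hb 0 k setT X (xi f l w).
  by move=> kw; exact: hX.
have T1 : hb 0 N.+2 setT (B * X * eta ^+ m)
    (fun x => xi f l w (euler_map f N g x) - wsum_lt m (fun u => lies f u (xi f l w) x * g u)).
  by apply: (HB m setT setT X eta (xi f l w) g (ltnW mN) X0 e01 rg) => //; apply: hx; move: mw; clear; lia.
have Ha u : (size u <= m)%N -> hb 0 N.+2 setT (Y * c0 * eta ^+ size u) (fun x => lies f u (xi f l w) x * g u).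
  move=> um; have uN : (size u <= N)%N by rewrite (leq_trans um) // leq_subr.
  apply: (hb_mul_functional (N := N) (g := g) (X := Y) (phi := lies f u (xi f l w)) Y0 rg uN).
  apply: (@hb_le _ _ _ _ _ (lc ^+ size u * X)).
    rewrite ler_wpM2r //; apply: (@le_trans _ _ ((1 + lc) ^+ size u)).
      by rewrite lerXn2r ?nnegrE ?addr_ge0 // lerDr.
    by rewrite ler_weXn2l // lerDl.
  apply: (hb_lies hf Mf0) => //; first by move: um mw; clear; lia.
  by apply: hx; move: um mw; clear; lia.
have Yc : 0 <= Y * c0 by rewrite mulr_ge0.
(* The words of length exactly m, present in [br] but not in the expansion of order m; their size is
   eta^m. *)
have T2 : hb 0 N.+2 setT (Z * eta ^+ m)
    (fun x => wsum m (fun u => lies f u (xi f l w) x * g u) - wsum_lt m (fun u => lies f u (xi f l w) x * g u)).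
  have pw : (1 + d%:R) ^+ m <= (1 + d%:R) ^+ N :> R by rewrite ler_weXn2l ?lerDl // leq_subr.
  case: m mN mw Ha pw {T1} => [|m'] mN mw Ha pw.
    apply: (@hb_ext _ _ _ _ _ _ (fun x => lies f [::] (xi f l w) x * g [::])).
      by apply/funext => x; rewrite /= wsum_ord0 subr0.
    apply: hb_le (Ha [::] isT); rewrite /= expr0 !mulr1 /Z.
    by apply: ler_peMl => //; exact: one_dge1.
  have := hb_wsum_tail (m := m') (p := 1) (a := fun u x => lies f u (xi f l w) x * g u) Yc e01.
  rewrite addn1 => /(_ N.+2 setT Ha); apply: hb_le; rewrite /Z -[leRHS]mulrA.
  by apply: ler_pM => //; rewrite ?one_dge0 // mulr_ge0.
apply: (@hb_ext _ _ _ _ _ _ (fun x =>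
   (xi f l w (euler_map f N g x) - wsum_lt m (fun u => lies f u (xi f l w) x * g u)) -
   (wsum m (fun u => lies f u (xi f l w) x * g u) - wsum_lt m (fun u => lies f u (xi f l w) x * g u)))).
  by apply/funext => x; rewrite opprB addrA subrK.
rewrite mulrDl; by apply: (hbB _ T1 T2); rewrite mulr_ge0.
Qed.

End Defect.

(** * Regularity of the flow *)

Section RoughFlow.
Context {R : realType} {n d : nat}.
Local Notation E := 'rV[R]_n.
Local Notation word := (word d).
Implicit Types (x y : E) (g h : word -> R) (w : word).

Lemma rough_functional_le N c0 (e e' : R) g : 0 <= c0 -> 0 <= e <= e' ->
  rough_functional N c0 e g -> rough_functional N c0 e' g.
Proof.
move=> c00 /andP[e0 ee] [g1 gw gs]; split => // w wN.
apply: le_trans (gw w wN) _; rewrite ler_wpM2l // lerXn2r ?nnegrE //.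
exact: le_trans ee.
Qed.

Lemma Nreg_gt (gam : R) : 0 < gam -> 1 < (Nreg gam).+1%:R * gam.
Proof.
move=> g0; rewrite -ltr_pdivrMr // div1r /Nreg; apply: truncnS_gt.
Qed.

Lemma powR_expn (h gam : R) m : (h `^ gam) ^+ m = h `^ (m%:R * gam).
Proof. by rewrite -powR_mulrn ?powR_ge0 // -powRrM mulrC. Qed.

(* The dyadic scheme needs a defect exponent larger than 1, and a loss th of it
   that one factor |t - s|^gamma can absorb. *)
Lemma hoelder_exponent (gam : R) : 0 < gam -> exists2 th : R, 0 < th <= 1 &
  1 < ((Nreg gam).+1%:R - th) * gam /\ th * (((Nreg gam).+1%:R - th) * gam) < gam.
Proof.
move=> g0; have H := Nreg_gt g0; set N1 := (Nreg gam).+1%:R in H *.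
have N11 : 1 <= N1 by rewrite /N1 ler1n.
pose th := Num.min ((N1 - gam^-1) / 2) (N1 + 1)^-1.
have Ng : 0 < N1 - gam^-1 by rewrite subr_gt0 -div1r ltr_pdivrMr.
have t0 : 0 < th by rewrite lt_min !divr_gt0 //= invr_gt0 ltr_wpDl // (le_trans ler01).
have tN : th <= (N1 + 1)^-1 by rewrite ge_min lexx orbT.
have tg : th <= (N1 - gam^-1) / 2 by rewrite ge_min lexx.
have tN' : th * (N1 + 1) <= 1 by rewrite -ler_pdivlMr ?div1r // ltr_wpDl // (le_trans ler01).
exists th.
  rewrite t0 (le_trans tN) // invf_le1 ?lerDr ?(le_trans ler01) //.
  by rewrite ltr_wpDl // (le_trans ler01).
have gi : gam^-1 * gam = 1 by rewrite mulVf // gt_eqF.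
clearbody th N1; split.
  have : ((N1 - gam^-1) / 2) * gam = (N1 * gam - 1) / 2 by rewrite mulrAC mulrBl gi.
  have : th * gam <= (N1 - gam^-1) / 2 * gam by rewrite ler_wpM2r // ltW.
  rewrite mulrBl; clear -H; lra.
rewrite mulrA -[ltRHS]mul1r ltr_pM2r //; clear -t0 tN' N11; nra.
Qed.

Variables (gam T : R) (W : R -> word -> R).
Hypothesis gam0 : 0 < gam.
Hypothesis gam1 : gam < 1.
Hypothesis hW : geometric_rough_path gam T W.
Let N := Nreg gam.

Lemma incr_rough_functional : exists2 c0 : R, 0 <= c0 & forall s t, 0 <= s -> s < t -> t <= T ->
  rough_functional N c0 ((t - s) `^ gam) (incr W s t).
Proof.
case: hW => WG WH.
have Hex (w : N.-bseq 'I_d) : exists C : R, forall s t, s \in `[0, T] -> t \in `[0, T] -> s != t ->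
    `|incr W s t w| / (`|t - s| `^ ((size w)%:R * gam)) <= C.
  by apply: WH; exact: size_bseq.
have [C HC] := choice Hex.
exists (\sum_w `|C w|); first by apply: sumr_ge0.
move=> s t s0 st tT.
have sI : s \in `[0, T] by rewrite in_itv /= s0 (le_trans (ltW st)).
have tI : t \in `[0, T] by rewrite in_itv /= tT andbT (le_trans s0) // ltW.
have [Ws1 _] := WG _ sI; have [Wt1 _] := WG _ tI.
split; first exact: incr_nil.
  move=> w wN; have := HC (Bseq wN) s t sI tI (negbT (lt_eqF st)).
  have ts : 0 < t - s by rewrite subr_gt0.
  rewrite (gtr0_norm ts) ler_pdivrMr ?powR_gt0 // powR_expn => /le_trans; apply.
  rewrite ler_wpM2r ?powR_ge0 //; apply: le_trans (ler_norm _) _.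
  by rewrite (bigD1 (Bseq wN)) //= lerDl sumr_ge0.
by apply: incr_shuffle_character; exact: WG.
Qed.

Variables (f : 'I_d -> E -> E) (Mf : R).
Hypothesis hf : forall i m, hb 0 (2 * N + 1) setT Mf (fun x => f i x 0 m).
Hypothesis Mf0 : 0 <= Mf.

Definition euler_scheme (s t : R) : E -> E := euler_map f N (incr W s t).

Lemma powR_unit (h : R) : 0 < h <= 1 -> 0 <= h `^ gam <= 1.
Proof.
move=> /andP[h0 h1]; rewrite powR_ge0 /=; apply: (@le_trans _ _ (1 `^ gam)); last by rewrite powR1.
by apply: ge0_ler_powR; rewrite ?nnegrE // ltW.
Qed.

Lemma euler_scheme_step : exists2 c : R, 0 <= c & forall s t, 0 <= s -> s < t -> t <= T -> t - s <= 1 ->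
  forall l, hb 0 N.+2 setT (c * (t - s) `^ gam) (fun x => euler_scheme s t x 0 l - x 0 l).
Proof.
have [c0 c00 Hc] := incr_rough_functional.
have kN : (N.+2 + N <= (2 * N + 1).+1)%N by lia.
have [D D0 HD] := hb_euler_step hf Mf0 c00 (leq0n N) kN.
exists D => // s t s0 st tT ts l.
have e01 : 0 <= (t - s) `^ gam <= 1 by apply: powR_unit; rewrite subr_gt0 st.
apply: (@hb_ext _ _ _ _ _ _ (euler_step f N (incr W s t) l)).
  by apply/funext => x; rewrite /euler_scheme euler_map_coord addrAC subrr add0r.
by have [] := HD (incr W s t) _ l e01 (Hc s t s0 st tT).
Qed.

Lemma euler_scheme_defect : exists2 c : R, 0 <= c & forall s t, 0 <= s -> s < t -> t <= T -> t - s <= 1 ->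
  forall l,
  hb 0 N.+1 setT (c * (t - s) `^ (N.+1%:R * gam))
    (fun x => euler_scheme ((s + t) / 2) t (euler_scheme s ((s + t) / 2) x) 0 l - euler_scheme s t x 0 l) /\
  hb 0 N.+2 setT (c * (t - s) `^ (N%:R * gam))
    (fun x => euler_scheme ((s + t) / 2) t (euler_scheme s ((s + t) / 2) x) 0 l - euler_scheme s t x 0 l).
Proof.
have [c0 c00 Hc] := incr_rough_functional.
have [B1 B10 H1] := euler_defect_low hf Mf0 c00.
have [B2 B20 H2] := euler_defect_high hf Mf0 c00.
exists (B1 + B2); first exact: addr_ge0.
move=> s t s0 st tT ts l.
have /andP[sm mt] := midpoint_lt st; have [ms tm] := midpoint_sub s t.
set r := (s + t) / 2 in sm mt ms tm *.
have ts0 : 0 < t - s by rewrite subr_gt0.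
have e01 : 0 <= (t - s) `^ gam <= 1 by apply: powR_unit; rewrite ts0.
have half : (t - s) / 2 <= t - s by rewrite ler_pdivrMr // ler_peMr ?ltW // ltr1n.
have ehalf : 0 <= ((t - s) / 2) `^ gam <= (t - s) `^ gam.
  by rewrite powR_ge0 /=; apply: ge0_ler_powR; rewrite ?nnegrE ?divr_ge0 // ltW.
have r0 : 0 <= r by rewrite (le_trans s0) // ltW.
have rT : r <= T by rewrite (le_trans (ltW mt)).
have R1 : rough_functional N c0 ((t - s) `^ gam) (incr W s r).
  by apply: rough_functional_le c00 ehalf _; rewrite -ms; exact: Hc.
have R2 : rough_functional N c0 ((t - s) `^ gam) (incr W r t).
  by apply: rough_functional_le c00 ehalf _; rewrite -tm; exact: Hc.
have Wr : W r [::] = 1 by case: hW => WG _; case: (WG r _) => //; rewrite in_itv /= r0.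
rewrite /euler_scheme (incr_chen s t Wr) -!powR_expn.
have p0 m : 0 <= ((t - s) `^ gam) ^+ m by rewrite exprn_ge0 // powR_ge0.
split.
  by apply: hb_le (H1 _ _ _ l e01 R1 R2); rewrite ler_wpM2r // lerDl.
by apply: hb_le (H2 _ _ _ l e01 R1 R2); rewrite ler_wpM2r // lerDr.
Qed.

(** Interpolation with weights 1 - th and th: (1 - th)(N + 1) + th N = N + 1 - th. *)
Lemma euler_scheme_defect_hoelder th : 0 <= th <= 1 -> exists2 c : R, 0 <= c &
  forall s t, 0 <= s -> s < t -> t <= T -> t - s <= 1 -> forall l,
  hb th N.+1 setT (c * (t - s) `^ ((N.+1%:R - th) * gam))
    (fun x => euler_scheme ((s + t) / 2) t (euler_scheme s ((s + t) / 2) x) 0 l - euler_scheme s t x 0 l).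
Proof.
move=> th01; have [c c0 H] := euler_scheme_defect.
have n1 : 0 <= 1 + n%:R :> R by rewrite addr_ge0.
exists ((1 + n%:R) * c); first by rewrite mulr_ge0.
move=> s t s0 st tT ts l; have [H1 H2] := H s t s0 st tT ts l.
have ts0 : 0 < t - s by rewrite subr_gt0.
have e01 : 0 <= (t - s) `^ gam <= 1 by apply: powR_unit; rewrite ts0.
have /andP[e0 e1] := e01.
have ab : 0 <= c * (t - s) `^ (N.+1%:R * gam) <= c * (t - s) `^ (N%:R * gam).
  rewrite mulr_ge0 ?powR_ge0 //= -!powR_expn ler_wpM2l // exprS ler_piMl // exprn_ge0 //.
have := hb_interpolate th01 (@convex_setT R n) ab H1 H2; apply: hb_le.
rewrite -mulrA ler_wpM2l // (powRM _ c0 (powR_ge0 _ _)) (powRM th c0 (powR_ge0 _ _)).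
rewrite mulrACA -powRD ?subrK ?oner_eq0 // powRr1 // -!powRrM -powRD; last by apply/implyP => _; rewrite (gt_eqF ts0).
rewrite le_eqVlt; apply/orP; left; apply/eqP; congr (_ * _ `^ _).
by rewrite -natr1; ring.
Qed.

Variable flow : R -> E -> R -> E.
Hypothesis flow_init : forall s x, 0 <= s <= T -> flow s x s = x.
Hypothesis flow_davie : forall s x, 0 <= s <= T -> exists2 C : R, 0 <= C &
  davie_path euler_scheme (N.+1%:R * gam) s T C 1 (flow s x).

Theorem flow_close : exists h0 L D : R, [/\ 0 < h0 <= 1, 0 <= L, 0 <= D &
  forall s t, 0 <= s -> s < t -> t <= T -> t - s <= h0 -> forall l,
  hb 0 N setT (L * (t - s) `^ (N.+1%:R * gam)) (fun x => flow s x t 0 l - euler_scheme s t x 0 l) /\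
  hb 0 N.+1 setT (D * (t - s) `^ gam) (fun x => flow s x t 0 l - x 0 l)] /\
  (forall s r x, 0 <= s -> s <= r -> r <= T -> flow s x T = flow r (flow s x r) T).
Proof.
have [c1 c10 H1] := euler_scheme_step.
have N1 := Nreg_gt gam0; rewrite -/N in N1.
have [th /andP[th0 th1] []] := hoelder_exponent gam0; rewrite -/N => vt1 thg.
have th01 : 0 <= th <= 1 by rewrite ltW.
have [c2 c20 H2] := euler_scheme_defect_hoelder th01.
have zero01 : 0 <= (0 : R) <= 1 by rewrite lexx ler01.
have [c3 c30 H3] := euler_scheme_defect_hoelder zero01.
rewrite subr0 in H3.
have n1 : 0 <= 1 + n%:R :> R by rewrite addr_ge0.
pose c := c1 + (c2 + c3).
have c0 : 0 <= c by rewrite !addr_ge0.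
have cc1 : c1 <= c by rewrite lerDl addr_ge0.
have cc2 : c2 <= c by rewrite /c addrCA lerDl addr_ge0.
have cc3 : c3 <= c by rewrite /c addrA lerDr addr_ge0.
have H1' s t : 0 <= s -> s < t -> t <= T -> t - s <= 1 -> forall l,
    hb 0 N.+2 setT (c * (t - s) `^ gam) (fun x => euler_scheme s t x 0 l - x 0 l).
  by move=> s0 st tT ts l; apply: hb_le (H1 s t s0 st tT ts l); rewrite ler_wpM2r ?powR_ge0.
have H2' s t : 0 <= s -> s < t -> t <= T -> t - s <= 1 -> forall l,
  hb th N.+1 setT (c * (t - s) `^ ((N.+1%:R - th) * gam))
    (fun x => euler_scheme ((s + t) / 2) t (euler_scheme s ((s + t) / 2) x) 0 l - euler_scheme s t x 0 l).
  by move=> s0 st tT ts l; apply: hb_le (H2 s t s0 st tT ts l); rewrite ler_wpM2r ?powR_ge0.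
have H3' s t : 0 <= s -> s < t -> t <= T -> t - s <= 1 -> forall l,
  hb 0 N.+1 setT (c * (t - s) `^ (N.+1%:R * gam))
    (fun x => euler_scheme ((s + t) / 2) t (euler_scheme s ((s + t) / 2) x) 0 l - euler_scheme s t x 0 l).
  by move=> s0 st tT ts l; apply: hb_le (H3 s t s0 st tT ts l); rewrite ler_wpM2r ?powR_ge0.
(* First run, with th > 0: the rate is not sharp, but the bounds on N + 1 derivatives pass to the
   limit. *)
have [ha [La [ha01 La0 Ha Hlima]]] := dyadic_flow th01 vt1 gam0 thg c0 H1' H2'.
have zg : 0 * (N.+1%:R * gam) < gam by rewrite mul0r.
(* Second run, with th = 0 and the sharp rate (N + 1) gam. *)
have [hb_ [Lb [hb01 Lb0 Hb Hlimb]]] := dyadic_flow zero01 N1 gam0 zg c0 H1' H3'.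
have /andP[ha0 ha1] := ha01; have /andP[hb0' hb1] := hb01.
exists (Num.min ha hb_), ((1 + n%:R) * Lb), (La + c); split; last first.
  move=> s r x s0 sr rT.
  have sI : 0 <= s <= T by rewrite s0 (le_trans sr).
  have rI : 0 <= r <= T by rewrite rT (le_trans s0).
  have [C C0 HC] := flow_davie x sI; have [C' C0' HC'] := flow_davie (flow s x r) rI.
  have r0 : 0 <= r by case/andP: rI.
  (* On [r, T] both paths satisfy Davie's estimate and start from [flow s x r]. *)
  apply: (davie_path_unique hb0' Hlimb r0 (lexx T) C0 C0' ltr01 ltr01 (davie_path_restrict sr HC) HC').
    by rewrite flow_init.
  by rewrite rT lexx.
split => //; rewrite ?lt_min ?ha0 ?hb0' ?ge_min ?ha1 ?addr_ge0 ?mulr_ge0 //.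
move=> s t s0 st tT; rewrite le_min => /andP[tsa tsb] l.
have sI : 0 <= s <= T by rewrite s0 (le_trans (ltW st)).
have ts1 : t - s <= 1 by exact: le_trans ha1.
have ts0 : 0 < t - s by rewrite subr_gt0.
have T1 x : tends (fun m => dyadic_comp euler_scheme m s t x 0 l - euler_scheme s t x 0 l)
    (flow s x t 0 l - euler_scheme s t x 0 l).
  apply: tendsB; last exact: tends_cst.
  have [C C0 HC] := flow_davie x sI.
  by have := Hlimb s T C 1 (flow s x) s0 (lexx T) C0 HC s t (lexx s) st tT tsb ts1 l; rewrite flow_init.
have half01 : 0 <= (2^-1 : R) <= 1 by rewrite invr_ge0 ler0n /= invf_le1 // ler1n.
split.
  (* A limit needs a positive Hoelder exponent. Interpolating the bounds at orders N and N + 1 gives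
     the exponent 1/2 at order N and keeps the sharp rate, at the expense of the top derivative. *)
  apply: (@hb_th0 _ _ (2^-1)); apply: (hb_tends (hm := fun m x => dyadic_comp euler_scheme m s t x 0 l - euler_scheme s t x 0 l) _ _ T1); first by rewrite invr_gt0.
  move=> m; have Hm := Hb m s t s0 st tT tsb l.
  have q0 : 0 <= Lb * (t - s) `^ (N.+1%:R * gam) by rewrite mulr_ge0 ?powR_ge0.
  have := hb_interpolate half01 (@convex_setT R n) _ (hbS Hm) Hm.
  rewrite q0 lexx => /(_ isT); apply: hb_le; rewrite -powRD ?subrK ?powRr1 ?mulrA //.
  by rewrite oner_eq0.
have Ha' : hb th N.+1 setT (La * (t - s) `^ ((N.+1%:R - th) * gam))
    (fun x => flow s x t 0 l - euler_scheme s t x 0 l).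
  by apply: (hb_tends (hm := fun m x => dyadic_comp euler_scheme m s t x 0 l - euler_scheme s t x 0 l) th0 _ T1) => m; exact: Ha.
apply: (@hb_ext _ _ _ _ _ _ (fun x => (flow s x t 0 l - euler_scheme s t x 0 l) +
   (euler_scheme s t x 0 l - x 0 l))).
  by apply/funext => x; rewrite addrA subrK.
rewrite mulrDl; apply: hbD; last by apply: hbS; exact: H1'.
apply: hb_le (hb_th0 Ha'); rewrite ler_wpM2l // ger_powR ?ts0 //.
exact: le_trans (ltW gam1) (ltW vt1).
Qed.

End RoughFlow.

(** * Controlled solutions *)

Section Conversions.
Context {R : realType} {n d : nat}.
Local Notation E := 'rV[R]_n.
Local Notation word := (word d).
Local Notation iterD := Defs.iterD. (* [ssrnat] has a lemma of the same name. *)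
Implicit Types (phi psi : E -> R) (x y : E) (F : E -> E) (S : set E).

Lemma smoothS k phi : (forall x, differentiable phi x) -> (forall l, smooth k (pd l phi)) ->
  smooth k.+1 phi.
Proof.
move=> dp sp; split; last by split.
by split => // x; apply: differentiable_continuous.
Qed.

Lemma smooth0 phi : continuous phi -> smooth 0 phi.
Proof. by move=> cp; split. Qed.

Lemma smooth_sum k (I : Type) (r : seq I) (h : I -> E -> R) : (forall i, smooth k (h i)) ->
  smooth k (fun x => \sum_(i <- r) h i x).
Proof. by move=> H; apply: hb_smooth (hb_sum _ (fun i _ => H i)). Qed.

Lemma smoothZ k c phi : smooth k phi -> smooth k (fun x => c * phi x).
Proof. by move=> H; apply: hb_smooth (hbZ c (lexx 0) H). Qed.

Lemma classC_coord k F m : classC k F -> classC k (fun x => F x 0 m).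
Proof.
elim: k F => [|k IH] F /=.
  by move=> cF x; apply: (@continuous_comp _ _ _ F (fun M : E => M 0 m)); [exact: cF|exact: coord_continuous].
move=> [dF cF]; split=> [x|v]; first exact: differentiable_coordfun.
rewrite (_ : (fun x => _) = fun x => 'D_v F x 0 m); first exact: IH.
by apply/funext => x; rewrite derive_coord.
Qed.

Lemma classC_smooth k phi : classC k phi -> smooth k phi.
Proof.
elim: k phi => [|k IH] phi; first exact: smooth0.
by move=> [dp cp]; apply: smoothS => // l; apply: IH; exact: cp.
Qed.

Lemma smooth_derive k phi v : smooth k.+1 phi -> smooth k (fun x => 'D_v phi x).
Proof.
move=> sp; rewrite (_ : (fun x => _) = fun x => \sum_l v 0 l * pd l phi x).
  by apply: smooth_sum => l; apply: smoothZ; exact: smooth_pd.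
by apply/funext => x; apply: derive_pd; exact: smooth_differentiable sp.
Qed.

Lemma smooth_classC k phi : smooth k phi -> classC k phi.
Proof.
elim: k phi => [|k IH] phi sp; first exact: smooth_continuous sp.
by split=> [x|v]; [exact: smooth_differentiable sp|apply: IH; exact: smooth_derive].
Qed.

Lemma iterD_rcons (U V : normedModType R) (us : seq U) (a : U) (h : U -> V) :
  iterD (rcons us a) h = iterD us (fun z => 'D_a h z).
Proof. by elim: us => [//|u us IH]; rewrite rcons_cons /= -/(iterD _ _) IH. Qed.

Lemma partials_rcons (V : normedModType R) js j (h : E -> V) :
  partials (rcons js j) h = partials js (fun x => 'D_(delta_mx 0 j) h x).
Proof. by rewrite /partials map_rcons iterD_rcons. Qed.

Lemma partials_coord k F m js x : classC k F -> (size js <= k)%N ->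
  partials js F x 0 m = partials js (fun y => F y 0 m) x.
Proof.
elim/last_ind: js k F => [//|js j IH] k F; case: k => [|k]; rewrite size_rcons // ltnS.
move=> [dF cF] jk; rewrite !partials_rcons (IH k) //; last exact: cF.
by congr (partials js _ x); apply/funext => y; rewrite derive_coord.
Qed.

Lemma hb_of_partials k S C phi : smooth k phi ->
  (forall js x, (size js <= k)%N -> S x -> `|partials js phi x| <= C) -> hb 0 k S C phi.
Proof.
elim: k phi => [|k IH] phi sp H.
  split => //; apply: hb0_of_bound; first exact: smooth_continuous sp.
  by move=> x; exact: (H [::]).
split.
  apply: hb0_of_bound; first exact: smooth_continuous sp.
  by move=> x; exact: (H [::]).
split=> [x|l]; first exact: smooth_differentiable sp.
apply: IH; first exact: smooth_pd.
by move=> js x jk Sx; have := H (rcons js l) x; rewrite size_rcons partials_rcons; apply.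
Qed.

Lemma partials_le k S C phi js x : hb 0 k S C phi -> (size js <= k)%N -> S x ->
  `|partials js phi x| <= C.
Proof.
elim/last_ind: js k phi => [|js j IH] k phi; first by move=> H _; exact: (hb_bound H).
case: k => [|k]; rewrite size_rcons // ltnS => H jk Sx; rewrite partials_rcons.
by apply: (IH k) => //; exact: hb_pd H.
Qed.

Lemma hb_of_local_bounds k S phi : smooth k phi ->
  (forall js : seq 'I_n, (size js <= k)%N -> exists C : R, forall x, S x -> `|partials js phi x| <= C) ->
  exists2 C : R, 0 <= C & hb 0 k S C phi.
Proof.
move=> sp H.
have [C HC] := choice (fun js : k.-bseq 'I_n => H js (size_bseq js)).
exists (\sum_js `|C js|); first by apply: sumr_ge0.
apply: hb_of_partials => // js x jk Sx.
apply: le_trans (HC (Bseq jk) x Sx) _; apply: le_trans (ler_norm _) _.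
by rewrite (bigD1 (Bseq jk)) //= lerDl sumr_ge0.
Qed.

Lemma hb_of_classCb k (f : 'I_d -> E -> E) : (forall i, classCb k (f i)) ->
  exists2 M : R, 0 <= M & forall i m, hb 0 k setT M (fun x => f i x 0 m).
Proof.
move=> H.
have Hex (p : 'I_d * 'I_n) : exists C : R, 0 <= C /\ hb 0 k setT C (fun x => f p.1 x 0 p.2).
  have [cf bf] := H p.1.
  have [||C C0 HC] := @hb_of_local_bounds k setT (fun x => f p.1 x 0 p.2).
  - exact/classC_smooth/classC_coord.
  - move=> js jk; have [M HM] := bf js jk; exists M => x _.
    by rewrite -(partials_coord _ _ cf) //; apply: le_trans (row_entry_le _ _) _.
  by exists C.
have [C HC] := choice Hex.
exists (\sum_p C p); first by apply: sumr_ge0 => p _; case: (HC p).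
move=> i m; have [_ H1] := HC (i, m); apply: hb_le H1.
by rewrite (bigD1 (i, m)) //= lerDl sumr_ge0 // => p _; case: (HC p).
Qed.

Lemma smooth_iterD j vs phi : smooth (j + size vs) phi -> smooth j (iterD vs phi).
Proof.
elim: vs j => [|v vs IH] j; first by rewrite addn0.
by rewrite /= addnS -addSn => /IH; exact: smooth_derive.
Qed.

Lemma iterD_cons v vs phi : smooth (size vs).+1 phi ->
  iterD (v :: vs) phi = fun x => \sum_l v 0 l * pd l (iterD vs phi) x.
Proof.
move=> sp; apply/funext => x; apply: derive_pd.
by apply: smooth_differentiable (smooth_iterD (j := 1) _).
Qed.

Lemma iterD_pd vs phi l : smooth (size vs).+1 phi -> pd l (iterD vs phi) = iterD vs (pd l phi).
Proof.
elim: vs l phi => [//|v vs IH] l phi sp.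
rewrite iterD_cons; last by apply: hb_order sp.
rewrite [RHS]iterD_cons; last exact: smooth_pd.
have sd m : smooth 1 (iterD vs (pd m phi)) by apply: smooth_iterD; exact: smooth_pd.
apply/funext => x.
have -> : (fun y => \sum_m v 0 m * pd m (iterD vs phi) y) = fun y => \sum_m v 0 m * iterD vs (pd m phi) y.
  by apply/funext => y; apply: eq_bigr => m _; rewrite IH //; apply: hb_order sp.
rewrite pd_sum; last first.
  move=> m _; apply: (@differentiableM _ _ (cst (v 0 m)) (iterD vs (pd m phi))).
    exact: differentiable_cst.
  exact: smooth_differentiable (sd m).
apply: eq_bigr => m _; rewrite pdZ; last exact: smooth_differentiable (sd m).
rewrite IH; last exact: smooth_pd.
by rewrite (IH m (pd l phi)) ?(smooth_pd_comm l m sp) //; exact: smooth_pd.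
Qed.

Lemma iterD_expand v vs phi x : smooth (size vs).+1 phi ->
  iterD (v :: vs) phi x = \sum_l v 0 l * iterD vs (pd l phi) x.
Proof.
by move=> sp; rewrite iterD_cons //; apply: eq_bigr => l _; rewrite iterD_pd.
Qed.

Lemma iterD_coord k F m vs x : classC k F -> (size vs <= k)%N ->
  iterD vs F x 0 m = iterD vs (fun y => F y 0 m) x.
Proof.
elim/last_ind: vs k F => [//|vs v IH] k F; case: k => [|k]; rewrite size_rcons // ltnS.
move=> [dF cF] vk; rewrite !iterD_rcons (IH k) //; last exact: cF.
by congr (iterD vs _ x); apply/funext => y; rewrite derive_coord.
Qed.

(** Since [xi] is 0 at the empty word, this allows tuples containing the empty word to be added to
    the sum in [lift_comp]. *)
Lemma iterD0 vs phi x : 0 \in vs -> smooth (size vs) phi -> iterD vs phi x = 0.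
Proof.
elim: vs phi x => [//|v vs IH] phi x; rewrite inE => /orP[/eqP <-|v0] sp.
  by rewrite iterD_cons // big1 // => l _; rewrite mxE mul0r.
rewrite iterD_expand // big1 // => l _; rewrite IH ?mulr0 //.
exact: smooth_pd.
Qed.

Lemma size_shuffle (A : eqType) (u v w : seq A) : w \in shuffle u v -> size w = (size u + size v)%N.
Proof.
elim: u v w => [|a u IHu] v w; first by rewrite inE => /eqP ->.
elim: v w => [|b v IHv] w; first by rewrite inE => /eqP ->; rewrite addn0.
rewrite [shuffle _ _]/= mem_cat => /orP[] /mapP[w' w'in ->] /=.
  by rewrite (IHu _ _ w'in).
by rewrite (IHv _ w'in) /= addSn addnS.
Qed.

Lemma wsum_extend m p (G : word -> R) : (forall w, (m < size w)%N -> G w = 0) ->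
  wsum (m + p) G = wsum m G.
Proof.
elim: m G => [|m IH] G H.
  rewrite add0n wsum_ord0; case: p => [|p]; rewrite ?wsum_ord0 // wsumS big1 ?addr0 // => i _.
  by rewrite (eq_wsum (G := fun=> 0)) ?wsum0 // => w _; rewrite H.
rewrite addSn !wsumS; congr (_ + _); apply: eq_bigr => i _; apply: IH => w mw; exact: H.
Qed.

Lemma wsum_pick m w (G : word -> R) : (size w <= m)%N -> wsum m (fun v => G v * (v == w)%:R) = G w.
Proof.
rewrite -wsum_bseq => wm; rewrite (bigD1 (Bseq wm)) //= eqxx mulr1 big1 ?addr0 // => v vw.
by rewrite (_ : (_ == _) = false) ?mulr0 //; apply: contraNF vw => /eqP vE; apply/eqP/val_inj.
Qed.

Lemma shuffle_eval_indicator w (u v : word) :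
  shuffle_eval (fun v' => (v' == w)%:R : R) u v = (count_mem w (shuffle u v))%:R.
Proof. by rewrite /shuffle_eval -sum1_count natr_sum [RHS]big_mkcond /=; apply: eq_bigr => i _; case: ifP. Qed.

(** This is [wsum_fshuffle] tested against the indicator of w. Pairs with |u| + |v| > m contribute
    nothing because all shuffles of u and v have length |u| + |v|. *)
Lemma fshuffle_count m w (P Q : word -> R) : (size w <= m)%N ->
  fshuffle w P Q = \sum_(u : m.-bseq 'I_d) \sum_(v : m.-bseq 'I_d)
    P u * Q v * (count_mem w (shuffle u v))%:R.
Proof.
move=> wm; rewrite -(wsum_pick (fun w => fshuffle w P Q) wm) wsum_fshuffle wsum2_nested.
rewrite -wsum_bseq; apply: eq_bigr => u _.
have -> : \sum_(v : m.-bseq 'I_d) P u * Q v * (count_mem w (shuffle u v))%:R =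
    wsum (m - size u + size u) (fun v => P u * Q v * shuffle_eval (fun v' => (v' == w)%:R) u v).
  by rewrite subnK ?size_bseq // -wsum_bseq; apply: eq_bigr => v _; rewrite shuffle_eval_indicator.
rewrite wsum_extend // => v uv.
rewrite shuffle_eval_indicator (_ : count_mem w _ = 0%N) ?mulr0 //.
apply/count_memPn; apply/negP => /size_shuffle sz.
by move: wm; rewrite sz leqNgt; move: uv; rewrite ltn_subLR ?size_bseq // => ->.
Qed.

End Conversions.

(** * Coefficients of lifted vector fields *)

Section LiftedFields.
Context {R : realType} {n d : nat}.
Local Notation E := 'rV[R]_n.
Local Notation word := (word d).
Local Notation iterD := Defs.iterD.
Implicit Types (phi psi : E -> R) (x y : E) (F : E -> E) (w : word).

Lemma sum_count m (s : seq word) (G : word -> R) : (forall v, (m < size v)%N -> G v = 0) ->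
  \sum_(v <- s) G v = \sum_(v : m.-bseq 'I_d) (count_mem (v : word) s)%:R * G v.
Proof.
move=> H; elim: s => [|v s IH].
  by rewrite big_nil big1 // => v _; rewrite mul0r.
rewrite big_cons IH.
rewrite [RHS](eq_bigr (fun u : m.-bseq 'I_d => (v == u)%:R * G u + (count_mem (u : word) s)%:R * G u)); last first.
  by move=> u _; rewrite /= natrD mulrDl.
rewrite big_split /=; congr (_ + _); have [vm|vm] := leqP (size v) m.
  rewrite (bigD1 (Bseq vm)) //= eqxx mul1r big1 ?addr0 // => u uv.
  by rewrite (_ : (v == u) = false) ?mul0r //; apply: contraNF uv => /eqP vE; apply/eqP/val_inj.
rewrite H // big1 // => u _; rewrite (_ : (v == u) = false) ?mul0r //.
by apply: contraTF vm => /eqP ->; rewrite -leqNgt size_bseq.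
Qed.

Lemma sum_tuple_cons (A : finType) k (G : seq A -> R) :
  \sum_(us : k.+1.-tuple A) G us = \sum_(u : A) \sum_(us : k.-tuple A) G (u :: us).
Proof.
rewrite pair_big /= (reindex (fun p : A * k.-tuple A => [tuple of p.1 :: p.2])) //=.
exists (fun us : k.+1.-tuple A => (thead us, [tuple of behead us])) => [[u us]|us] _ /=.
  by congr (_, _); apply: val_inj.
by rewrite [us in RHS]tuple_eta; apply: val_inj.
Qed.

Variables (f : 'I_d -> E -> E) (K : nat) (Mf : R).
Hypothesis hf : forall i m, hb 0 K setT Mf (fun x => f i x 0 m).
Hypothesis Mf0 : 0 <= Mf.

Lemma lies_coord_differentiable w l x : (size w <= K)%N -> differentiable (lies f w (fun y => y 0 l)) x.
Proof.
case: w => [|i w] wK; first exact: differentiable_coord.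
exact: (@xi_differentiable _ _ _ f K Mf hf Mf0 l (i :: w)).
Qed.

Lemma Fword_lies w x l : (size w <= K.+1)%N -> Fword f w x 0 l = lies f w (fun y => y 0 l) x.
Proof.
elim: w x l => [//|i w IH] x l; rewrite /= ltnS => wK.
have FE k : (fun y => Fword f w y 0 k) = lies f w (fun y => y 0 k).
  by apply/funext => y; apply: IH; exact: leqW.
have dF : differentiable (Fword f w) x.
  by apply: differentiable_row => k; rewrite FE; exact: lies_coord_differentiable.
by rewrite derive_coord // FE derive_pd //; exact: lies_coord_differentiable.
Qed.

Lemma Gamw_lies w phi : (size w <= K.+1)%N -> smooth (size w) phi -> Gamw f w phi = lies f w phi.
Proof.
elim: w => [//|i w IH] wK sp; rewrite /= -/(Gamw f w phi).
rewrite IH; [|exact: ltnW|exact: hb_order sp].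
have sl : smooth 1 (lies f w phi).
  have := hb_lies (S := set0) (C := 0) (k := 1) (w := w) hf Mf0 _ (lexx 0).
  by rewrite add1n => /(_ _ wK sp) /hb_smooth.
apply/funext => x; rewrite /Gam derive_pd //; exact: smooth_differentiable sl.
Qed.

Definition xi_row x u : E := \row_l xi f l u x.

(** Peeling off the first entry of the tuple reproduces the recursion of [faa]: an intermediate word
    v records the shuffle of the remaining entries. *)
Lemma sum_iterD_shuffles k m w phi x : (size w <= m)%N -> smooth k phi ->
  \sum_(us : k.-tuple (m.-bseq 'I_d)) (count_mem w (shuffles [seq bseqval u | u <- us]))%:R *
    iterD [seq xi_row x (bseqval u) | u <- us] phi x = faa f k phi w x.
Proof.
elim: k w phi => [|k IH] w phi wm sp.
  rewrite (bigD1 [tuple]) //= big1 ?addr0; last by move=> us; rewrite (tuple0 us).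
  by case: w wm => [|i w] _ /=; rewrite ?mul1r ?mul0r.
rewrite (sum_tuple_cons k (fun us : seq (m.-bseq 'I_d) => (count_mem w (shuffles [seq bseqval u | u <- us]))%:R *
    iterD [seq xi_row x (bseqval u) | u <- us] phi x)).
rewrite [RHS]/=.
under [RHS]eq_bigr => l _ do rewrite (fshuffle_count _ _ wm).
rewrite [RHS]exchange_big /=; apply: eq_bigr => u _.
rewrite [RHS]exchange_big /=.
under [RHS]eq_bigr => v _.
  under eq_bigr => l _ do rewrite -(IH _ _ (size_bseq v) (smooth_pd l sp)) -mulrA mulr_suml mulr_sumr.
  rewrite exchange_big /=; over.
rewrite [RHS]exchange_big /=; apply: eq_bigr => us _.
set vs := [seq xi_row x (bseqval u) | u <- us].
have svs : size vs = k by rewrite size_map size_tuple.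
rewrite [X in _ * X](_ : _ = iterD (xi_row x u :: vs) phi x) // iterD_expand ?svs //.
rewrite count_flatten -map_comp sumnE big_map natr_sum.
rewrite (@sum_count m _ (fun v => (count_mem w (shuffle u v))%:R)); last first.
  move=> v mv; rewrite (_ : count_mem w _ = 0%N) //.
  apply/count_memPn; apply/negP => /size_shuffle sz.
  by move: wm; rewrite sz leqNgt ltn_addl.
rewrite mulr_suml; apply: eq_bigr => v _; rewrite mulr_sumr; apply: eq_bigr => l _.
rewrite mxE; move: (iterD vs _ x) (xi f l u x) => a b.
by move: (_%:R) (_%:R) => c e; ring.
Qed.

(** If the coefficients of X at time t are the F_u, the composition formula is the Faa di Bruno sum
    for Gamma_w. *)
Lemma lift_comp_lies F (X : R -> word -> E) t w m : (size w <= K.+1)%N ->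
  classC (size w) F -> smooth (size w).+1 (fun y => F y 0 m) ->
  (forall u l, u != [::] -> (size u <= size w)%N -> X t u 0 l = xi f l u (X t [::])) ->
  lift_comp F X t w 0 m = lies f w (fun y => F y 0 m) (X t [::]).
Proof.
move=> wK cF sF HX; rewrite /lift_comp; case: eqVneq => [->//|w0].
set x := X t [::]; set phi := fun y => F y 0 m.
rewrite -(faa_di_bruno hf Mf0 x (leqnn _) wK sF) /faa_sum.
rewrite -(big_mkord xpredT (fun k => (k`!%:R)^-1 * faa f k phi w x)) big_nat_recl // .
(* The term j = 0 vanishes because w is nonempty, which matches the sum over k >= 1 in
   [lift_comp]. *)
rewrite [faa f 0 _ _ _](_ : _ = 0) ?mulr0 ?add0r; last by case: w w0 {wK cF sF HX}.
rewrite big_add1 /= summxE; apply: eq_big_nat => k /andP[_ kw].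
rewrite mxE; congr (_ * _).
rewrite -[RHS]/(faa f k.+1 phi w x) -(sum_iterD_shuffles (m := size w)) //; last by apply: hb_order sF; exact: ltnW.
rewrite big_mkcond summxE; apply: eq_bigr => us _.
have svs : size [seq xi_row x (bseqval u) | u <- us] = k.+1 by rewrite size_map size_tuple.
case: ifPn => [us0|]; last first.
  rewrite negbK => us0; rewrite mxE iterD0 ?mulr0 //.
    case/mapP: us0 => u uin u0; apply/mapP; exists u => //.
    by apply/rowP => l; rewrite !mxE -u0.
  by rewrite svs; apply: hb_order sF; exact: ltnW.
rewrite mxE; congr (_ * _); rewrite (iterD_coord _ _ cF); last by rewrite !size_map size_tuple.
congr (iterD _ _ _); rewrite -map_comp; apply/eq_in_map => u uin; apply/rowP => l.
rewrite mxE /= HX ?size_bseq //; apply: contraNneq us0 => <-; exact: map_f.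
Qed.

End LiftedFields.

(** * Sewing *)

Section Sewing.
Context {R : realType} {V : normedModType R}.
Implicit Types (s : seq R) (G : R -> R -> V).

Definition germ_sum G (a : R) s : V :=
  let p := nth a (a :: s) in \sum_(0 <= k < size s) G (p k) (p k.+1).

Lemma germ_sum_cons G a x s : germ_sum G a (x :: s) = G a x + germ_sum G x s.
Proof.
rewrite /germ_sum /= big_nat_recl //=; congr (_ + _).
apply: eq_big_nat => k /andP[_ ks].
by congr (G _ _); [apply: set_nth_default; rewrite /= ltnS ltnW|apply: set_nth_default].
Qed.

Lemma germ_sum_cat G a s1 s2 : germ_sum G a (s1 ++ s2) = germ_sum G a s1 + germ_sum G (last a s1) s2.
Proof.
elim: s1 a => [|x s1 IH] a; first by rewrite [X in X + _]/germ_sum /= big_nil add0r.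
by rewrite cat_cons !germ_sum_cons IH addrA.
Qed.

Lemma mesh_lt_cons (a x : R) s e : mesh_lt a (x :: s) e <-> x - a < e /\ mesh_lt x s e.
Proof.
have E k : (k < size s)%N -> nth a s k - nth a (x :: s) k = nth x s k - nth x (x :: s) k.
  by move=> ks; congr (_ - _); apply: set_nth_default => //=; rewrite ltnS ltnW.
rewrite /mesh_lt /=; split=> [H|[H1 H2]].
  by split=> [|k ks]; [exact: (H 0%N)|have /= := H k.+1 ks; rewrite E].
by move=> [|k] //= ks; rewrite E //; exact: H2.
Qed.

Lemma mesh_lt_cat (a : R) s1 s2 e : mesh_lt a s1 e -> mesh_lt (last a s1) s2 e -> mesh_lt a (s1 ++ s2) e.
Proof.
elim: s1 a => [a _|x s1 IH a /mesh_lt_cons[H1 H2] H]; first by [].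
by rewrite cat_cons; apply/mesh_lt_cons; split => //; exact: IH.
Qed.

Fixpoint dyadic_partition m (r t : R) : seq R :=
  if m is m'.+1 then dyadic_partition m' r ((r + t) / 2) ++ dyadic_partition m' ((r + t) / 2) t
  else [:: t].

Lemma dyadic_partitionP m r t : r < t -> itv_partition r t (dyadic_partition m r t).
Proof.
elim: m r t => [|m IH] r t rt; first exact: itv_partition1.
have /andP[rm mt] := midpoint_lt rt.
by apply: (itv_partition_cat (IH _ _ rm) (IH _ _ mt)).
Qed.

Lemma mesh_dyadic_partition m r t e : r < t -> (t - r) * 2^-1 ^+ m < e ->
  mesh_lt r (dyadic_partition m r t) e.
Proof.
elim: m r t => [|m IH] r t rt.
  by rewrite mulr1 => te; apply/mesh_lt_cons; split.
have /andP[rm mt] := midpoint_lt rt; have [mr tm] := midpoint_sub r t.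
rewrite exprS mulrA => te; apply: mesh_lt_cat; first by apply: IH; rewrite ?mr.
have [_ /eqP ->] := dyadic_partitionP m rm; by apply: IH; rewrite ?tm.
Qed.

Variables (G : R -> R -> V) (a b C vt : R).
Hypothesis vt1 : 1 < vt.
Hypothesis C0 : 0 <= C.
Hypothesis defect : forall r t, a <= r -> r < t -> t <= b -> t - r <= 1 ->
  `|G r ((r + t) / 2) + G ((r + t) / 2) t - G r t| <= C * (t - r) `^ vt.

Let q : R := 2 * 2 `^ (- vt).

Lemma sewing_ratio : 0 <= q < 1.
Proof.
rewrite /q mulr_ge0 ?powR_ge0 //= -[X in X * _](powRr1 (ler0n R 2)) -powRD ?pnatr_eq0 ?implybT //.
rewrite -[ltRHS](powRr0 2) /powR !gt_eqF // ltr_expR mul0r.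
by rewrite pmulr_llt0 ?subr_lt0 // ln_gt0 // ltr1n.
Qed.

Definition sewing_const : R := C / (1 - q).

(** The constant reproduces itself: the two halves return q times the bound, and the defect adds C,
    which equals 1 - q times [sewing_const]. *)
Lemma germ_sum_dyadic m r t : a <= r -> r < t -> t <= b -> t - r <= 1 ->
  `|germ_sum G r (dyadic_partition m r t) - G r t| <= sewing_const * (t - r) `^ vt.
Proof.
have /andP[q0 q1] := sewing_ratio.
have K0 : 0 <= sewing_const by rewrite divr_ge0 // subr_ge0 ltW.
elim: m r t => [|m IH] r t ar rt tb tr1.
  by rewrite germ_sum_cons {1}/germ_sum /= big_nil addr0 subrr normr0 mulr_ge0 ?powR_ge0.
have /andP[rm mt] := midpoint_lt rt; have [mr tm] := midpoint_sub r t.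
have := defect ar rt tb tr1.
rewrite /= germ_sum_cat; have [_ /eqP ->] := dyadic_partitionP m rm.
set w := (r + t) / 2 in rm mt mr tm *.
have h1 : (t - r) / 2 <= 1 by rewrite ler_pdivrMr // mul1r (le_trans tr1) // ler1n.
have := IH r w ar rm (le_trans (ltW mt) tb) (ltac:(by rewrite mr)).
have := IH w t (le_trans ar (ltW rm)) mt tb (ltac:(by rewrite tm)).
rewrite mr tm powR_half; last by rewrite subr_ge0 ltW.
move: (germ_sum G r _) (germ_sum G w _) (G r w) (G w t) (G r t) => A B P Q S.
move=> H1 H2 H3.
have -> : A + B - S = (B - Q) + ((A - P) + (P + Q - S)).
  by rewrite -(addrA P Q) (addrA (A - P)) subrK addrCA (addrA (B - Q)) subrK addrA [B + A]addrC.
apply: le_trans (ler_normD _ _) _; apply: le_trans (lerD H1 (le_trans (ler_normD _ _) (lerD H2 H3))) _.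
rewrite le_eqVlt; apply/orP; left; apply/eqP.
have CE : sewing_const * (1 - q) = C by rewrite /sewing_const divfK // subr_eq0 gt_eqF.
by rewrite -CE /q; ring.
Qed.

Variables (I : R -> V).
Hypothesis integral : forall t, a <= t <= b -> forall e : R, 0 < e -> exists2 delta : R, 0 < delta &
  forall s, itv_partition a t s -> mesh_lt a s delta -> `|germ_sum G a s - I t| < e.

Lemma fine_dyadic (r t e : R) : r < t -> 0 < e -> exists m, mesh_lt r (dyadic_partition m r t) e.
Proof.
move=> rt e0; have tr : 0 < t - r by rewrite subr_gt0.
have h01 : 0 <= (2^-1 : R) < 1 by rewrite invr_ge0 ler0n /= invf_lt1 // ltr1n.
have [M HM] := geometric_vanish h01 (divr_gt0 e0 tr).
exists M; apply: mesh_dyadic_partition => //.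
by rewrite mulrC -ltr_pdivlMr // HM.
Qed.

(** Convergence along all partitions is given, so partitions can be chosen: a fine one of [a, r]
    followed by a fine dyadic one of [r, t]. The difference of the two integrals is then close to a
    dyadic sum over [r, t], to which [germ_sum_dyadic] applies. *)
Theorem sewing r t : a <= r -> r < t -> t <= b -> t - r <= 1 ->
  `|I t - I r - G r t| <= sewing_const * (t - r) `^ vt.
Proof.
move=> ar rt tb tr1; apply/ler_addgt0Pr => e e0.
have e2 : 0 < e / 2 by rewrite divr_gt0.
have rI : a <= r <= b by rewrite ar (le_trans (ltW rt)).
have tI : a <= t <= b by rewrite tb (le_trans ar) // ltW.
have [d1 d10 H1] := integral rI e2; have [d2 d20 H2] := integral tI e2.
have dm : 0 < Num.min d1 d2 by rewrite lt_min d10.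
have mesh_min s x (e1 e3 : R) : mesh_lt x s (Num.min e1 e3) -> mesh_lt x s e1 /\ mesh_lt x s e3.
  by rewrite /mesh_lt /= => H; split=> k ks; have := H k ks; rewrite lt_min => /andP[].
have [s1 P1 M1] : exists2 s1, itv_partition a r s1 & mesh_lt a s1 (Num.min d1 d2).
  (* For r = a the partition is the empty list. *)
  move: ar; rewrite le_eqVlt => /orP[/eqP <-|ar]; first by exists [::].
  by have [m Hm] := fine_dyadic ar dm; exists (dyadic_partition m a r) => //; exact: dyadic_partitionP.
have [m M2] := fine_dyadic rt dm.
have P2 := dyadic_partitionP m rt.
have [M11 M12] := mesh_min _ _ _ _ M1.
have lr : last a s1 = r by case: P1 => _ /eqP.
have := H1 _ P1 M11.
have := H2 (s1 ++ dyadic_partition m r t) (itv_partition_cat P1 P2).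
have M3 : mesh_lt a (s1 ++ dyadic_partition m r t) d2.
  by apply: mesh_lt_cat; rewrite ?lr //; have [] := mesh_min _ _ _ _ M2.
move=> /(_ M3).
have := germ_sum_dyadic m ar rt tb tr1.
rewrite germ_sum_cat lr.
move: (germ_sum G a _) (germ_sum G r _) (I t) (I r) (G r t) => A B J J' S L1 L2 L3.
have -> : J - J' - S = (B - S) + ((A - J') - (A + B - J)).
  rewrite opprB (addrC A (- J')) -(addrA (- J')) (addrCA A J) opprD (addrA A (- A)) subrr add0r.
  by rewrite (addrCA (B - S)) (addrC (B - S)) (addrA (J - B)) subrK addrA (addrC (- J')).
apply: le_trans (ler_normD _ _) _; apply: lerD => //.
apply: le_trans (ler_normB _ _) _; by rewrite [leRHS]splitr ltW // ltrD.
Qed.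

End Sewing.

(** * Germs of the rough integrals in the equation *)

Section RdeSolutions.
Context {R : realType} {n d : nat}.
Local Notation E := 'rV[R]_n.
Local Notation word := (word d).
Implicit Types (g h : word -> R) (G : word -> R).

Lemma wsum_norm m G C : (forall w, (size w <= m)%N -> `|G w| <= C) -> `|wsum m G| <= (1 + d%:R) ^+ m * C.
Proof.
elim: m G => [|m IH] G H; first by rewrite wsum_ord0 expr0 mul1r H.
have C0 : 0 <= C by apply: le_trans (H [::] _).
rewrite wsumS; apply: le_trans (ler_normD _ _) _.
apply: (@le_trans _ _ (C + \sum_(i < d) (1 + d%:R) ^+ m * C)).
  apply: lerD; first exact: H.
  by apply: le_trans (ler_norm_sum _ _ _) _; apply: ler_sum => i _; apply: IH => w wm; exact: H.
rewrite sumr_const card_ord -[_ *+ d]mulr_natl exprS -subr_ge0.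
rewrite (_ : _ - _ = ((1 + d%:R) ^+ m - 1) * C); last by ring.
by rewrite mulr_ge0 // subr_ge0 one_dge1.
Qed.

(** An integral against W^i pairs words that end in i, so the last letter has to be peeled off
    here. *)
Lemma wsum_rcons m G : wsum m.+1 G = G [::] + \sum_(i < d) wsum m (fun w => G (rcons w i)).
Proof.
elim: m G => [|m IH] G.
  by rewrite wsumS; congr (_ + _); apply: eq_bigr => i _; rewrite !wsum_ord0.
rewrite wsumS; congr (_ + _); under eq_bigr do rewrite IH.
under [RHS]eq_bigr do rewrite wsumS.
by rewrite !big_split /= [X in _ + X]exchange_big.
Qed.

Lemma star_rcons g h w i :
  star g h (rcons w i) = g (rcons w i) * h [::] + star g (fun v => h (rcons v i)) w.
Proof.
elim: w g => [|a w IH] g; first by rewrite /= star_cons !star_nil addrC.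
by rewrite rcons_cons !star_cons IH addrCA.
Qed.

Lemma classC_order (V U : normedModType R) (F : V -> U) j k : (j <= k)%N -> classC k F -> classC j F.
Proof.
elim: j k F => [|j IH] [|k] F //=.
  by move=> _ [dF _] x; exact: differentiable_continuous.
by move=> jk [dF cF]; split=> // v; apply: (IH k).
Qed.

Lemma lift_int_rcons (V : normedModType R) (J : R -> V) Y i t (w : word) j :
  lift_int J Y i t (rcons w j) = if j == i then Y t w else 0.
Proof.
by case: w => [//|a w]; rewrite /lift_int rcons_cons last_rcons belast_rcons.
Qed.

Section Germ.
Variables (f : 'I_d -> E -> E) (N : nat) (Mf : R).
Hypothesis hf : forall i m, hb 0 (2 * N + 1) setT Mf (fun x => f i x 0 m).
Hypothesis Mf0 : 0 <= Mf.
Variable c0 : R.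
Hypothesis c00 : 0 <= c0.
Local Notation pr l := (fun y : E => y 0 l).

(** The point y may miss the Euler point by A eta^N: the function is Lipschitz and N - |v| <= N, so
    the replacement does not spoil the rate of the expansion. *)
Lemma germ_bracket : exists2 B : R, 0 <= B & forall g eta A x y (v : word) i l,
  0 <= eta <= 1 -> rough_functional N c0 eta g -> 0 <= A -> (size v < N)%N ->
  `|y - euler_map f N g x| <= A * eta ^+ N ->
  `|lies f (rcons v i) (pr l) y -
    wsum (N.-1 - size v) (fun u => lies f (u ++ rcons v i) (pr l) x * g u)|
  <= B * (1 + A) * eta ^+ (N - size v).
Proof.
have [X X0 hX] := hb_xi_word hf Mf0.
have kN : (0 + N <= (2 * N + 1).+1)%N by lia.
have [B B0 HB] := hb_bracket_uniform hf Mf0 c00 kN.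
exists ((n%:R + B) * X); first by rewrite mulr_ge0 // addr_ge0.
move=> g eta A x y v i l e01 rg A0 vN Hy; have /andP[e0 e1] := e01.
set P := lies f (rcons v i) (pr l).
have PE : P = xi f l (rcons v i) by rewrite /P; case: v {vN P}.
have vN1 : (size (rcons v i) <= N)%N by rewrite size_rcons.
have HP k : (k <= N.+1)%N -> hb 0 k setT X P.
  by move=> k1; rewrite PE; apply: hX => //; move: vN1 k1; clear; lia.
have mN : (N - size v <= N.+1)%N by rewrite leqW // leq_subr.
have H := HB (N - size v)%N setT setT X eta P g mN X0 e01 rg (fun _ _ _ _ => I) (HP _ _).
have {H} := hb_bound (H _) (I : setT x).
rewrite addn0 (leq_trans (leq_subr _ _)) // => /(_ isT).
have -> : (N - size v = (N.-1 - size v).+1)%N by move: vN; clear; lia.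
rewrite [wsum_lt _ _]/= => H.
rewrite (eq_wsum (G := fun w => lies f w P x * g w)); last by move=> u _; rewrite lies_cat.
have L1 : `|P y - P (euler_map f N g x)| <= n%:R * X * (A * eta ^+ N).
  have HP1 := HP 1%N isT.
  apply: le_trans (@lipschitz_of_pd _ _ setT P X _ X0 (@convex_setT R n) _ y _ I I) _.
  - by move=> z; exact: hb_differentiable HP1.
  - by move=> z m _; exact: hb_bound (hb_pd m HP1) I.
  - by rewrite ler_wpM2l // mulr_ge0.
have eN : eta ^+ N <= eta ^+ (N.-1 - size v).+1.
  by apply: ler_wiXn2l => //; move: vN; clear; lia.
have e2 : 0 <= eta ^+ (N.-1 - size v).+1 by rewrite exprn_ge0.
set w := wsum _ _ in H *; set p := P (euler_map _ _ _ _) in H L1; set q := P y in L1 *.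
have {}H : `|p - w| <= B * X * eta ^+ (N.-1 - size v).+1 by exact: H.
move: (eta ^+ N) (eta ^+ (N.-1 - size v).+1) eN e2 H L1 => e e' eN e2 H L1.
have -> : q - w = (q - p) + (p - w) by rewrite addrA subrK.
apply: le_trans (ler_normD _ _) _; apply: le_trans (lerD L1 H) _.
have n0 : 0 <= n%:R :> R by [].
apply: (@le_trans _ _ (n%:R * X * (A * e') + B * X * e')).
  by apply: lerD; [rewrite ler_wpM2l ?mulr_ge0 // ler_wpM2l|].
rewrite -subr_ge0 (_ : _ - _ = n%:R * X * e' + B * X * A * e'); last by ring.
by rewrite addr_ge0 // !mulr_ge0.
Qed.

(** The summand of the compensated Riemann sum for the l-th coordinate of the integral of f_i, when
    the coefficients of the solution are the F_w. *)
Definition taylor_germ i l (k : word -> R) (z : E) : R :=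
  wsum N.-1 (fun w => k (rcons w i) * lies f (rcons w i) (pr l) z).

(** Chen's relation as in [euler_defectE], with the last letter i fixed on the h side: h (v i) gives
    eta^(|v|+1) and the expansion error gives eta^(N-|v|). *)
Lemma germ_defect : exists2 B : R, 0 <= B & forall g h eta A x y i l,
  0 <= eta <= 1 -> rough_functional N c0 eta g -> rough_functional N c0 eta h ->
  0 <= A -> `|y - euler_map f N g x| <= A * eta ^+ N -> (0 < N)%N ->
  `|taylor_germ i l g x + taylor_germ i l h y - taylor_germ i l (star g h) x| <= B * (1 + A) * eta ^+ N.+1.
Proof.
have [B B0 HB] := germ_bracket.
exists ((1 + d%:R) ^+ N.-1 * (c0 * B)); first by rewrite mulr_ge0 ?one_dge0 // mulr_ge0.
move=> g h eta A x y i l e01 rg rh A0 Hy N0; have /andP[e0 e1] := e01.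
have [h1 hw _] := rh.
have NE : N.-1.+1 = N by rewrite prednK.
set germ := taylor_germ i l.
pose Q (v : word) := lies f (rcons v i) (pr l) y -
    wsum (N.-1 - size v) (fun u => lies f (u ++ rcons v i) (pr l) x * g u).
have -> : germ g x + germ h y - germ (star g h) x = wsum N.-1 (fun v => h (rcons v i) * Q v).
  have -> : germ (star g h) x = germ g x +
      wsum N.-1 (fun v => h (rcons v i) * wsum (N.-1 - size v) (fun u => lies f (u ++ rcons v i) (pr l) x * g u)).
    rewrite /germ /taylor_germ; under eq_wsum => w _ do rewrite star_rcons h1 mulr1 mulrDl.
    rewrite wsumD; congr (_ + _).
    under eq_wsum => w _ do rewrite mulrC.
    rewrite wsum_star wsum2_swap wsum2_nested; apply: eq_wsum => v _; rewrite -wsumZ.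
    by apply: eq_wsum => u _; rewrite rcons_cat mulrA mulrC.
  have -> : wsum N.-1 (fun v => h (rcons v i) * Q v) = germ h y + (-1) *
      wsum N.-1 (fun v => h (rcons v i) * wsum (N.-1 - size v) (fun u => lies f (u ++ rcons v i) (pr l) x * g u)).
    by rewrite -wsumZ -wsumD; apply: eq_wsum => v _; rewrite /Q mulrBr mulN1r.
  by move: (germ g x) (germ h y) (wsum _ _) => a b c; ring.
rewrite -!mulrA; apply: wsum_norm => v vN; rewrite normrM.
have vN' : (size v < N)%N by rewrite -NE ltnS.
have H1 := HB g eta A x y v i l e01 rg A0 vN' Hy.
have H2 : `|h (rcons v i)| <= c0 * eta ^+ (size v).+1 by rewrite -(size_rcons v i) hw // size_rcons.
apply: le_trans (ler_pM (normr_ge0 _) (normr_ge0 _) H2 H1) _.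
have -> : eta ^+ N.+1 = eta ^+ (size v).+1 * eta ^+ (N - size v) by rewrite -exprD addSn subnKC // ltnW.
by rewrite le_eqVlt; apply/orP; left; apply/eqP; move: (eta ^+ _) (eta ^+ _) => p q; ring.
Qed.

End Germ.
End RdeSolutions.

(** * Davie's estimate for controlled solutions *)

Section RdeDavie.
Context {R : realType} {n d : nat}.
Local Notation E := 'rV[R]_n.
Local Notation word := (word d).
Local Notation pr l := (fun y : E => y 0 l).
Variables (gam T : R) (W : R -> word -> R).
Hypothesis gam0 : 0 < gam.
Hypothesis gam1 : gam < 1.
Hypothesis hW : geometric_rough_path gam T W.
Let N := Nreg gam.
Variables (f : 'I_d -> E -> E) (Mf : R).
Hypothesis hf : forall i m, hb 0 (2 * N + 1) setT Mf (fun x => f i x 0 m).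
Hypothesis Mf0 : 0 <= Mf.
Hypothesis cf : forall i, classC (2 * N + 1) (f i).

Lemma Nreg_gt0 : (0 < N)%N.
Proof. by rewrite /N /Nreg truncn_gt0 ltW // invf_gt1. Qed.

Variables (a : R) (X : R -> E) (XX : R -> word -> E) (J : 'I_d -> R -> E).
Hypothesis a0 : 0 <= a.
Hypothesis XX_controlled : controlled gam N W a T XX.
Hypothesis XX_nil : forall t, t \in `[a, T] -> XX t [::] = X t.
Hypothesis XX_init : forall w : word, (size w <= N.-1)%N -> XX a w = Fword f w (X a).
Hypothesis J_integral : forall i t, t \in `[a, T] -> is_rough_int N W (lift_comp (f i) XX) i a t (J i t).
Hypothesis XX_increment : forall s t, a <= s -> s < t -> t <= T ->
  forall w : word, (size w <= N.-1)%N ->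
  XX t w - XX s w = \sum_(i < d) (lift_int (J i) (lift_comp (f i) XX) i t w -
                                  lift_int (J i) (lift_comp (f i) XX) i s w).

Lemma lifted_field_coord i (w : word) t l : t \in `[a, T] -> (size w <= N.-1)%N ->
  (forall u m, (size u <= size w)%N -> XX t u 0 m = lies f u (pr m) (X t)) ->
  lift_comp (f i) XX t w 0 l = lies f (rcons w i) (pr l) (X t).
Proof.
move=> tI wN HX; have N0 := Nreg_gt0.
have wN2 : (size w <= 2 * N + 1)%N by move: wN; clear; lia.
have wN1 : ((size w).+1 <= 2 * N + 1)%N by move: wN N0; clear; lia.
rewrite (lift_comp_lies hf Mf0 (leqW wN2) (classC_order wN2 (cf i))).
- by rewrite XX_nil // -cats1 lies_cat /= lie_coord.
- by apply: hb_order wN1 _; exact: hb_smooth (hf i l).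
move=> u m u0 uw; rewrite HX // XX_nil //.
by case: u u0 {uw}.
Qed.

(** Induction on length. For the word v j only the integral against W^j contributes, and the
    equation says that this coefficient has the increments of the lift of f_j at v, which is F_(vj)
    along X by induction; the prescribed initial coefficients fix the constant. *)
Lemma rde_coefficient (w : word) t l : t \in `[a, T] -> (size w <= N.-1)%N ->
  XX t w 0 l = lies f w (pr l) (X t).
Proof.
move=> tI; have [m] := ubnP (size w); elim: m w l => // m IH w l; rewrite ltnS => wm wN.
have aT : a \in `[a, T].
  by move: tI; rewrite !in_itv /= lexx => /andP[]; exact: le_trans.
have [->|w0] := eqVneq w [::]; first by rewrite XX_nil.
have FE : XX a w 0 l = lies f w (pr l) (X a).
  by rewrite XX_init // (Fword_lies hf Mf0) //; move: wN; clear; lia.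
have [<- //|ta] := eqVneq a t.
have {ta} at_ : a < t by rewrite lt_neqAle ta; move: tI; rewrite in_itv /= => /andP[].
have tT : t <= T by move: tI; rewrite in_itv /= => /andP[].
move: w0 wm wN FE; case/lastP: w => [//|v j] _; rewrite size_rcons => vm vN FE.
have wN : (size (rcons v j) <= N.-1)%N by rewrite size_rcons.
have := XX_increment (lexx a) at_ tT wN.
under eq_bigr do rewrite !lift_int_rcons.
rewrite (bigD1 j) //= eqxx big1 ?addr0; last first.
  by move=> i ij; rewrite eq_sym (negbTE ij) subrr.
move=> /rowP /(_ l); rewrite !mxE FE => H.
have Y s : s \in `[a, T] -> (forall u m, (size u <= size v)%N -> XX s u 0 m = lies f u (pr m) (X s)) ->
    lift_comp (f j) XX s v 0 l = lies f (rcons v j) (pr l) (X s).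
  by move=> sI; apply: lifted_field_coord => //; exact: ltnW.
move: H; rewrite Y //; last first.
  by move=> u k uv; apply: IH; [exact: leq_ltn_trans vm|apply: leq_trans uv _; exact: ltnW].
rewrite Y //; last first.
  move=> u k uv; rewrite XX_init; last by apply: leq_trans uv _; exact: ltnW.
  by rewrite (Fword_lies hf Mf0) //; move: uv vN; clear; lia.
by move/(congr1 (+%R^~ (lies f (rcons v j) (pr l) (X a)))); rewrite !subrK.
Qed.

Let eta r t : R := (t - r) `^ gam.

(** A first estimate with rate N only, read off from the controlled expansion at the empty word; the
    words of length N in the Euler map are of the same order. *)
Lemma rde_local : exists2 A : R, 0 <= A & forall r t, a <= r -> r < t -> t <= T -> t - r <= 1 ->
  `|X t - euler_map f N (incr W r t) (X r)| <= A * eta r t ^+ N.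
Proof.
have [c0 c00 Hc] := incr_rough_functional hW.
have [_ [C]] := XX_controlled (leq0n N.-1 : (size ([::] : word) <= N.-1)%N).
rewrite [size _]/= !subn0 => HC.
have N0 := Nreg_gt0; have N1 : (N.-1 <= N)%N by exact: leq_pred.
have kN : (0 + N <= (2 * N + 1).+1)%N by lia.
have [D D0 HD] := hb_euler_step hf Mf0 c00 N1 kN.
exists (`|C| + D); first by rewrite addr_ge0.
move=> r t ar rt tT tr1; have r0 : 0 <= r by exact: le_trans ar.
have tr : 0 < t - r by rewrite subr_gt0.
have rI : r \in `[a, T] by rewrite in_itv /= ar (le_trans (ltW rt)).
have tI : t \in `[a, T] by rewrite in_itv /= tT (le_trans ar) // ltW.
have rf := Hc r t r0 rt tT; set g := incr W r t in rf *.
have [g1 _ _] := rf.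
have e01 : 0 <= eta r t <= 1 by apply: powR_unit => //; rewrite tr.
have en0 : 0 <= eta r t ^+ N by rewrite exprn_ge0 //; case/andP: e01.
have := HC r t ar rt tT; rewrite (gtr0_norm tr) -powR_expn -/(eta r t) XX_nil //.
set S := \sum_(v | _) _ => HS.
rewrite -(subrKA S); apply: le_trans (ler_normD _ _) _; rewrite mulrDl; apply: lerD.
  by apply: le_trans HS _; rewrite ler_wpM2r // ler_norm.
apply: row_norm_le => [|l]; first by rewrite mulr_ge0.
have [_] := HD g (eta r t) l e01 rf; rewrite prednK // => /hb_bound /(_ I).
move=> /(_ (X r)); rewrite !mxE -normrN opprB; congr (`|_| <= _).
have -> : S 0 l = X r 0 l + wsum N.-1 (fun w => xi f l w (X r) * g w).
  rewrite /S summxE.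
  rewrite (eq_bigr (fun w : N.-1.-bseq 'I_d => lies f w (pr l) (X r) * g w)); last first.
    by move=> w _; rewrite mxE cats0 rde_coefficient ?size_bseq // mulrC.
  rewrite (wsum_bseq N.-1 (fun w => lies f w (pr l) (X r) * g w)) -[X in X + _](wsum_indicator (d := d) N.-1) -wsumD.
  apply: eq_wsum => -[|i w] _; first by rewrite g1 mulr1 mul0r addr0.
  by rewrite add0r.
move: (wsum _ _) (X r 0 l) (euler_step _ _ _ _ _) => p q s.
by ring.
Qed.

(** The rate N of [rde_local] is just what [germ_defect] accepts, and sewing the germs raises it to
    N + 1. *)
Theorem rde_davie : exists2 C : R, 0 <= C & davie_path (euler_scheme gam W f) (N.+1%:R * gam) a T C 1 X.
Proof.
have [c0 c00 Hc] := incr_rough_functional hW.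
have [A A0 HA] := rde_local.
have [B B0 HB] := germ_defect hf Mf0 c00.
have N0 := Nreg_gt0; have vt1 := Nreg_gt gam0; rewrite -/N in vt1.
pose G i r t : E := \sum_(w : N.-1.-bseq 'I_d) incr W r t (rcons w i) *: lift_comp (f i) XX r w.
have GE i r t l : r \in `[a, T] -> G i r t 0 l = taylor_germ f N i l (incr W r t) (X r).
  move=> rI; rewrite /G summxE /taylor_germ -wsum_bseq; apply: eq_bigr => w _.
  rewrite mxE lifted_field_coord ?size_bseq // => u m uw; apply: rde_coefficient => //.
  exact: leq_trans uw (size_bseq w).
have C0 : 0 <= B * (1 + A) by rewrite mulr_ge0 // addr_ge0.
have defect i r t : a <= r -> r < t -> t <= T -> t - r <= 1 ->
    `|G i r ((r + t) / 2) + G i ((r + t) / 2) t - G i r t| <= B * (1 + A) * (t - r) `^ (N.+1%:R * gam).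
  move=> ar rt tT tr1; have r0 : 0 <= r by exact: le_trans ar.
  have tr : 0 < t - r by rewrite subr_gt0.
  have /andP[rm mt] := midpoint_lt rt; have [mr tm] := midpoint_sub r t.
  set m := (r + t) / 2 in rm mt mr tm *.
  have am : a <= m by rewrite (le_trans ar) // ltW.
  have mT : m <= T by rewrite (le_trans (ltW mt)).
  have m0 : 0 <= m by exact: le_trans am.
  have e01 : 0 <= eta r t <= 1 by apply: powR_unit => //; rewrite tr.
  have half : (t - r) / 2 <= t - r by rewrite ler_pdivrMr // ler_peMr ?ltW // ltr1n.
  have ehalf : 0 <= ((t - r) / 2) `^ gam <= eta r t.
    by rewrite powR_ge0 /=; apply: ge0_ler_powR; rewrite ?nnegrE ?divr_ge0 // ltW.
  have R1 : rough_functional N c0 (eta r t) (incr W r m).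
    by apply: rough_functional_le c00 ehalf _; rewrite -mr; exact: Hc.
  have R2 : rough_functional N c0 (eta r t) (incr W m t).
    by apply: rough_functional_le c00 ehalf _; rewrite -tm; exact: Hc.
  have Wm : W m [::] = 1 by case: hW => WG _; case: (WG m _) => //; rewrite in_itv /= m0.
  have HA' : `|X m - euler_map f N (incr W r m) (X r)| <= A * eta r t ^+ N.
    apply: le_trans (HA r m ar rm mT _) _; first by rewrite mr (le_trans half).
    rewrite ler_wpM2l // lerXn2r ?nnegrE ?powR_ge0 // /eta mr; by case/andP: ehalf.
  have rI : r \in `[a, T] by rewrite in_itv /= ar (le_trans (ltW rt)).
  have mI : m \in `[a, T] by rewrite in_itv /= am.
  rewrite -powR_expn -/(eta r t); apply: row_norm_le => [|l].
    by rewrite mulr_ge0 // exprn_ge0 // powR_ge0.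
  rewrite !mxE !GE // (incr_chen r t Wm).
  exact: HB e01 R1 R2 A0 HA' N0.
pose K := sewing_const (B * (1 + A)) (N.+1%:R * gam).
have sew i r t : a <= r -> r < t -> t <= T -> t - r <= 1 ->
    `|J i t - J i r - G i r t| <= K * (t - r) `^ (N.+1%:R * gam).
  apply: (sewing vt1 C0 (defect i)) => s sI; exact: J_integral.
have K0 : 0 <= K.
  by rewrite divr_ge0 // subr_ge0 ltW //; have /andP[] := sewing_ratio vt1.
exists (d%:R * K); first by rewrite mulr_ge0.
move=> r t ar rt tT tr1.
have rI : r \in `[a, T] by rewrite in_itv /= ar (le_trans (ltW rt)).
have tI : t \in `[a, T] by rewrite in_itv /= tT (le_trans ar) // ltW.
(* Sorting the words of the Euler step by their last letter makes it the sum over i of the germs. *)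
have -> : X t - euler_scheme gam W f r t (X r) = \sum_(i < d) (J i t - J i r - G i r t).
  rewrite big_split /= -(XX_increment (w := [::]) ar rt tT) // !XX_nil // -addrA; congr (_ + _).
  apply/rowP => l; rewrite [LHS]mxE [RHS]mxE summxE [(- X r) 0 l]mxE /euler_scheme euler_map_coord opprD.
  congr (_ + _); rewrite (eq_bigr (fun i => - taylor_germ f N i l (incr W r t) (X r))); last first.
    by move=> i _; rewrite mxE GE.
  rewrite sumrN; congr (- _); rewrite /euler_step -[X in wsum X](prednK N0) wsum_rcons mul0r add0r.
  by apply: eq_bigr => i _; apply: eq_wsum => w _; rewrite mulrC; congr (_ * _); case: w.
apply: le_trans (ler_norm_sum _ _ _) _.
apply: (@le_trans _ _ (\sum_(i < d) K * (t - r) `^ (N.+1%:R * gam))).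
  by apply: ler_sum => i _; exact: sew.
rewrite sumr_const card_ord -[_ *+ d]mulr_natl mulrA. exact: lexx.
Qed.

End RdeDavie.

(** * The transport equation *)

Section Transport.
Context {R : realType} {n d : nat}.
Local Notation E := 'rV[R]_n.
Local Notation word := (word d).
Implicit Types (phi : E -> R) (x y : E).

Definition norm_ball (rho : R) : set E := [set x | `|x| <= rho]%classic.

Lemma norm_ball_convex rho : convex_set (norm_ball rho).
Proof.
move=> x y t; rewrite /norm_ball /= => Sx Sy /andP[t0 t1].
rewrite (_ : x + t *: (y - x) = (1 - t) *: x + t *: y); last first.
  by rewrite scalerBr scalerBl scale1r addrA addrAC.
apply: le_trans (ler_normD _ _) _; rewrite !normrZ !ger0_norm ?subr_ge0 //.
rewrite (_ : rho = (1 - t) * rho + t * rho); last by ring.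
by apply: lerD; rewrite ler_wpM2l // subr_ge0.
Qed.

Lemma norm_ball_compact rho : compact (norm_ball rho).
Proof.
apply: bounded_closed_compact.
  by exists rho; split; [exact: num_real|move=> M rM x; rewrite /norm_ball /= => /le_trans; apply; exact: ltW].
rewrite (_ : norm_ball rho = ((Num.norm : E -> R) @^-1` [set z | z <= rho])%classic) //.
by apply: closed_comp; [move=> x _; exact: norm_continuous|exact: closed_le].
Qed.

Lemma compact_subset_ball (K : set E) : compact K -> exists2 rho : R, 0 <= rho & forall x, K x -> norm_ball rho x.
Proof.
move=> /compact_bounded [M [_ HM]]; exists (`|M| + 1); first by rewrite addr_ge0.
by move=> x Kx; apply: (HM (`|M| + 1)) => //; rewrite ltr_pwDr // ler_norm.
Qed.

Lemma smooth_partials j js phi : smooth (j + size js) phi -> smooth j (partials js phi).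
Proof.
by move=> sp; rewrite /partials; apply: smooth_iterD; rewrite size_map.
Qed.

Lemma smooth_bounded_on_ball k phi rho : smooth k phi ->
  exists2 C : R, 0 <= C & hb 0 k (norm_ball rho) C phi.
Proof.
move=> sp; apply: hb_of_local_bounds => // js jk.
have sj : smooth 0 (partials js phi) by apply: smooth_partials; apply: hb_order sp.
have := @norm_ball_compact rho.
move=> /(continuous_compact (continuous_subspaceT (smooth_continuous sj))) /compact_bounded [M [_ HM]].
exists (`|M| + 1) => x Sx; apply: (HM (`|M| + 1)); first by rewrite ltr_pwDr // ler_norm.
by exists x.
Qed.

Section LieSums.
Variables (f : 'I_d -> E -> E) (K : nat) (Mf : R).
Hypothesis hf : forall i m, hb 0 K setT Mf (fun x => f i x 0 m).
Hypothesis Mf0 : 0 <= Mf.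

Lemma smooth_lies j (w : word) phi : (j + size w <= K.+1)%N -> smooth (j + size w) phi -> smooth j (lies f w phi).
Proof.
move=> jw sp; exact: hb_smooth (hb_lies hf Mf0 jw (lexx 0) sp).
Qed.

Lemma lies_sum (w : word) (I : Type) (r : seq I) (h : I -> E -> R) : (size w <= K.+1)%N ->
  (forall i, smooth (size w) (h i)) ->
  lies f w (fun x => \sum_(i <- r) h i x) = fun x => \sum_(i <- r) lies f w (h i) x.
Proof.
elim: w => [//|a w IH] wK sh.
rewrite /= IH; [|exact: ltnW|by move=> i; apply: hb_order (sh i)].
apply/funext => x; apply: lie_sum => i; apply: (@smooth_differentiable _ _ 0).
exact: smooth_lies.
Qed.

Lemma liesZ (w : word) c phi : (size w <= K.+1)%N -> smooth (size w) phi ->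
  lies f w (fun x => c * phi x) = fun x => c * lies f w phi x.
Proof.
elim: w => [//|a w IH] wK sp.
rewrite /= IH; [|exact: ltnW|by apply: hb_order sp].
apply/funext => x; apply: lieZ; apply: (@smooth_differentiable _ _ 0).
exact: smooth_lies.
Qed.

Lemma liesB (w : word) phi psi : (size w <= K.+1)%N -> smooth (size w) phi -> smooth (size w) psi ->
  lies f w (fun x => phi x - psi x) = fun x => lies f w phi x - lies f w psi x.
Proof.
elim: w => [//|a w IH] wK sp sq.
rewrite /= IH; [|exact: ltnW|by apply: hb_order sp|by apply: hb_order sq].
apply/funext => x; apply: lieB; apply: (@smooth_differentiable _ _ 0); exact: smooth_lies.
Qed.

Lemma lies_taylor m (w : word) phi psi (g : word -> R) x : (m + size w <= K.+1)%N ->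
  smooth (m + size w) phi -> smooth (size w) psi ->
  lies f w (fun y => psi y - wsum m (fun v => lies f v phi y * g v)) x =
  lies f w psi x - wsum m (fun v => lies f (w ++ v) phi x * g v).
Proof.
move=> mK sp sq; have wK : (size w <= K.+1)%N by apply: leq_trans mK; exact: leq_addl.
have sl (v : m.-bseq 'I_d) : smooth (size w) (lies f v phi).
  apply: smooth_lies; last by apply: hb_order sp; rewrite addnC leq_add2r size_bseq.
  by apply: leq_trans mK; rewrite addnC leq_add2r size_bseq.
have E1 : (fun y => wsum m (fun v => lies f v phi y * g v)) =
    fun y => \sum_(v : m.-bseq 'I_d) g v * lies f v phi y.
  apply/funext => y; rewrite -(wsum_bseq m (fun v => lies f v phi y * g v)).
  by apply: eq_bigr => v _; rewrite mulrC.
have sE : smooth (size w) (fun y => wsum m (fun v => lies f v phi y * g v)).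
  by rewrite E1; apply: smooth_sum => v; apply: smoothZ.
rewrite (@liesB w psi (fun y => wsum m (fun v => lies f v phi y * g v))) //; congr (_ - _).
rewrite E1 lies_sum //; last by move=> v; apply: smoothZ.
rewrite -wsum_bseq; apply: eq_bigr => v _; rewrite liesZ // lies_cat mulrC //.
Qed.

End LieSums.

Variables (gam T : R) (W : R -> word -> R).
Hypothesis gam0 : 0 < gam.
Hypothesis gam1 : gam < 1.
Hypothesis hW : geometric_rough_path gam T W.
Let N := Nreg gam.
Variables (f : 'I_d -> E -> E) (Mf : R).
Hypothesis hf : forall i m, hb 0 (2 * N + 1) setT Mf (fun x => f i x 0 m).
Hypothesis Mf0 : 0 <= Mf.
Variables (flow : R -> E -> R -> E) (h0 L D : R).
Hypothesis h01 : 0 < h0 <= 1.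
Hypothesis L0 : 0 <= L.
Hypothesis D0 : 0 <= D.
Hypothesis flow_euler : forall s t, 0 <= s -> s < t -> t <= T -> t - s <= h0 -> forall l,
  hb 0 N setT (L * (t - s) `^ (N.+1%:R * gam)) (fun x => flow s x t 0 l - euler_scheme gam W f s t x 0 l).
Hypothesis flow_increment : forall s t, 0 <= s -> s < t -> t <= T -> t - s <= h0 -> forall l,
  hb 0 N.+1 setT (D * (t - s) `^ gam) (fun x => flow s x t 0 l - x 0 l).
Hypothesis flow_init : forall s x, 0 <= s <= T -> flow s x s = x.
Hypothesis flow_comp : forall s r x, 0 <= s -> s <= r -> r <= T -> flow s x T = flow r (flow s x r) T.
Variable g : E -> R.
Hypothesis sg : smooth N.+1 g.
Hypothesis T0 : 0 <= T.

Let u s x := g (flow s x T).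

(** Steps short enough for flow and Euler map to move points by at most 1 and to be near-identity
    with constant 1. The last bound makes their distance an admissible eps in [hb_comp_diff]. *)
Lemma flow_step : exists2 h : R, 0 < h <= h0 & forall s t, 0 <= s -> s < t -> t <= T -> t - s <= h ->
  [/\ near_id 0 N.+1 setT 1 (fun x => flow s x t), near_id 0 N.+1 setT 1 (euler_scheme gam W f s t),
      (forall x, `|flow s x t - x| <= D * (t - s) `^ gam /\ D * (t - s) `^ gam <= 1),
      (forall x, `|euler_scheme gam W f s t x - x| <= 1) &
      L * (t - s) `^ (N.+1%:R * gam) <= 1].
Proof.
have [c c0 Hc] := euler_scheme_step gam0 gam1 hW hf Mf0.
have n1 : 0 < 1 + n%:R :> R by rewrite ltr_pwDl.
have Ng : 0 < N.+1%:R * gam by rewrite mulr_gt0.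
have [h1 /andP[h10 h11] H1] := small_powR (mulr_ge0 (ltW n1) D0) gam0 ltr01.
have [h2 /andP[h20 h21] H2] := small_powR (mulr_ge0 (ltW n1) c0) gam0 ltr01.
have [h3 /andP[h30 h31] H3] := small_powR L0 Ng ltr01.
have /andP[h00 h01'] := h01.
exists (Num.min (Num.min h0 h1) (Num.min h2 h3)); first by rewrite !lt_min h00 h10 h20 h30 !ge_min lexx.
move=> s t s0 st tT; rewrite !le_min => /andP[/andP[ts0 ts1] /andP[ts2 ts3]].
have ts : 0 <= t - s by rewrite subr_ge0 ltW.
have ts11 : t - s <= 1 by exact: le_trans ts0 h01'.
have {}H1 := H1 (t - s) (ltac:(by rewrite ts ts1)).
have {}H2 := H2 (t - s) (ltac:(by rewrite ts ts2)).
have {}H3 := H3 (t - s) (ltac:(by rewrite ts ts3)).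
rewrite -mulrA in H1; rewrite -mulrA in H2.
have d0 : 0 <= D * (t - s) `^ gam by rewrite mulr_ge0 ?powR_ge0.
have e0 : 0 <= c * (t - s) `^ gam by rewrite mulr_ge0 ?powR_ge0.
have le1 (b : R) : 0 <= b -> (1 + n%:R) * b <= 1 -> b <= 1.
  by move=> b0; apply: le_trans; rewrite ler_peMl // lerDl.
have d1 := le1 _ d0 H1; have e1 := le1 _ e0 H2.
have HF := flow_increment s0 st tT ts0; have HE l := hbS (Hc s t s0 st tT ts11 l).
split=> //.
- exact: near_id_of_hb d0 H1 HF.
- exact: near_id_of_hb e0 H2 HE.
- move=> x; split=> //; apply: row_norm_le => // l.
  by rewrite !mxE; exact: (hb_bound (HF l) I).
move=> x; apply: le_trans e1; apply: row_norm_le => // l.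
have := hb_bound (HE l) (I : setT x); by rewrite !mxE.
Qed.

Lemma near_id_sub th k (S S' : set E) eta B : (forall x, S' x -> S x) -> near_id th k S eta B ->
  near_id th k S' eta B.
Proof.
by move=> SS [H1 H2]; split=> [l|x y S'x S'y]; [exact: hbW SS (lexx _) (H1 l)|apply: H2; exact: SS].
Qed.

(** The datum g is bounded on balls only. Going back from T in steps of length h, each step composes
    with a near-identity map that moves points by at most 1, so a bound on radius rho comes from one
    on radius rho + 1. *)
Lemma transport_bound rho : exists2 C : R, 0 <= C & forall s, 0 <= s <= T -> hb 0 N.+1 (norm_ball rho) C (u s).
Proof.
have [h /andP[hp hh0] Hh] := flow_step.
have [Kc Kc0 HC] := @hb_comp R n N.+1.
(* The radius is quantified inside the induction, as the inductive step enlarges it. *)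
suff H k : forall rho, exists2 C : R, 0 <= C & forall s, 0 <= s <= T -> T - s <= k%:R * h ->
    hb 0 N.+1 (norm_ball rho) C (u s).
  have [C C0 HC'] := H (Num.truncn (T / h)).+1 rho; exists C => // s sT.
  apply: HC' => //; apply: (@le_trans _ _ T); first by rewrite gerBl; case/andP: sT.
  by rewrite -ler_pdivrMr // ltW // truncnS_gt.
elim: k => [|k IH] {}rho.
  have [C C0 HC'] := smooth_bounded_on_ball rho sg; exists C => // s /andP[s0 sT].
  rewrite mul0r subr_le0 => Ts; have -> : s = T by apply/eqP; rewrite eq_le sT.
  by apply: hb_ext HC'; apply/funext => x; rewrite /u flow_init // lexx T0.
have [C C0 HC'] := IH rho; have [C1 C10 HC1] := IH (rho + 1).
have K10 : 0 <= (1 + Kc * 1) * C1 by rewrite mulr1 mulr_ge0 // addr_ge0.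
exists (C + (1 + Kc * 1) * C1); first by rewrite addr_ge0.
move=> s sI; have /andP[s0 sT] := sI => Tk.
have [Ts|kT] := leP (T - s) (k%:R * h).
  by apply: hb_le (HC' s sI Ts); rewrite lerDl.
have sT' : s < T by rewrite -subr_gt0; apply: le_lt_trans kT; rewrite mulr_ge0 // ltW.
pose r := Num.min (s + h) T.
have sr : s < r by rewrite lt_min sT' ltrDl hp.
have rT : r <= T by rewrite ge_min lexx orbT.
have rh : r - s <= h by rewrite lerBlDl ge_min lexx.
have Tr : T - r <= k%:R * h.
  rewrite lerBlDr -lerBlDl le_min lerBlDl lerBlDr; apply/andP; split.
    by move: Tk; rewrite -natr1 mulrDl mul1r lerBlDr -addrA [h + s]addrC.
  by rewrite lerDl mulr_ge0 // ltW.
have [nF _ HF _ _] := Hh s r s0 sr rT rh.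
have rI : 0 <= r <= T by rewrite rT andbT (le_trans s0) // ltW.
apply: (@hb_ext _ _ _ _ _ _ (fun x => u r (flow s x r))).
  by apply/funext => x; rewrite /u (flow_comp x s0 (ltW sr) rT).
have := HC 0 (norm_ball rho) (norm_ball (rho + 1)) C1 1 (u r) (fun x => flow s x r).
rewrite !lexx ler01 => /(_ isT C10 isT) H.
apply: hb_le (H _ (near_id_sub _ nF) (HC1 r rI Tr)) => //; first by rewrite lerDr.
move=> x; rewrite /norm_ball /= => xr; have [H1 H2] := HF x.
rewrite -(subrK x (flow s x r)) addrC; apply: le_trans (ler_normD _ _) _.
by apply: lerD => //; exact: le_trans H2.
Qed.

Lemma flow_in_ball rho x (B : E) : norm_ball rho x -> `|B - x| <= 1 -> norm_ball (rho + 1) B.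
Proof.
rewrite /norm_ball /= => xr Bx; rewrite -(subrK x B) addrC.
by apply: le_trans (ler_normD _ _) _; apply: lerD.
Qed.

Lemma transport_flow s t x : 0 <= s -> s <= t -> t <= T -> u s x = u t (flow s x t).
Proof. by move=> s0 st tT; rewrite /u (flow_comp x s0 st tT). Qed.

(** For steps longer than h a uniform bound becomes a bound with the required power, at the cost of
    the factor h^(-r). *)
Lemma powR_ratio (h e r : R) : 0 < h -> h <= e -> 0 <= r -> 1 <= (h `^ r)^-1 * e `^ r.
Proof.
move=> h_gt0 he r0; rewrite mulrC ler_pdivlMr ?powR_gt0 // mul1r.
by apply: ge0_ler_powR; rewrite ?nnegrE //; [exact: ltW|rewrite (le_trans (ltW h_gt0))].
Qed.

Lemma transport_hoelder rho : exists2 C : R, 0 <= C & forall s t x, 0 <= s <= T -> 0 <= t <= T ->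
  norm_ball rho x -> `|u t x - u s x| <= C * `|t - s| `^ gam.
Proof.
have [h /andP[hp hh0] Hh] := flow_step.
have [C C0 HC] := transport_bound rho; have [C1 C10 HC1] := transport_bound (rho + 1).
have A0 : 0 <= n%:R * C1 * D by rewrite !mulr_ge0.
have B0 : 0 <= (C + C) * (h `^ gam)^-1 by rewrite mulr_ge0 ?addr_ge0 // invr_ge0 powR_ge0.
exists (n%:R * C1 * D + (C + C) * (h `^ gam)^-1); first by rewrite addr_ge0.
suff H s t x : 0 <= s -> s < t -> t <= T -> norm_ball rho x ->
    `|u t x - u s x| <= (n%:R * C1 * D + (C + C) * (h `^ gam)^-1) * (t - s) `^ gam.
  move=> s t x /andP[s0 sT] /andP[t0 tT] xr; have [st|ts|->] := ltgtP s t.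
  - by rewrite (gtr0_norm (x := t - s)) ?subr_gt0 //; exact: H.
  - by rewrite distrC (distrC t) (gtr0_norm (x := s - t)) ?subr_gt0 //; exact: H.
  - by rewrite subrr normr0 mulr_ge0 ?powR_ge0 // addr_ge0.
move=> s0 st tT xr.
have sI : 0 <= s <= T by rewrite s0 (le_trans (ltW st)).
have tI : 0 <= t <= T by rewrite tT (le_trans s0) // ltW.
have p0 := powR_ge0 (t - s) gam.
rewrite mulrDl; have [ts|hts] := leP (t - s) h.
  rewrite -[leLHS]addr0; apply: lerD; last by rewrite mulr_ge0.
  have [_ _ HF _ _] := Hh s t s0 st tT ts; have [H1 H2] := HF x.
  rewrite (transport_flow x s0 (ltW st) tT) distrC.
  have Ht := HC1 t tI.
  have x1 : norm_ball (rho + 1) x by apply: le_trans xr _; rewrite lerDl.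
  have F1 : norm_ball (rho + 1) (flow s x t) by apply: flow_in_ball xr _ => //; exact: le_trans H2.
  apply: le_trans (@lipschitz_of_pd _ _ (norm_ball (rho + 1)) (u t) C1 _ C10 (@norm_ball_convex _) _ _ _ F1 x1) _.
  - by move=> z; exact: hb_differentiable Ht.
  - by move=> z l Sz; exact: hb_bound (hb_pd l Ht) Sz.
  - by rewrite -(mulrA _ D) ler_wpM2l // mulr_ge0.
rewrite -[leLHS]add0r; apply: lerD; first by rewrite mulr_ge0.
apply: le_trans (ler_normB _ _) _; apply: le_trans (lerD (hb_bound (HC t tI) xr) (hb_bound (HC s sI) xr)) _.
rewrite -mulrA -[leLHS]mulr1 ler_wpM2l ?addr_ge0 //.
by apply: powR_ratio => //; exact: ltW.
Qed.

(** The expansion is proved first for the empty prefix, with an error in C^|w|, and Gamma_w is then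
    applied to the error. This divides the N + 1 derivatives of u_t into |w| for Gamma_w and m = N +
    1 - |w| for the order of the expansion. *)
Lemma transport_expansion rho (w : word) : (size w <= N)%N -> exists C : R,
  forall s t x, 0 <= s -> s < t -> t <= T -> norm_ball rho x ->
  `|lies f w (u s) x - wsum (N - size w) (fun v => lies f (w ++ v) (u t) x * incr W s t v)|
  <= C * `|t - s| `^ ((N.+1 - size w)%:R * gam).
Proof.
move=> wN; have [c0 c00 Hc] := incr_rough_functional hW.
have [h /andP[hp hh0] Hh] := flow_step.
have [C C0 HC] := transport_bound rho; have [C1 C10 HC1] := transport_bound (rho + 1).
have h1 : h <= 1 by case/andP: h01 => _; exact: le_trans.
set k := size w in wN *; pose m := (N.+1 - k)%N.
have mE : m = (N - k).+1 by rewrite /m subSn.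
have mk : (m + k = N.+1)%N by rewrite subnK // leqW.
have mN : (m <= N.+1)%N by exact: leq_subr.
have kN : (k + N <= (2 * N + 1).+1)%N by move: wN; clear; lia.
have wK : (0 + size w <= (2 * N + 1).+1)%N by move: wN; rewrite /k; clear; lia.
have [Bk Bk0 HB] := hb_bracket hf Mf0 c00 mN kN.
have [Kd Kd0 HD] := @hb_comp_diff R n k.
have lc0 := @lie_const_ge0 R n (2 * N + 1) Mf Mf0.
set lc := lie_const (n := n) (2 * N + 1) Mf in lc0.
set r := m%:R * gam.
have r0 : 0 <= r by rewrite mulr_ge0 // ltW.
(* Constant for steps of length at most h; lc^k is the price of Gamma_w. *)
pose Q1 := lc ^+ k * (Kd * C1 * L + Bk * C1).
have Q10 : 0 <= Q1 by rewrite mulr_ge0 ?exprn_ge0 // addr_ge0 // !mulr_ge0.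
pose M := (1 + lc) ^+ N * C.
have M0 : 0 <= M by rewrite mulr_ge0 // exprn_ge0 // addr_ge0.
pose I := c0 * (1 + T `^ gam) ^+ N.
have T1 : 1 <= 1 + T `^ gam by rewrite lerDl powR_ge0.
have I0 : 0 <= I by rewrite mulr_ge0 // exprn_ge0 // (le_trans ler01).
(* Constant for longer steps, where each term is bounded separately: M bounds the Lie derivatives of
   u on the ball and I the increments of W. *)
pose Q2 := M + (1 + d%:R) ^+ (N - k) * (M * I).
have Q20 : 0 <= Q2 by rewrite addr_ge0 // mulr_ge0 ?one_dge0 // mulr_ge0.
exists (Q1 + Q2 * (h `^ r)^-1) => s t x s0 st tT xr.
have sI : 0 <= s <= T by rewrite s0 (le_trans (ltW st)).
have tI : 0 <= t <= T by rewrite tT (le_trans s0) // ltW.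
have ts0 : 0 < t - s by rewrite subr_gt0.
have rf := Hc s t s0 st tT.
rewrite (gtr0_norm ts0) -/m -/r mulrDl.
have p0 := powR_ge0 (t - s) r.
have hr0 : 0 <= (h `^ r)^-1 by rewrite invr_ge0 powR_ge0.
have [ts|hts] := leP (t - s) h; last first.
  rewrite -[leLHS]add0r; apply: lerD; first by rewrite mulr_ge0.
  have bound (v : word) y (a : R) : (size v <= N)%N -> norm_ball rho y -> 0 <= a <= T -> `|lies f v (u a) y| <= M.
    move=> vN yr aI; have vK : (0 + size v <= (2 * N + 1).+1)%N by move: vN; clear; lia.
    have vC : hb 0 (0 + size v) (norm_ball rho) C (u a) by apply: hb_order (HC a aI); rewrite add0n leqW.
    apply: le_trans (hb_bound (hb_lies hf Mf0 vK C0 vC) yr) _.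
    rewrite ler_wpM2r // (@le_trans _ _ ((1 + lc) ^+ size v)) //; last by rewrite ler_weXn2l // lerDl.
    by rewrite lerXn2r ?nnegrE ?addr_ge0 // lerDr.
  apply: (@le_trans _ _ Q2); last first.
    rewrite -mulrA -[leLHS]mulr1 ler_wpM2l //; apply: powR_ratio => //; exact: ltW.
  apply: le_trans (ler_normB _ _) _; apply: lerD; first exact: bound.
  apply: wsum_norm => v vN; rewrite normrM.
  have wvN : (size (w ++ v) <= N)%N by rewrite size_cat -(subnKC wN) leq_add2l.
  apply: ler_pM => //; first exact: bound.
  have [_ gw _] := rf; have vN' : (size v <= N)%N by apply: leq_trans vN (leq_subr _ _).
  apply: le_trans (gw v vN') _; rewrite ler_wpM2l //.
  apply: (@le_trans _ _ ((1 + T `^ gam) ^+ size v)); last by rewrite ler_weXn2l.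
  rewrite lerXn2r ?nnegrE ?powR_ge0 ?(le_trans ler01) //.
  apply: (@le_trans _ _ (T `^ gam)); last by rewrite lerDr.
  by apply: ge0_ler_powR; rewrite ?nnegrE //; [exact: ltW|exact: ltW|rewrite (le_trans _ tT) // gerBl].
rewrite -[leLHS]addr0; apply: lerD; last by rewrite !mulr_ge0.
have [nF nE HF HE eps1] := Hh s t s0 st tT ts.
have ts1 : t - s <= 1 by exact: le_trans ts h1.
have eta01 : 0 <= (t - s) `^ gam <= 1 by apply: powR_unit; rewrite ?ts0.
have Ht := HC1 t tI; have tsh0 : t - s <= h0 by exact: le_trans ts hh0.
pose S := norm_ball rho; pose S1 := norm_ball (rho + 1).
have S1F y : S y -> S1 (flow s y t).
  by move=> yr; apply: flow_in_ball yr _ => //; have [H1 H2] := HF y; exact: le_trans H2.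
have S1E y : S y -> S1 (euler_scheme gam W f s t y).
  by move=> yr; apply: flow_in_ball yr _ => //; exact: HE.
have toT y : S y -> setT y by [].
have kN1 : (k <= N.+1)%N by rewrite leqW.
have eps0 : 0 <= L * (t - s) `^ (N.+1%:R * gam) by rewrite mulr_ge0 ?powR_ge0.
have zero01 : 0 <= (0 : R) <= 1 by rewrite lexx ler01.
(* The flow is replaced by the Euler map in C^k. This uses k + 1 <= N + 1 derivatives of u_t, and th
   = 0 keeps the full rate (N + 1) gam. *)
have A1 := HD 0 S S1 C1 (L * (t - s) `^ (N.+1%:R * gam)) (u t) (euler_scheme gam W f s t)
  (fun y => flow s y t) zero01 C10 (ltac:(by rewrite eps0 eps1)) (@norm_ball_convex _) S1E S1F
  (near_id_order kN1 (near_id_sub toT nE)) (near_id_order kN1 (near_id_sub toT nF))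
  (fun l => hb_order wN (hbW toT (lexx _) (flow_euler s0 st tT tsh0 l)))
  (hb_order (wN : (k.+1 <= N.+1)%N) Ht).
have S1L y z : S y -> 0 <= z <= 1 -> S1 (y + z *: \row_l euler_step f N (incr W s t) l y).
  move=> yr /andP[z0 z1]; apply: flow_in_ball yr _; rewrite addrAC subrr add0r normrZ (ger0_norm z0).
  rewrite -[leRHS]mulr1; apply: ler_pM => //; apply: le_trans (HE y).
  by rewrite le_eqVlt; apply/orP; left; apply/eqP; congr (`|_|); apply/rowP => l; rewrite !mxE addrAC subrr add0r.
(* Expansion of u_t after the Euler step, of order m in C^k. *)
have A2 := HB S1 S C1 ((t - s) `^ gam) (u t) (incr W s t) C10 eta01 rf S1L (hb_order (eq_leq mk) Ht).
have A := hbD A1 A2.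
have sut : smooth N.+1 (u t) := hb_smooth Ht.
have sus : smooth N.+1 (u s) := hb_smooth (HC s sI).
have Q3 : Kd * C1 * (L * (t - s) `^ (N.+1%:R * gam)) `^ (1 - 0) + Bk * C1 * ((t - s) `^ gam) ^+ m
    <= (Kd * C1 * L + Bk * C1) * (t - s) `^ r.
  rewrite subr0 powRr1 // mulrDl powR_expn; apply: lerD => //.
  rewrite mulrA ler_wpM2l ?mulr_ge0 // ger_powR ?ts0 // ler_wpM2r ?(ltW gam0) // ler_nat //.
have {}A := hb_le Q3 A.
have Q30 : 0 <= (Kd * C1 * L + Bk * C1) * (t - s) `^ r by rewrite mulr_ge0 // addr_ge0 // !mulr_ge0.
(* By linearity Gamma_w of the error is the expression to be bounded, the prefix w passing into the
   words. *)
rewrite -(lies_taylor (K := (2 * N + 1)%N) hf Mf0 (incr W s t) x).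
- have := hb_bound (hb_lies (k := 0) hf Mf0 wK Q30 (S := S) (phi := fun y => u s y - wsum (N - k) (fun v => lies f v (u t) y * incr W s t v)) _) xr.
  rewrite mulrA; apply; apply: hb_ext A; apply/funext => y.
  by rewrite mE /= (transport_flow y s0 (ltW st) tT) addrA subrK.
- by rewrite subnK //; move: wN; clear; lia.
- by apply: hb_order sut; rewrite subnK.
by apply: hb_order sus.
Qed.

End Transport.

Theorem theorem4p3 (R : realType) (d n : nat) (hd : (0 < d)%N) (hn : (0 < n)%N)
    (T : R) (hT : 0 < T) (gam : R) (hgam0 : 0 < gam) (hgam1 : gam < 1)
    (W : R -> word d -> R) (hW : geometric_rough_path gam T W)
    (f : 'I_d -> 'rV[R]_n -> 'rV[R]_n)
    (hf : forall i, classCb (2 * Nreg gam + 1) (f i))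
    (g : 'rV[R]_n -> R) (hg : classC (Nreg gam).+1 g)
    (X : R -> 'rV[R]_n -> R -> 'rV[R]_n)
    (hX : forall s x, s \in `[0, T] -> rde_solution gam W f s T x (X s x)) :
  regular_solution gam T W f g (fun s x => g (X s x T)).
Proof.
have N2 : (Nreg gam <= (2 * Nreg gam + 1).+1)%N.
  by rewrite leqW // (leq_trans _ (leq_addr _ _)) // leq_pmull.
have cf i : classC (2 * Nreg gam + 1) (f i) by case: (hf i).
have [Mf Mf0 hbf] := hb_of_classCb hf.
have X_init s x : 0 <= s <= T -> X s x s = x.
  by move=> sI; have [] := hX s x (ltac:(by rewrite in_itv)).
(* The constant C depends on s and x through the controlled path of the solution. *)
have X_davie s x : 0 <= s <= T -> exists2 C : R, 0 <= C &
    davie_path (euler_scheme gam W f) ((Nreg gam).+1%:R * gam) s T C 1 (X s x).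
  move=> sI; have [_ [XX [H1 H2 H3 [J [H4 H5]]]]] := hX s x (ltac:(by rewrite in_itv)).
  by case/andP: sI => s0 _; exact: (rde_davie (X := X s x) hgam0 hgam1 hW hbf Mf0 cf s0 H1 H2 H3 H4 H5).
have [h0 [L [D [[h01 L0 D0 close] X_comp]]]] := flow_close hgam0 hgam1 hW hbf Mf0 X_init X_davie.
have X_euler s t : 0 <= s -> s < t -> t <= T -> t - s <= h0 -> forall l,
    hb 0 (Nreg gam) setT (L * (t - s) `^ ((Nreg gam).+1%:R * gam))
      (fun x => X s x t 0 l - euler_scheme gam W f s t x 0 l).
  by move=> s0 st tT ts l; case: (close s t s0 st tT ts l).
have X_incr s t : 0 <= s -> s < t -> t <= T -> t - s <= h0 -> forall l,
    hb 0 (Nreg gam).+1 setT (D * (t - s) `^ gam) (fun x => X s x t 0 l - x 0 l).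
  by move=> s0 st tT ts l; case: (close s t s0 st tT ts l).
have sg := classC_smooth hg; have T0 := ltW hT.
have bound := transport_bound hgam0 hgam1 hW hbf Mf0 h01 L0 D0 X_incr X_init X_comp sg T0.
have smooth_u s : 0 <= s <= T -> smooth (Nreg gam).+1 (fun x => g (X s x T)).
  by move=> sI; have [C _ HC] := bound 0; exact: hb_smooth (HC s sI).
split.
- split=> [K /compact_subset_ball[rho _ Kr]|s|K js /compact_subset_ball[rho _ Kr] jN].
  + have [C _ HC] := transport_hoelder hgam0 hgam1 hW hbf Mf0 h01 L0 D0 X_incr X_init X_comp sg T0 rho.
    by exists C => s t x; rewrite !in_itv /= => sI tI Kx; apply: HC => //; exact: Kr.
  + by move=> sI; apply: smooth_classC; apply: smooth_u; move: sI; rewrite in_itv.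
  + have [C _ HC] := bound rho; exists C => s x; rewrite in_itv /= => sI Kx.
    exact: partials_le (HC s sI) jN (Kr x Kx).
- by move=> x; rewrite X_init // lexx T0.
move=> w K wN /compact_subset_ball[rho _ Kr].
have [C HC] := transport_expansion hgam0 hgam1 hW hbf Mf0 h01 L0 D0 X_euler X_incr X_init X_comp sg T0 rho wN.
exists C => s t x s0 st tT Kx.
have sI : 0 <= s <= T by rewrite s0 (le_trans (ltW st)).
have tI : 0 <= t <= T by rewrite tT (le_trans s0) // ltW.
have := HC s t x s0 st tT (Kr x Kx); rewrite -wsum_bseq.
rewrite (Gamw_lies hbf Mf0) //; last 2 first.
- exact: leq_trans wN N2.
- by apply: hb_order (smooth_u s sI); exact: leqW.
congr (`|_ - _| <= _); apply: eq_bigr => v _.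
have wv : (size (w ++ v) <= Nreg gam)%N by rewrite size_cat -leq_subRL // size_bseq.
rewrite (Gamw_lies hbf Mf0) //; first exact: leq_trans wv N2.
by apply: hb_order (smooth_u t tI); exact: leqW.
Qed.
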